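(* Let $0<\sigma\le 32\pi^2$. For $\alpha>0$ and an integer $m\ge 1$ let $$F_m(u)=\int_B |x|^\alpha\left(e^{\sigma u^2}-\sum_{k=0}^m\frac{\sigma^k u^{2k}}{k!}\right)dx$$ and $$T_{\alpha,m}=\sup_{u\in H^2_{\mathcal N}(B),\ \|\Delta u\|_2=1}F_m(u),\qquad T^{\mathrm{rad}}_{\alpha,m}=\sup_{u\in H^2_{\mathcal N,\mathrm{rad}}(B),\ \|\Delta u\|_2=1}F_m(u),$$ $$T^{0}_{\alpha,m}=\sup_{u\in H^2_{0}(B),\ \|\Delta u\|_2=1}F_m(u),\qquad T^{0,\mathrm{rad}}_{\alpha,m}=\sup_{u\in H^2_{0,\mathrm{rad}}(B),\ \|\Delta u\|_2=1}F_m(u).$$ Then there exists a threshold $\alpha^*>0$ such that for all $\alpha>\alpha^*$, $$T^{\mathrm{rad}}_{\alpha,m}<T_{\alpha,m}\quad\text{and}\quad T^{0,\mathrm{rad}}_{\alpha,m}<T^0_{\alpha,m}\qquad\text{for any integer } m\ge 1.$$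
   Context: $B\subset\mathbb R^4$ is the open unit ball centered at the origin. $H^2_{\mathcal N}(B)=H^1_0(B)\cap H^2(B)$ (Navier boundary conditions), $H^2_0(B)$ is the closure of $C_c^\infty(B)$ in $H^2(B)$ (Dirichlet boundary conditions); functions are real-valued, and the subscript $\mathrm{rad}$ denotes the subspace of radially symmetric functions. $\|\cdot\|_2$ is the norm of $L^2(B)$. *)

(* Defs.v *)
From HB Require Import structures.
From mathcomp Require Import all_boot all_order all_algebra.
From mathcomp Require Import all_classical all_reals all_analysis.
Set Implicit Arguments.
Unset Strict Implicit.
Unset Printing Implicit Defensive.
Import Order.TTheory GRing.Theory Num.Theory.
Import numFieldNormedType.Exports.
Local Open Scope classical_set_scope.
Local Open Scope ring_scope.

(* R^4 is the iterated product ((R * R) * R) * R, whose product topology and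
   product (Borel) sigma-algebra are the usual ones.  [measurableTypeR R] is
   [R] with the sigma-algebra on which [lebesgue_measure] is defined.  The
   library norm on this product is the sup norm; the Euclidean norm is
   [enorm] below. *)
Notation R4 R := (measurableTypeR R * measurableTypeR R * measurableTypeR R
                  * measurableTypeR R)%type.

Definition lebesgue4 {R : realType} : set (R4 R) -> \bar R :=
  (@lebesgue_measure R \x @lebesgue_measure R \x @lebesgue_measure R
   \x @lebesgue_measure R)%E.
HB.instance Definition _ (R : realType) := Measure.on (@lebesgue4 R).

Section SobolevBall.
Context {R : realType}.
Implicit Types (u w phi : R4 R -> R) (x : R4 R) (s : seq 'I_4).

Definition coord4 x (i : 'I_4) : R := tnth [tuple x.1.1.1; x.1.1.2; x.1.2; x.2] i.

Definition basis4 (i : 'I_4) : R4 R :=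
  ((i == 0%N :> nat)%:R, (i == 1%N :> nat)%:R, (i == 2%N :> nat)%:R,
   (i == 3%N :> nat)%:R).

Definition enorm x : R := Num.sqrt (\sum_(i < 4) coord4 x i ^+ 2).

Definition uball : set (R4 R) := [set x | enorm x < 1].

(* For s = [:: i1; ...; ik], the classical iterated partial derivative
   d_i1 ... d_ik phi. *)
Definition pderiv s phi : R4 R -> R :=
  foldr (fun i f => 'D_(basis4 i) f : R4 R -> R) phi s.

Definition smooth phi : Prop :=
  forall s, continuous (pderiv s phi) /\
    forall x i, derivable (pderiv s phi) x (basis4 i).

(* C_c^oo(B), every function being extended by 0 outside B. *)
Definition test_fun phi : Prop :=
  [/\ smooth phi, compact (closure [set x | phi x != 0])
    & closure [set x | phi x != 0] `<=` uball].

(* Here and below, functions on B are represented by functions on R^4 of which only the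
   restriction to B is used. *)
Definition L2B u : Prop := u \_ uball \in Lfun lebesgue4 2%:E.

Definition normL2B u : \bar R := 'N[lebesgue4]_2%:E[EFin \o u \_ uball]%E.

Definition weak_deriv s u w : Prop :=
  forall phi, test_fun phi ->
    \int[lebesgue4]_(x in uball) (u x * pderiv s phi x) =
    (-1) ^+ size s * \int[lebesgue4]_(x in uball) (w x * phi x).

(* The weak derivative d_i1 ... d_ik u in L^2(B), which is unique up to null
   sets when it exists (0 by convention when there is none). *)
Definition wderiv s u : R4 R -> R :=
  xget (cst 0) [set w | L2B w /\ weak_deriv s u w].

Definition Hk (k : nat) u : Prop :=
  L2B u /\
  forall s, (size s <= k)%N -> exists2 w, L2B w & weak_deriv s u w.

(* (sum_{j <= k} ||D^j u||_2^2)^(1/2) with D^j u the tensor of all ordered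
   partial derivatives of order j, i.e. mixed derivatives are counted with
   multiplicity. *)
Definition normHk (k : nat) u : \bar R :=
  ((\sum_(j < k.+1) \sum_(s : j.-tuple 'I_4) normL2B (wderiv s u) ^+ 2)
     `^ 2^-1)%E.

(* Closure of C_c^oo(B) in H^k(B). *)
Definition Hk0 (k : nat) u : Prop :=
  Hk k u /\
  forall e : R, 0 < e ->
    exists2 phi, test_fun phi & (normHk k (fun x => u x - phi x)%R < e%:E)%E.

(* H^2 with Navier boundary conditions. *)
Definition H2N u : Prop := Hk0 1 u /\ Hk 2 u.

(* Elements of H^2(B) are classes modulo equality a.e. *)
Definition radial u : Prop :=
  exists g : R -> R, {ae lebesgue4, forall x, uball x -> u x = g (enorm x)}.

Definition laplacian u : R4 R -> R :=
  fun x => \sum_(i < 4) wderiv [:: i; i] u x.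

Definition adamsF (sigma alpha : R) (m : nat) u : \bar R :=
  (\int[lebesgue4]_(x in uball)
     (enorm x `^ alpha *
      (expR (sigma * u x ^+ 2) -
       \sum_(0 <= k < m.+1) sigma ^+ k * u x ^+ (2 * k) / k`!%:R))%:E)%E.

Definition adams_sup (X : set (R4 R -> R)) (sigma alpha : R) (m : nat) : \bar R :=
  ereal_sup [set adamsF sigma alpha m u |
             u in [set u | X u /\ normL2B (laplacian u) = 1%E]].

End SobolevBall.

Arguments H2N R u : clear implicits.
Arguments radial R u : clear implicits.
Arguments Hk0 R k u : clear implicits.

(* Main.v *)
(* The two inequalities follow from one chain, since test functions belong to H^2_0, which is
   contained in H^2_N: for large alpha the radial supremum on H^2_N is smaller than the value
   of F_m at a suitable test function.

   Radial functions.  If f is supported in a thin shell, the solution psi of Delta psi = f(|x|^2)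
   vanishing on the sphere is explicit and int u f(|x|^2) = int (Delta u) psi.  By Cauchy-Schwarz and
   Lebesgue differentiation, u^2 <= C min(t, t^2) with t = log(1/|x|), whence, with n = m + 1 >= 2,
   F_m(u) <= o(1) D^n alpha^(-n-2) as alpha tends to infinity, uniformly in m.

   Non-radial functions.  Near a boundary point, in a cube of side 1/alpha on which |x|^alpha is
   bounded below, superpose n dyadic rescalings of a bump.  In dimension 4 the L^2 norm of the
   Laplacian is scale invariant, so the normalised sum is of order sqrt n on a cube of side
   2^-n / alpha, and F_m >= c kappa^n alpha^-4. *)

Require Import Defs.
From mathcomp Require Import all_boot all_order all_algebra.
From mathcomp Require Import all_classical all_reals all_analysis.
From mathcomp Require Import measurable_realfun ring lra.
Set Implicit Arguments.
Unset Strict Implicit.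
Unset Printing Implicit Defensive.
Import Order.TTheory GRing.Theory Num.Theory.
Import numFieldNormedType.Exports.
Local Open Scope classical_set_scope.
Local Open Scope ring_scope.

(** * Smooth functions of one and of four variables *)

(** Uniformity in m requires both bounds to be geometric in n, so the factor 1/n! of the exponential
    tail has to be compensated on each side. From above, t^(n+2) is bounded by (C/alpha)^(n+2)
    (n+2)! times an exponential that part of the weight |x|^alpha absorbs. From below, the number of
    rescalings is n because a normalised square of order n contributes n^n / n! >= 1. The quotient
    of the two bounds then has the form o(1) (r/alpha)^(n-2). Its power is at most 1 once alpha
    exceeds the constant r; for n = 2, where both bounds carry alpha^-4, only the o(1) separates
    them. That o(1) is the integral over the ball of an unspent part of the weight. The two powers
    of alpha gained in the radial bound come from the boundary condition: the regime t^2 near the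
    sphere gives t^(2n) <= t^(n+2) for t <= 1, because n >= 2. *)

Section SmoothReal.
Context {R : realType}.
Implicit Types (f g : R -> R) (x : R).

(** Any class of functions stable under differentiation is a witness, so smoothness is established
    without induction on the order of the derivative. *)
Definition smooth1 f : Prop :=
  exists2 C : (R -> R) -> Prop, C f &
    forall g, C g -> exists2 g', C g' & forall x : R, is_derive x 1 g (g' x).

Lemma smooth1_derive1 f : smooth1 f ->
  smooth1 f^`()%classic /\ forall x : R, is_derive x 1 f (f^`()%classic x).
Proof.
case=> C Cf HC; have [f' Cf' df] := HC _ Cf.
have -> : f^`()%classic = f'.
  by apply/funext => x; rewrite derive1E; apply: derive_val.
by split => //; exists C.
Qed.

(* [smooth1] is coinductive: closure under an operation is proved for all operations at once,
   because differentiating one of them produces the others. *)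
Inductive smooth1_closure : (R -> R) -> Prop :=
| sc_base f : smooth1 f -> smooth1_closure f
| sc_cst (c : R) : smooth1_closure (fun=> c)
| sc_id : smooth1_closure (fun x => x)
| sc_add f g : smooth1_closure f -> smooth1_closure g ->
    smooth1_closure (fun x => f x + g x)
| sc_mul f g : smooth1_closure f -> smooth1_closure g ->
    smooth1_closure (fun x => f x * g x)
| sc_inv f : (forall x, f x != 0) -> smooth1_closure f ->
    smooth1_closure (fun x => (f x)^-1)
| sc_comp f g : smooth1_closure f -> smooth1_closure g ->
    smooth1_closure (fun x => f (g x)).

Lemma smooth1_closureP f : smooth1_closure f -> smooth1 f.
Proof.
move=> cf; exists smooth1_closure => // {cf}f; elim => {f}.
- by move=> f /smooth1_derive1[sf' df]; exists f^`()%classic => //; apply: sc_base.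
- by move=> c; exists (fun=> 0); [exact: sc_cst | move=> x; exact: is_derive_cst].
- by exists (fun=> 1); [exact: sc_cst | move=> x; exact: is_derive_id].
- move=> f g _ [f' cf' df] _ [g' cg' dg]; exists (fun x => f' x + g' x).
    exact: sc_add.
  by move=> x; apply: is_deriveD.
- move=> f g cf [f' cf' df] cg [g' cg' dg].
  exists (fun x => f x * g' x + g x * f' x).
    by apply: sc_add; apply: sc_mul.
  by move=> x; apply: is_deriveM.
- move=> f f0 cf [f' cf' df].
  exists (fun x => (- 1) * ((f x)^-1 * (f x)^-1) * f' x).
    apply: sc_mul => //; apply: sc_mul; first exact: sc_cst.
    by apply: sc_mul; apply: sc_inv.
  move=> x; have := is_deriveV (f0 x) (df x).
  by rewrite /GRing.scale/= expr2 invfM mulN1r mulNr.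
- move=> f g cf [f' cf' df] cg [g' cg' dg].
  exists (fun x => f' (g x) * g' x).
    by apply: sc_mul => //; apply: sc_comp.
  by move=> x; apply: is_derive1_comp.
Qed.

Lemma smooth1_cst (c : R) : smooth1 (fun=> c).
Proof. exact/smooth1_closureP/sc_cst. Qed.

Lemma smooth1_id : smooth1 (fun x => x).
Proof. exact/smooth1_closureP/sc_id. Qed.

Lemma smooth1D f g : smooth1 f -> smooth1 g -> smooth1 (fun x => f x + g x).
Proof. by move=> *; apply/smooth1_closureP/sc_add; apply: sc_base. Qed.

Lemma smooth1M f g : smooth1 f -> smooth1 g -> smooth1 (fun x => f x * g x).
Proof. by move=> *; apply/smooth1_closureP/sc_mul; apply: sc_base. Qed.

Lemma smooth1V f : (forall x, f x != 0) -> smooth1 f ->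
  smooth1 (fun x => (f x)^-1).
Proof. by move=> *; apply/smooth1_closureP/sc_inv => //; apply: sc_base. Qed.

Lemma smooth1_comp f g : smooth1 f -> smooth1 g -> smooth1 (fun x => f (g x)).
Proof. by move=> *; apply/smooth1_closureP/sc_comp; apply: sc_base. Qed.

(** Adding [f] to the class of smooth functions keeps that class stable under differentiation. *)
Lemma smooth1_primitive f g : (forall x : R, is_derive x 1 f (g x)) ->
  smooth1 g -> smooth1 f.
Proof.
move=> df sg; exists (fun k => k = f \/ smooth1 k); first by left.
move=> k [->|/smooth1_derive1[sk dk]]; first by exists g => //; right.
by exists k^`()%classic => //; right.
Qed.

Lemma smooth1_continuous f : smooth1 f -> continuous f.
Proof.
move=> /smooth1_derive1[_ df] x.
apply: differentiable_continuous; apply/derivable1_diffP.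
by have [] := df x.
Qed.

Lemma smooth1N f : smooth1 f -> smooth1 (fun x => - f x).
Proof.
move=> sf; have -> : (fun x => - f x) = (fun x => (-1) * f x).
  by apply/funext => x; rewrite mulN1r.
by apply: smooth1M => //; exact: smooth1_cst.
Qed.

Lemma smooth1B f g : smooth1 f -> smooth1 g -> smooth1 (fun x => f x - g x).
Proof. by move=> sf sg; apply: smooth1D => //; apply: smooth1N. Qed.

(** The whole family is needed because the derivatives of the flat function [exp(-1/x)], the case
    [k = 0], are linear combinations of its members. *)
Definition expinv (k : nat) (x : R) : R :=
  if 0 < x then x^-1 ^+ k * expR (- x^-1) else 0.

(** With [y = 1/x] this is [y^(k+2) <= (k+2)! exp y]. Vanishing to second order is what gives the
    derivative 0 at the origin. *)
Lemma expinv_bound k x : 0 < x -> expinv k x <= (k.+2)`!%:R * x ^+ 2.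
Proof.
move=> x0; rewrite /expinv x0.
have y0 : 0 < x^-1 by rewrite invr_gt0.
have H : x^-1 ^+ k.+2 / (k.+2)`!%:R <= expR x^-1.
  have := expR_ge1Dxn k.+1 (ltW y0); lra.
have f0 : 0 < (k.+2)`!%:R :> R by rewrite ltr0n fact_gt0.
rewrite expRN ler_pdivrMr ?expR_gt0//.
rewrite ler_pdivrMr// in H.
have -> : x^-1 ^+ k = x^-1 ^+ k.+2 * x ^+ 2.
  by rewrite -[k.+2]addn2 exprD -mulrA -exprMn mulVf ?gt_eqF// expr1n mulr1.
apply: le_trans (ler_wpM2r (sqr_ge0 x) H) _.
by rewrite le_eqVlt; apply/orP; left; apply/eqP; ring.
Qed.

Lemma expinv_ge0 k x : 0 <= expinv k x.
Proof.
rewrite /expinv; case: ifPn => // x0.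
by rewrite mulr_ge0 ?expR_ge0// exprn_ge0// invr_ge0 ltW.
Qed.

Lemma is_derive_expinv k (x : R) :
  is_derive x 1 (expinv k) (expinv k.+2 x - k%:R * expinv k.+1 x).
Proof.
have [x0|x0|<-] := ltgtP 0 x.
- have xV : is_derive x 1 (fun y : R => y^-1) (- x ^- 2).
    have := @is_deriveV R id x 1 1 (lt0r_neq0 x0) (is_derive_id _ _).
    by rewrite /GRing.scale/= mulr1.
  have H : is_derive x 1 (fun y : R => y^-1 ^+ k * expR (- y^-1))
     (expinv k.+2 x - k%:R * expinv k.+1 x).
    have d1 := @is_deriveX _ _ (fun y : R => y^-1) k x 1 _ xV.
    have d2 := @is_derive1_comp _ expR (fun y : R => - y^-1) x _ _
      (is_derive_expR _) (is_deriveN xV).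
    have -> : (fun y : R => y^-1 ^+ k * expR (- y^-1)) =
        ((fun y : R => y^-1) ^+ k : R -> R) * (expR \o (fun y : R => - y^-1)).
      by apply/funext => y; rewrite /= !fctE.
    apply: is_derive_eq (is_deriveM d1 d2) _.
    rewrite /expinv x0 /GRing.scale/= !fctE opprK -!exprVn.
    set E := expR _; set y := x^-1.
    case: k d1 => [|k] _ /=; first by rewrite !mul0r mulr0 addr0 subr0 expr0; ring.
    by rewrite !exprS; ring.
  split.
    by apply: near_eq_derivable (@ex_derive _ _ _ _ _ _ _ H);
      near=> y; rewrite /expinv ifT//; near: y; exact: lt_nbhsr.
  rewrite -[RHS](@derive_val _ _ _ _ _ _ _ H); apply: near_eq_derive.
  by near=> y; rewrite /expinv ifT//; near: y; exact: lt_nbhsr.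
- rewrite {2 3}/expinv !ltNge !(ltW x0)/= mulr0 subr0.
  split.
    apply: near_eq_derivable (@derivable_cst _ _ _ (0:R) _ _).
    by near=> y; rewrite /expinv ifF//; apply/negbTE; rewrite -leNgt;
      apply/ltW; near: y; exact: lt_nbhsl.
  rewrite -[RHS](@derive_cst _ _ _ (0:R) x 1); apply: near_eq_derive.
  by near=> y; rewrite /expinv ifF//; apply/negbTE; rewrite -leNgt;
      apply/ltW; near: y; exact: lt_nbhsl.
rewrite {2 3}/expinv !ltxx mulr0 subr0.
suff H : (h^-1 *: ((expinv k \o shift 0) (h *: 1) - expinv k 0)) @[h --> (0:R)^'] --> (0:R).
  by split; [apply/cvg_ex; exists 0|apply/cvg_lim].
apply/cvgrPdist_le => e e0.
set C : R := (k.+2)`!%:R.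
have C0 : 0 < C by rewrite ltr0n fact_gt0.
near=> h.
rewrite sub0r normrN /= addr0 /GRing.scale/= mulr1 [expinv k 0]/expinv ltxx subr0.
have [h0|h0] := ltP 0 h; last first.
  by rewrite /expinv ltNge h0/= mulr0 normr0 ltW.
rewrite ger0_norm ?mulr_ge0 ?invr_ge0 ?expinv_ge0 ?(ltW h0)//.
rewrite ler_pdivrMl//; apply: (le_trans (expinv_bound k h0)).
rewrite -/C expr2 mulrCA ler_pM2l// -ler_pdivlMl//.
rewrite -[h]gtr0_norm//; near: h; apply: dnbhs0_le.
by rewrite mulr_gt0// invr_gt0.
Unshelve. all: by end_near. Qed.

(** Finite linear combinations, coded by lists of pairs (coefficient, index), form a class stable
    under differentiation: each member [k] produces only the members [k + 1] and [k + 2]. *)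
Lemma smooth1_expinv k : smooth1 (expinv k).
Proof.
exists (fun f => exists s : seq (R * nat),
   f = fun x => \sum_(a <- s) a.1 * expinv a.2 x).
  by exists [:: (1, k)]; apply/funext => x; rewrite big_seq1 mul1r.
move=> _ [s ->].
exists (fun x => \sum_(a <- s) a.1 * (expinv a.2.+2 x - a.2%:R * expinv a.2.+1 x)).
  exists (flatten [seq [:: (a.1, a.2.+2); (- (a.1 * a.2%:R), a.2.+1)] | a <- s]).
  apply/funext => x; elim: s => [|a s IH]; first by rewrite !big_nil.
  by rewrite /= !big_cons IH/=; ring.
move=> x; elim: s => [|a s IH].
  rewrite big_nil; have -> : (fun x => \sum_(a <- [::]) a.1 * expinv a.2 x) = (fun=> 0 : R).
    by apply/funext => y; rewrite big_nil.
  exact: is_derive_cst.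
rewrite big_cons.
have -> : (fun x => \sum_(a0 <- a :: s) a0.1 * expinv a0.2 x) =
  (fun x => a.1 * expinv a.2 x + \sum_(a0 <- s) a0.1 * expinv a0.2 x).
  by apply/funext => y; rewrite big_cons.
by apply: is_deriveD; apply: is_deriveZ; exact: is_derive_expinv.
Qed.

Definition hstep : R -> R := expinv 0.

Lemma hstep_gt0 x : 0 < x -> 0 < hstep x.
Proof. by move=> x0; rewrite /hstep /expinv x0 expr0 mul1r expR_gt0. Qed.

Lemma hstep_ge0 x : 0 <= hstep x.
Proof. exact: expinv_ge0. Qed.

Lemma hstep_eq0 x : x <= 0 -> hstep x = 0.
Proof. by move=> x0; rewrite /hstep /expinv ltNge x0. Qed.

Lemma smooth1_hstep : smooth1 hstep.
Proof. exact: smooth1_expinv. Qed.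

(** The product [q] is positive exactly on []a, b[], so these functions increase to the indicator of
    that interval as [k] grows. *)
Definition bump (a b : R) (k : nat) (x : R) : R :=
  let q := hstep (x - a) * hstep (b - x) in q / (q + k.+1%:R^-1).

Lemma smooth1_bump a b k : smooth1 (bump a b k).
Proof.
have sq : smooth1 (fun x => hstep (x - a) * hstep (b - x)).
  apply: smooth1M; apply: smooth1_comp smooth1_hstep _.
    by apply: smooth1B; [exact: smooth1_id|exact: smooth1_cst].
  by apply: smooth1B; [exact: smooth1_cst|exact: smooth1_id].
apply: smooth1M => //; apply: smooth1V.
  by move=> x; rewrite gt_eqF// ltr_wpDl// ?mulr_ge0 ?hstep_ge0// invr_gt0 ltr0n.
by apply: smooth1D => //; exact: smooth1_cst.
Qed.

Lemma bump_ge0 a b k x : 0 <= bump a b k x.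
Proof.
have q0 : 0 <= hstep (x - a) * hstep (b - x) by rewrite mulr_ge0// hstep_ge0.
by rewrite /bump mulr_ge0// invr_ge0 addr_ge0// invr_ge0.
Qed.

Lemma bump_le1 a b k x : bump a b k x <= 1.
Proof.
have q0 : 0 <= hstep (x - a) * hstep (b - x) by rewrite mulr_ge0// hstep_ge0.
rewrite /bump ler_pdivrMr; last by rewrite ltr_wpDl// invr_gt0 ltr0n.
by rewrite mul1r lerDl invr_ge0.
Qed.

Lemma bump_eq0 a b k x : ~~ (a < x < b) -> bump a b k x = 0.
Proof.
rewrite negb_and -!leNgt /bump => /orP[h|h].
  by rewrite [hstep (x - a)]hstep_eq0 ?subr_le0// !mul0r.
by rewrite [hstep (b - x)]hstep_eq0 ?subr_le0// mulr0 mul0r.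
Qed.

Lemma bump_cvg a b x : bump a b k x @[k --> \oo] --> (\1_`]a, b[ x : R).
Proof.
rewrite indicE; case: (boolP (a < x < b)) => [/andP[ax xb]|n]; last first.
  rewrite memNset/=; last by rewrite in_itv/=; apply/negP.
  have -> : (fun k => bump a b k x) = (fun=> 0) by apply/funext => k; rewrite bump_eq0.
  exact: cvg_cst.
rewrite mem_set/=; last by rewrite in_itv/= ax xb.
have q0 : 0 < hstep (x - a) * hstep (b - x) by rewrite mulr_gt0// hstep_gt0// subr_gt0.
rewrite /bump; set q := _ * _ in q0 *.
rewrite -[X in _ --> X](@mulfV _ (q + 0)); last by rewrite addr0 gt_eqF.
rewrite {1}addr0.
apply: cvgM; first exact: cvg_cst.
apply: cvgV; first by rewrite addr0 gt_eqF.
apply: cvgD; first exact: cvg_cst.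
exact: cvg_harmonic.
Qed.

Definition ramp (x : R) : R := hstep (x - 1) / (hstep (x - 1) + hstep (2 - x)).

Lemma ramp_den_gt0 x : 0 < hstep (x - 1) + hstep (2 - x).
Proof.
have [x1|x1] := ltP 1 x.
  by rewrite ltr_wpDr ?hstep_ge0// hstep_gt0// subr_gt0.
by rewrite ltr_wpDl ?hstep_ge0// hstep_gt0// subr_gt0 (le_lt_trans x1)// ltr1n.
Qed.

Lemma smooth1_ramp : smooth1 ramp.
Proof.
have s1 : smooth1 (fun x => hstep (x - 1)).
  by apply: smooth1_comp smooth1_hstep _; apply: smooth1B; [exact: smooth1_id|exact: smooth1_cst].
apply: smooth1M => //; apply: smooth1V; first by move=> x; rewrite gt_eqF// ramp_den_gt0.
apply: smooth1D => //; apply: smooth1_comp smooth1_hstep _.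
by apply: smooth1B; [exact: smooth1_cst|exact: smooth1_id].
Qed.

Lemma ramp_eq0 x : x <= 1 -> ramp x = 0.
Proof. by move=> x1; rewrite /ramp hstep_eq0 ?mul0r// subr_le0. Qed.

Lemma ramp_eq1 x : 2 <= x -> ramp x = 1.
Proof.
move=> x2; rewrite /ramp [hstep (2 - x)]hstep_eq0 ?subr_le0// addr0 mulfV//.
by rewrite gt_eqF// hstep_gt0// subr_gt0 (lt_le_trans _ x2)// ltr1n.
Qed.

Lemma ramp_ge0 x : 0 <= ramp x.
Proof. by rewrite mulr_ge0 ?hstep_ge0// invr_ge0 ltW// ramp_den_gt0. Qed.

Lemma ramp_le1 x : ramp x <= 1.
Proof. by rewrite ler_pdivrMr ?ramp_den_gt0// mul1r lerDl hstep_ge0. Qed.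

Lemma smooth1_bounded f (a b : R) : smooth1 f ->
  exists2 M, 0 < M & forall x, a <= x <= b -> `|f x| <= M.
Proof.
move=> /smooth1_continuous cf.
have [ab|ba] := leP a b; last first.
  by exists 1 => // x /andP[ax xb]; have := le_lt_trans (le_trans ax xb) ba; rewrite ltxx.
have cn : {within `[a, b], continuous (fun x => `|f x|)}.
  apply: continuous_subspaceT => x.
  by apply: continuous_comp; [exact: cf|exact: norm_continuous].
have [c _ Hc] := EVT_max ab cn.
exists (`|f c| + 1); first by rewrite ltr_wpDl.
by move=> x xab; rewrite (le_trans (Hc x _)) ?in_itv// lerDl.
Qed.

(** The location of the support matters as much as the bound: it confines the gradient of the
    cutoffs to a shell where [1 - |x|^2] is of order [1/k]. *)
Lemma ramp_derive_bounded : exists2 M, 0 < M &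
  forall x, `|ramp^`()%classic x| <= M /\ (ramp^`()%classic x != 0 -> 1 <= x <= 2).
Proof.
have [s' d'] := smooth1_derive1 smooth1_ramp.
have [M M0 HM] := smooth1_bounded 1 2 s'.
have z x : ~~ (1 <= x <= 2) -> ramp^`()%classic x = 0.
  rewrite negb_and -!ltNge => /orP[x1|x2]; rewrite derive1E.
    rewrite -[RHS](@derive_cst _ _ _ (0:R) x 1); apply: near_eq_derive.
    by near=> y; rewrite ramp_eq0//; apply/ltW; near: y; exact: lt_nbhsl.
  rewrite -[RHS](@derive_cst _ _ _ (1:R) x 1); apply: near_eq_derive.
  by near=> y; rewrite ramp_eq1//; apply/ltW; near: y; exact: lt_nbhsr.
exists M => // x; case: (boolP (1 <= x <= 2)) => h; first by split; [exact: HM|].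
by rewrite z// normr0 eqxx; split => //; exact: ltW.
Unshelve. all: by end_near. Qed.

End SmoothReal.

(** * Functions of four variables *)

Section SmoothR4.
Context {R : realType}.
Implicit Types (f g : R4 R -> R) (x v : R4 R).

(** Restriction to a line turns a directional derivative into a one-variable one, so the chain rule
    and the mean value theorem are available without total differentiability. *)
Lemma is_derive_line f x v (t d : R) :
  is_derive (t *: v + x) v f d <->
  is_derive t (1:R) (fun h : R => f (h *: v + x)) d.
Proof.
have E : (fun h : R => h^-1 *: ((f \o shift (t *: v + x)) (h *: v) - f (t *: v + x))) =
  (fun h : R => h^-1 *: (((fun h : R => f (h *: v + x)) \o shift t) (h *: 1) -
     (fun h : R => f (h *: v + x)) t)).
  apply/funext => h /=; congr (_ *: (f _ - _)).
  have -> : h%:A = h by exact: mulr1.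
  by rewrite scalerDl addrA.
by split => -[d1 d2]; split;
  [rewrite /derivable -E; exact: d1|rewrite /derive -E; exact: d2
  |rewrite /derivable E; exact: d1|rewrite /derive E; exact: d2].
Qed.

Lemma is_derive_line0 f x v (d : R) :
  is_derive x v f d <->
  is_derive (0:R) (1:R) (fun h : R => f (h *: v + x)) d.
Proof. by rewrite -is_derive_line scale0r add0r. Qed.

Lemma is_derive_comp1 (p : R -> R) f x v (a b : R) :
  is_derive (f x) 1 p a -> is_derive x v f b ->
  is_derive x v (fun y => p (f y)) (a * b).
Proof.
move=> dp /is_derive_line0 df; apply/is_derive_line0.
by apply: (@is_derive1_comp _ p) => //; rewrite scale0r add0r.
Qed.

(* Wrapping [smooth] keeps unification from unfolding it. *)
Variant is_smooth f : Prop := IsSmooth of smooth f.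

(** The induction on the list of directions is done here once; afterwards smoothness only requires a
    class of continuous functions stable under the four partial derivatives. *)
Lemma smooth_coinduction (C : (R4 R -> R) -> Prop) :
  (forall f, C f -> continuous f /\
     forall i : 'I_4, exists2 f', C f' & forall x, is_derive x (basis4 i) f (f' x)) ->
  forall f, C f -> is_smooth f.
Proof.
move=> HC f Cf; constructor => s.
have : C (pderiv s f).
  elim: s => //= i s /HC[_ /(_ i)[f' Cf' df]].
  suff -> : 'D_(basis4 i) (pderiv s f) = f' by [].
  by apply/funext => x; apply: derive_val.
by move=> /HC[cs ds]; split => // x i; have [f' _ df] := ds i; have [] := df x.
Qed.

Lemma smooth_continuous f : is_smooth f -> continuous f.
Proof. by move=> [/(_ [::])[]]. Qed.

Lemma pderiv_cat s t f : pderiv (s ++ t) f = pderiv s (pderiv t f).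
Proof. by rewrite /pderiv foldr_cat. Qed.

Lemma smooth_pderiv s f : is_smooth f -> is_smooth (pderiv s f).
Proof. by move=> [sf]; constructor => t; rewrite -pderiv_cat; exact: sf. Qed.

Lemma smooth_is_derive f i x : is_smooth f -> is_derive x (basis4 i) f (pderiv [:: i] f x).
Proof. by move=> [/(_ [::])[_ /(_ x i) d]]; exact: derivableP. Qed.

Inductive smooth_closure : (R4 R -> R) -> Prop :=
| sm_base f : is_smooth f -> smooth_closure f
| sm_cst (c : R) : smooth_closure (fun=> c)
| sm_coord i : smooth_closure (fun x => coord4 x i)
| sm_add f g : smooth_closure f -> smooth_closure g ->
    smooth_closure (fun x => f x + g x)
| sm_mul f g : smooth_closure f -> smooth_closure g ->
    smooth_closure (fun x => f x * g x)
| sm_comp (p : R -> R) f : smooth1 p -> smooth_closure f ->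
    smooth_closure (fun x => p (f x)).

Lemma coord4_linear x v (h : R) i : coord4 (h *: v + x) i = h * coord4 v i + coord4 x i.
Proof. by case: i => [[|[|[|[|//]]]] H]; rewrite /coord4 !(tnth_nth 0). Qed.

Lemma coord4_basis i j : coord4 (basis4 j : R4 R) i = (i == j)%:R.
Proof.
by case: i => [[|[|[|[|//]]]] H]; case: j => [[|[|[|[|//]]]] H'];
  rewrite /coord4 (tnth_nth 0).
Qed.

Lemma continuous_coord4 i : continuous (fun x => coord4 x i).
Proof.
have c0 : continuous (fun x => x.1.1).
  by move=> x; apply: continuous_comp; exact: cvg_fst.
have c1 : continuous (fun x => x.1.1.1 : R).
  by move=> x; apply: (@continuous_comp _ _ R (fun x : R4 R => x.1.1) fst); [exact: c0|exact: cvg_fst].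
have c2 : continuous (fun x => x.1.1.2 : R).
  by move=> x; apply: (@continuous_comp _ _ R (fun x : R4 R => x.1.1) snd); [exact: c0|exact: cvg_snd].
have c3 : continuous (fun x => x.1.2 : R).
  by move=> x; apply: (@continuous_comp _ _ R (fun x : R4 R => x.1) snd); [exact: cvg_fst|exact: cvg_snd].
case: i => [[|[|[|[|//]]]] H]; rewrite /coord4/=.
- have -> : (fun x => tnth [tuple x.1.1.1; x.1.1.2; x.1.2; x.2] (Ordinal H)) =
    (fun x => x.1.1.1 : R) by apply/funext => x; rewrite (tnth_nth 0).
  exact: c1.
- have -> : (fun x => tnth [tuple x.1.1.1; x.1.1.2; x.1.2; x.2] (Ordinal H)) =
    (fun x => x.1.1.2 : R) by apply/funext => x; rewrite (tnth_nth 0).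
  exact: c2.
- have -> : (fun x => tnth [tuple x.1.1.1; x.1.1.2; x.1.2; x.2] (Ordinal H)) =
    (fun x => x.1.2 : R) by apply/funext => x; rewrite (tnth_nth 0).
  exact: c3.
- have -> : (fun x => tnth [tuple x.1.1.1; x.1.1.2; x.1.2; x.2] (Ordinal H)) =
    (fun x => x.2 : R) by apply/funext => x; rewrite (tnth_nth 0).
  by move=> x; exact: cvg_snd.
Qed.

Lemma is_derive_coord4 i j x :
  is_derive x (basis4 j) (fun x => coord4 x i) ((i == j)%:R : R).
Proof.
apply/is_derive_line0.
have -> : (fun h : R => coord4 (h *: (basis4 j : R4 R) + x) i) =
    (fun h : R => (i == j)%:R * h + coord4 x i).
  by apply/funext => h; rewrite coord4_linear coord4_basis mulrC.
rewrite -[X in is_derive _ _ _ X]addr0 -[X in is_derive _ _ _ (X + _)]mulr1.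
by apply: is_deriveD.
Qed.

Lemma smooth_closureP f : smooth_closure f -> is_smooth f.
Proof.
apply: smooth_coinduction => {f} f; elim => {f}.
- move=> f sf; split; first exact: smooth_continuous.
  move=> i; exists (pderiv [:: i] f); first exact/sm_base/smooth_pderiv.
  by move=> x; apply: smooth_is_derive.
- move=> c; split; first exact: cst_continuous.
  by move=> i; exists (fun=> 0); [exact: sm_cst|move=> x; exact: is_derive_cst].
- move=> j; split; first exact: continuous_coord4.
  by move=> i; exists (fun=> (j == i)%:R); [exact: sm_cst|move=> x; exact: is_derive_coord4].
- move=> f g _ [cf df] _ [cg dg]; split.
    by move=> x; apply: cvgD; [exact: cf|exact: cg].
  move=> i; have [f' cf' df'] := df i; have [g' cg' dg'] := dg i.
  by exists (fun x => f' x + g' x); [exact: sm_add|move=> x; apply: is_deriveD].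
- move=> f g sf [cf df] sg [cg dg]; split.
    by move=> x; apply: cvgM; [exact: cf|exact: cg].
  move=> i; have [f' cf' df'] := df i; have [g' cg' dg'] := dg i.
  exists (fun x => f x * g' x + g x * f' x).
    by apply: sm_add; apply: sm_mul.
  by move=> x; apply: is_deriveM.
- move=> p f sp sf [cf df]; have [sp' dp] := smooth1_derive1 sp; split.
    by move=> x; apply: continuous_comp; [exact: cf|exact: smooth1_continuous].
  move=> i; have [f' cf' df'] := df i.
  exists (fun x => p^`()%classic (f x) * f' x).
    by apply: sm_mul => //; apply: sm_comp.
  by move=> x; apply: is_derive_comp1.
Qed.

Lemma smooth_cst (c : R) : is_smooth (fun _ : R4 R => c).
Proof. exact/smooth_closureP/sm_cst. Qed.

Lemma smooth_coord4 i : is_smooth (fun x => coord4 x i).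
Proof. exact/smooth_closureP/sm_coord. Qed.

Lemma smoothD f g : is_smooth f -> is_smooth g -> is_smooth (fun x => f x + g x).
Proof. by move=> *; apply/smooth_closureP/sm_add; apply: sm_base. Qed.

Lemma smoothM f g : is_smooth f -> is_smooth g -> is_smooth (fun x => f x * g x).
Proof. by move=> *; apply/smooth_closureP/sm_mul; apply: sm_base. Qed.

Lemma smooth_comp (p : R -> R) f : smooth1 p -> is_smooth f -> is_smooth (fun x => p (f x)).
Proof. by move=> *; apply/smooth_closureP/sm_comp => //; apply: sm_base. Qed.

Lemma smoothZ (c : R) f : is_smooth f -> is_smooth (fun x => c * f x).
Proof. by move=> sf; apply: smoothM => //; exact: smooth_cst. Qed.

Lemma smooth_sum (I : Type) (r : seq I) (F : I -> R4 R -> R) :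
  (forall i, is_smooth (F i)) -> is_smooth (fun x => \sum_(i <- r) F i x).
Proof.
move=> sF; elim: r => [|a r IH].
  by under eq_fun do rewrite big_nil; exact: smooth_cst.
by under eq_fun do rewrite big_cons; apply: smoothD.
Qed.

Lemma smooth_prod (I : Type) (r : seq I) (F : I -> R4 R -> R) :
  (forall i, is_smooth (F i)) -> is_smooth (fun x => \prod_(i <- r) F i x).
Proof.
move=> sF; elim: r => [|a r IH].
  by under eq_fun do rewrite big_nil; exact: smooth_cst.
by under eq_fun do rewrite big_cons; apply: smoothM.
Qed.

Lemma pderiv1E f i (f' : R4 R -> R) :
  (forall x, is_derive x (basis4 i) f (f' x)) -> pderiv [:: i] f = f'.
Proof. by move=> df; apply/funext => x; apply: derive_val. Qed.

Lemma pderiv1D f g i : is_smooth f -> is_smooth g ->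
  pderiv [:: i] (fun x => f x + g x) = fun x => pderiv [:: i] f x + pderiv [:: i] g x.
Proof. by move=> sf sg; apply: pderiv1E => x; apply: is_deriveD; apply: smooth_is_derive. Qed.

Lemma pderiv1M f g i : is_smooth f -> is_smooth g ->
  pderiv [:: i] (fun x => f x * g x) = fun x => f x * pderiv [:: i] g x + g x * pderiv [:: i] f x.
Proof. by move=> sf sg; apply: pderiv1E => x; apply: is_deriveM; apply: smooth_is_derive. Qed.

Lemma pderiv1Z (c : R) f i : is_smooth f ->
  pderiv [:: i] (fun x => c * f x) = fun x => c * pderiv [:: i] f x.
Proof. by move=> sf; apply: pderiv1E => x; apply: is_deriveZ; apply: smooth_is_derive. Qed.

Lemma pderiv1_comp (p : R -> R) f i : smooth1 p -> is_smooth f ->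
  pderiv [:: i] (fun x => p (f x)) = fun x => p^`()%classic (f x) * pderiv [:: i] f x.
Proof.
move=> /smooth1_derive1[_ dp] sf; apply: pderiv1E => x.
by apply: is_derive_comp1 => //; apply: smooth_is_derive.
Qed.

Lemma pderivD s f g : is_smooth f -> is_smooth g ->
  pderiv s (fun x => f x + g x) = fun x => pderiv s f x + pderiv s g x.
Proof.
move=> sf sg; elim: s => //= i s ->.
exact: (@pderiv1D _ _ i (smooth_pderiv s sf) (smooth_pderiv s sg)).
Qed.

Lemma pderivZ s (c : R) f : is_smooth f ->
  pderiv s (fun x => c * f x) = fun x => c * pderiv s f x.
Proof.
move=> sf; elim: s => //= i s ->.
exact: (@pderiv1Z _ _ i (smooth_pderiv s sf)).
Qed.

(** Radial functions are written as functions of [|x|^2], which unlike [|x|] is smooth at the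
    origin. *)
Definition sqnorm x : R := \sum_(i < 4) coord4 x i ^+ 2.

Lemma smooth_sqnorm : is_smooth sqnorm.
Proof.
have -> : sqnorm = fun x => \sum_(i <- index_enum 'I_4) coord4 x i * coord4 x i.
  by apply/funext => x; apply: eq_bigr => i _; rewrite expr2.
by apply: smooth_sum => i; apply: smoothM; exact: smooth_coord4.
Qed.

Lemma sqnorm_ge0 x : 0 <= sqnorm x.
Proof. by apply: sumr_ge0 => i _; exact: sqr_ge0. Qed.

Lemma enormE x : enorm x ^+ 2 = sqnorm x.
Proof. by rewrite /enorm sqr_sqrtr// sqnorm_ge0. Qed.

Lemma uballE x : uball x = (sqnorm x < 1) :> Prop.
Proof. by rewrite /uball /= /enorm -{1}sqrtr1 ltr_sqrt. Qed.

Lemma pderiv_sqnorm i : pderiv [:: i] sqnorm = fun x => 2 * coord4 x i.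
Proof.
apply: pderiv1E => x.
have -> : sqnorm = \sum_(j < 4) (fun x => coord4 x j * coord4 x j).
  by apply/funext => y; rewrite fct_sumE; apply: eq_bigr => j _; rewrite expr2.
have H (j : 'I_4) : is_derive x (basis4 i) (fun x => coord4 x j * coord4 x j)
    (coord4 x j * (j == i)%:R + coord4 x j * (j == i)%:R).
  by apply: is_deriveM; exact: is_derive_coord4.
apply: is_derive_eq (is_derive_sum H) _.
rewrite (bigD1 i)//= eqxx mulr1 big1 ?addr0; first by rewrite mulr2n mulrDl mul1r.
by move=> j /negbTE ->; rewrite mulr0 addr0.
Qed.
End SmoothR4.

(** * Lebesgue measure on R^4 and integration on the ball *)

Section ProductImage.
Local Open Scope ereal_scope.
Context d1 d2 (T1 : measurableType d1) (T2 : measurableType d2) (R : realType).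
Variables (m1 : {measure set T1 -> \bar R}) (m2 : {sigma_finite_measure set T2 -> \bar R}).

(** By sections: a section of the preimage is the preimage under [f2] of a section of [A], which
    contributes [b]; the change of variables along [f1] in the outer integral contributes [a]. Three
    applications give the scaling of the measure on R^4. *)
Lemma product_measure_preimage (f1 : T1 -> T1) (f2 : T2 -> T2) (a b : R) :
  (0 <= a)%R -> (0 <= b)%R -> measurable_fun setT f1 -> measurable_fun setT f2 ->
  (forall A, measurable A -> m1 (f1 @^-1` A) = a%:E * m1 A) ->
  (forall A, measurable A -> m2 (f2 @^-1` A) = b%:E * m2 A) ->
  forall A, measurable A ->
    (m1 \x m2) ((fun x => (f1 x.1, f2 x.2)) @^-1` A) = (a * b)%:E * (m1 \x m2) A.
Proof.
move=> a0 b0 mf1 mf2 H1 H2 A mA.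
rewrite /product_measure1.
have mg : measurable_fun [set: T1] ((m2 \o xsection A) : T1 -> \bar R) by exact: measurable_fun_xsection.
transitivity (\int[m1]_x (b%:E * (m2 \o xsection A) (f1 x))).
  apply: eq_integral => x _ /=.
  rewrite -H2; last exact: measurable_xsection.
  congr (m2 _); apply/seteqP; split => y /=; rewrite /xsection /= !inE//.
rewrite ge0_integralZl//; last first.
  by apply: measurableT_comp => //.
rewrite -[in LHS](@ge0_integral_pushforward _ _ _ _ _ _ mf1 m1 setT (m2 \o xsection A))//.
transitivity (b%:E * \int[mscale (NngNum a0) m1]_x (m2 \o xsection A) x).
  by congr (_ * _); apply: eq_measure_integral => B mB _; rewrite [LHS]H1.
by rewrite ge0_integral_mscale// muleA -EFinM mulrC.
Qed.
End ProductImage.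

Section Lebesgue4.
Context {R : realType}.
Local Notation mu := (@lebesgue4 R).
Implicit Types (f g : R4 R -> R) (x v : R4 R).

(** The pushforward multiplied by [r] agrees with Lebesgue measure on half-open intervals, which
    determines it. *)
Lemma lebesgue_measure_affine (r c : R) (A : set (measurableTypeR R)) : 0 < r -> measurable A ->
  (lebesgue_measure ((fun t : measurableTypeR R => r * t + c)%R @^-1` A) = r^-1%R%:E * lebesgue_measure A)%E.
Proof.
move=> r0 mA.
have mf : measurable_fun setT (fun t : measurableTypeR R => r * t + c : measurableTypeR R).
  by apply: measurable_funD => //; apply: measurable_funM.
pose m := mscale (NngNum (ltW r0)) (pushforward (@lebesgue_measure R) (fun t : measurableTypeR R => r * t + c : measurableTypeR R)).
have : lebesgue_measure A = m mf A.
  apply: lebesgue_measure_unique => // _ [[a b]] _ <-.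
  change (lebesgue_measure [set` `]a, b]] =
    (r%:E * lebesgue_measure ((fun t : R => r * t + c)%R @^-1` [set` `]a, b]]))%E).
  have -> : (fun t : R => r * t + c) @^-1` [set` `]a, b]] = [set` `]((a - c) / r), ((b - c) / r)]].
    by apply/seteqP; split => t /=; rewrite !in_itv/= ltr_pdivrMr// ler_pdivlMr// ltrBlDr lerBrDr [t * r]mulrC.
  rewrite !lebesgue_measure_itv/= !lte_fin ltr_pM2r ?invr_gt0// ltrD2r.
  case: ifP => _; last by rewrite mule0.
  rewrite -!EFinB -EFinM; congr EFin.
  by rewrite -mulrBl opprB addrA subrK mulrCA mulfV ?mulr1// gt_eqF.
change (lebesgue_measure A = (r%:E * lebesgue_measure ((fun t : measurableTypeR R => r * t + c)%R @^-1` A))%E ->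
  (lebesgue_measure ((fun t : measurableTypeR R => r * t + c)%R @^-1` A) = r^-1%R%:E * lebesgue_measure A)%E).
move=> ->.
by rewrite muleA -EFinM mulVf ?mul1e// gt_eqF.
Qed.

Definition mk4 (a b c d : R) : R4 R := (a, b, c, d).

Lemma mk4E x : x = mk4 x.1.1.1 x.1.1.2 x.1.2 x.2.
Proof. by case: x => [[[a b] c] d]. Qed.

Lemma measurable_fun_mk4 d (T : measurableType d) (f1 f2 f3 f4 : T -> R) :
  measurable_fun setT f1 -> measurable_fun setT f2 -> measurable_fun setT f3 ->
  measurable_fun setT f4 ->
  measurable_fun setT (fun t => mk4 (f1 t) (f2 t) (f3 t) (f4 t)).
Proof.
move=> m1 m2 m3 m4.
apply: (@measurable_fun_pair _ _ _ _ (measurableTypeR R * measurableTypeR R * measurableTypeR R)%type (measurableTypeR R)) => //.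
by apply: measurable_fun_pair => //; apply: measurable_fun_pair.
Qed.

Lemma measurable_c1 : measurable_fun setT (fun x => x.1.1.1 : R).
Proof.
exact: (measurableT_comp (f := fst) (g := fun x => x.1.1) measurable_fst
  (measurableT_comp (f := fst) (g := fst) measurable_fst measurable_fst)).
Qed.

Lemma measurable_c2 : measurable_fun setT (fun x => x.1.1.2 : R).
Proof.
exact: (measurableT_comp (f := snd) (g := fun x => x.1.1) measurable_snd
  (measurableT_comp (f := fst) (g := fst) measurable_fst measurable_fst)).
Qed.

Lemma measurable_c3 : measurable_fun setT (fun x => x.1.2 : R).
Proof. exact: (measurableT_comp (f := snd) (g := fst) measurable_snd measurable_fst). Qed.

Lemma measurable_c4 : measurable_fun setT (fun x => x.2 : R).
Proof. exact: measurable_snd. Qed.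

Lemma coord4E x (i : 'I_4) : coord4 x i = [:: x.1.1.1; x.1.1.2; x.1.2; x.2]`_i.
Proof. by rewrite /coord4 (tnth_nth 0). Qed.

Lemma affine4E (r : R) v x : r *: x + v =
  mk4 (r * x.1.1.1 + v.1.1.1) (r * x.1.1.2 + v.1.1.2) (r * x.1.2 + v.1.2) (r * x.2 + v.2).
Proof. by []. Qed.

Lemma measurable_affine4 (r : R) v : measurable_fun setT (fun x => r *: x + v : R4 R).
Proof.
under eq_fun do rewrite affine4E.
apply: (@measurable_fun_mk4 _ _ (fun x : R4 R => r * x.1.1.1 + v.1.1.1)
  (fun x => r * x.1.1.2 + v.1.1.2) (fun x => r * x.1.2 + v.1.2) (fun x => r * x.2 + v.2));
  (apply: measurable_funD => //; apply: measurable_funM => //);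
  [exact: measurable_c1|exact: measurable_c2|exact: measurable_c3].
Qed.

Lemma lebesgue4_affine (r : R) v (A : set (R4 R)) : 0 < r -> measurable A ->
  (mu ((fun x => r *: x + v)%R @^-1` A) = (r ^- 4)%R%:E * mu A)%E.
Proof.
move=> r0 mA.
have mf (c : R) : measurable_fun setT (fun t : measurableTypeR R => r * t + c : measurableTypeR R).
  by apply: measurable_funD => //; apply: measurable_funM.
have r1 : 0 <= r^-1 by rewrite invr_ge0 ltW.
pose f2 (x : measurableTypeR R * measurableTypeR R) :=
  (r * x.1 + v.1.1.1, r * x.2 + v.1.1.2) : (measurableTypeR R * measurableTypeR R)%type.
pose f3 (x : measurableTypeR R * measurableTypeR R * measurableTypeR R) :=
  (f2 x.1, r * x.2 + v.1.2) : (measurableTypeR R * measurableTypeR R * measurableTypeR R)%type.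
have mf2 : measurable_fun setT f2.
  by apply: measurable_fun_pair; [exact: measurableT_comp (mf _) measurable_fst|exact: measurableT_comp (mf _) measurable_snd].
have mf3 : measurable_fun setT f3.
  by apply: measurable_fun_pair; [exact: measurableT_comp mf2 measurable_fst|exact: measurableT_comp (mf _) measurable_snd].
have -> : (fun x => r *: x + v) = (fun x => (f3 x.1, r * x.2 + v.2)) by [].
have -> : r ^- 4 = r^-1 * r^-1 * r^-1 * r^-1 by rewrite -exprVn !exprS expr0 mulr1 !mulrA.
have E c B mB := @lebesgue_measure_affine r c B r0 mB.
have P2 := product_measure_preimage (m1 := @lebesgue_measure R) (m2 := @lebesgue_measure R)
  r1 r1 (mf _) (mf _) (E v.1.1.1) (E v.1.1.2).
have P3 := product_measure_preimage (m1 := (@lebesgue_measure R \x @lebesgue_measure R)%E)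
  (m2 := @lebesgue_measure R) (mulr_ge0 r1 r1) r1 mf2 (mf _) P2 (E v.1.2).
exact: (product_measure_preimage (m1 := (@lebesgue_measure R \x @lebesgue_measure R \x @lebesgue_measure R)%E)
  (m2 := @lebesgue_measure R) (mulr_ge0 (mulr_ge0 r1 r1) r1) r1 mf3 (mf _) P3 (E v.2)).
Qed.

Definition discretize (k : nat) (t : R) : R := (Num.floor (t * k.+1%:R))%:~R / k.+1%:R.

Lemma discretize_cvg (t : R) : discretize k t @[k --> \oo] --> t.
Proof.
apply/cvgrPdist_le => e e0; near=> k.
have k0 : 0 < k.+1%:R :> R by rewrite ltr0n.
have H1 := floor_le (t * k.+1%:R). have H2 := floorD1_gt (t * k.+1%:R).
rewrite /discretize; set F := Num.floor _ in H1 H2 *.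
have -> : t - F%:~R / k.+1%:R = (t * k.+1%:R - F%:~R) / k.+1%:R by field; rewrite gt_eqF.
rewrite normrM ger0_norm ?subr_ge0// ger0_norm ?invr_ge0//.
rewrite intrD in H2.
have h : k.+1%:R^-1 <= e.
  by apply: ltW; near: k; exact: (near_infty_natSinv_lt (PosNum e0)).
apply: le_trans h; rewrite -[leRHS]mul1r ler_wpM2r ?invr_ge0//; lra.
Unshelve. all: by end_near. Qed.

Definition discretize4 (k : nat) x : R4 R :=
  mk4 (discretize k x.1.1.1) (discretize k x.1.1.2) (discretize k x.1.2) (discretize k x.2).

(** [f] is the pointwise limit of its compositions with rounding down to the grid of mesh [1/(k+1)],
    and each of these takes countably many values, on half-open cubes. The open sets of R^4 thus
    need not be compared with the product sigma-algebra. *)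
Lemma continuous_measurable4 f : continuous f -> measurable_fun setT f.
Proof.
move=> cf.
apply: (measurable_fun_cvg (h := fun k x => f (discretize4 k x))); last first.
  move=> x _; apply: continuous_cvg; first exact: cf.
  rewrite {2}(mk4E x).
  have F1 (a : R) : Filter (nbhs a) by exact: nbhs_filter.
  have h2 := @cvg_pair _ _ _ _ _ _ _ (F1 _) (F1 _) _ _ (@discretize_cvg x.1.1.1) (@discretize_cvg x.1.1.2) _.
  have F2 (a b : R) : Filter (filter_prod (nbhs a) (nbhs b)) by exact: filter_prod_filter.
  have h3 := @cvg_pair _ _ _ _ _ _ _ (F2 _ _) (F1 _) _ _ (h2 _) (@discretize_cvg x.1.2) _.
  have F3 (a b c : R) : Filter (filter_prod (filter_prod (nbhs a) (nbhs b)) (nbhs c)) by exact: filter_prod_filter.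
  exact: (@cvg_pair _ _ _ _ _ _ _ (F3 _ _ _) (F1 _) _ _ (h3 _ _) (@discretize_cvg x.2)).
move=> k _ A mA; rewrite setTI.
pose pt (z : int * int * int * int) : R4 R :=
  mk4 (z.1.1.1%:~R / k.+1%:R) (z.1.1.2%:~R / k.+1%:R) (z.1.2%:~R / k.+1%:R) (z.2%:~R / k.+1%:R).
pose fl (t : R) := Num.floor (t * k.+1%:R).
have -> : (fun x => f (discretize4 k x)) @^-1` A = \bigcup_z
   (if f (pt z) \in A then [set x | [/\ fl x.1.1.1 = z.1.1.1, fl x.1.1.2 = z.1.1.2, fl x.1.2 = z.1.2 & fl x.2 = z.2]] else set0).
  apply/seteqP; split => x /=.
    move=> Ax; exists (fl x.1.1.1, fl x.1.1.2, fl x.1.2, fl x.2) => //.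
    by rewrite mem_set.
  by move=> [z _]; case: ifPn => // /set_mem Az [h1 h2 h3 h4];
    rewrite /discretize4 /discretize -/(fl _) -/(fl x.1.1.2) -/(fl x.1.2) -/(fl x.2) h1 h2 h3 h4.
apply: countable_bigcupT_measurable => // z; case: ifP => // _.
have mfl (c : R4 R -> R) (n : int) : measurable_fun setT c -> measurable [set x | fl (c x) = n].
  move=> mc.
  have -> : [set x | fl (c x) = n] = setT `&` c @^-1` [set` `[n%:~R / k.+1%:R, (n + 1)%:~R / k.+1%:R[].
    rewrite setTI; apply/seteqP; split => x /=;
      rewrite in_itv/= ler_pdivrMr ?ltr0n// ltr_pdivlMr ?ltr0n// -floor_eq.
      by move=> <-; rewrite /fl.
    by move=> /eqP.
  exact: mc.
have -> : [set x : R4 R | [/\ fl x.1.1.1 = z.1.1.1, fl x.1.1.2 = z.1.1.2, fl x.1.2 = z.1.2 & fl x.2 = z.2]] =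
   ([set x : R4 R | fl x.1.1.1 = z.1.1.1] `&` [set x : R4 R | fl x.1.1.2 = z.1.1.2]) `&`
   ([set x : R4 R | fl x.1.2 = z.1.2] `&` [set x : R4 R | fl x.2 = z.2]).
  by apply/seteqP; split => x /=; [case|move=> [[? ?] [? ?]]].
by apply: measurableI; apply: measurableI; apply: mfl;
  [exact: measurable_c1|exact: measurable_c2|exact: measurable_c3|exact: measurable_c4].
Qed.
End Lebesgue4.

(** * The space L^2(B) and the integral over the ball *)

Section L2ball.
Context {R : realType}.
Local Notation mu := (@lebesgue4 R).
Local Notation B := (@uball R).
Implicit Types (f g u v w : R4 R -> R) (x : R4 R).

Definition intB f : R := \int[mu]_(x in B) f x.
Definition integrable_ball f := mu.-integrable B (EFin \o f).

Lemma smooth_measurable f (D : set (R4 R)) : measurable D -> is_smooth f -> measurable_fun D f.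
Proof. by move=> mD /smooth_continuous/continuous_measurable4 /measurable_funS; exact. Qed.

Lemma measurable_sqnorm : measurable_fun setT (@sqnorm R).
Proof. by apply: smooth_measurable => //; exact: smooth_sqnorm. Qed.

Lemma measurable_sqnorm_lt (r : R) : measurable [set x : R4 R | sqnorm x < r].
Proof.
have -> : [set x : R4 R | sqnorm x < r] = setT `&` (@sqnorm R) @^-1` [set` `]-oo, r[].
  by rewrite setTI; apply/seteqP; split => x /=; rewrite in_itv.
exact: measurable_sqnorm.
Qed.

Lemma uball_sqnorm : B = [set x | sqnorm x < 1].
Proof. by apply/funext => x; rewrite uballE. Qed.

Lemma measurable_uball : measurable B.
Proof. by rewrite uball_sqnorm; exact: measurable_sqnorm_lt. Qed.

Lemma coord4_le_sqnorm x i : coord4 x i ^+ 2 <= sqnorm x.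
Proof. by rewrite /sqnorm (bigD1 i)//= lerDl sumr_ge0// => j _; exact: sqr_ge0. Qed.

Definition box (a b : R4 R) : set (R4 R) :=
  [set x | forall i, coord4 a i < coord4 x i < coord4 b i].

Lemma forall_ord4 (P : 'I_4 -> Prop) (Q : nat -> Prop) :
  (forall i : 'I_4, P i <-> Q i) -> (forall i, P i) <-> [/\ Q 0%N, Q 1%N, Q 2%N & Q 3%N].
Proof.
move=> PQ; split.
  by move=> H; split; [apply/(PQ (@Ordinal 4 0 isT))|apply/(PQ (@Ordinal 4 1 isT))|
    apply/(PQ (@Ordinal 4 2 isT))|apply/(PQ (@Ordinal 4 3 isT))].
by move=> [? ? ? ?] [[|[|[|[|//]]]] H]; apply/PQ.
Qed.

Lemma boxE (a b : R4 R) : box a b =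
  ((`]a.1.1.1, b.1.1.1[%classic `*` `]a.1.1.2, b.1.1.2[%classic) `*` `]a.1.2, b.1.2[%classic) `*`
     `]a.2, b.2[%classic.
Proof.
apply/seteqP; split => x.
  move/(@forall_ord4 _ (fun i => [:: a.1.1.1; a.1.1.2; a.1.2; a.2]`_i <
    [:: x.1.1.1; x.1.1.2; x.1.2; x.2]`_i < [:: b.1.1.1; b.1.1.2; b.1.2; b.2]`_i)).
  case; first by move=> i; rewrite !coord4E.
  by move=> /= h1 h2 h3 h4; split; [split; [split|]|]; rewrite /= in_itv.
move=> [[[h1 h2] h3] h4]; move: h1 h2 h3 h4; rewrite /= !in_itv/= => h1 h2 h3 h4.
apply/(@forall_ord4 _ (fun i => [:: a.1.1.1; a.1.1.2; a.1.2; a.2]`_i <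
    [:: x.1.1.1; x.1.1.2; x.1.2; x.2]`_i < [:: b.1.1.1; b.1.1.2; b.1.2; b.2]`_i)) => //.
by move=> i; rewrite !coord4E.
Qed.

Lemma measurable_box (a b : R4 R) : measurable (box a b).
Proof. by rewrite boxE; do ! apply: measurableX => //. Qed.

Lemma lebesgue4_box (a b : R4 R) : (forall i, coord4 a i <= coord4 b i) ->
  mu (box a b) = (\prod_(i < 4) (coord4 b i - coord4 a i))%:E.
Proof.
move=> ab; rewrite boxE /lebesgue4.
have mI (c d : R) : measurable (`]c, d[%classic : set (measurableTypeR R)) by [].
have L (i : nat) (H : (i < 4)%N) : lebesgue_measure
    (`]([:: a.1.1.1; a.1.1.2; a.1.2; a.2]`_i), ([:: b.1.1.1; b.1.1.2; b.1.2; b.2]`_i)[%classic) =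
    ([:: b.1.1.1; b.1.1.2; b.1.2; b.2]`_i - [:: a.1.1.1; a.1.1.2; a.1.2; a.2]`_i)%:E.
  have := ab (Ordinal H); rewrite !coord4E /= => abi.
  rewrite lebesgue_measure_itv/= lte_fin; case: ltP => //.
  by move=> h; congr EFin; apply/esym/eqP; rewrite subr_eq0 eq_le h abi.
have E2 : (@lebesgue_measure R \x @lebesgue_measure R)%E
    (`]a.1.1.1, b.1.1.1[%classic `*` `]a.1.1.2, b.1.1.2[%classic) =
    ((b.1.1.1 - a.1.1.1) * (b.1.1.2 - a.1.1.2))%:E.
  by apply: (etrans (product_measure1E _ _ (mI _ _) (mI _ _))); rewrite EFinM; congr (_ * _)%E;
    [exact: (L 0%N isT)|exact: (L 1%N isT)].
have E3 : (@lebesgue_measure R \x @lebesgue_measure R \x @lebesgue_measure R)%E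
    ((`]a.1.1.1, b.1.1.1[%classic `*` `]a.1.1.2, b.1.1.2[%classic) `*` `]a.1.2, b.1.2[%classic) =
    ((b.1.1.1 - a.1.1.1) * (b.1.1.2 - a.1.1.2) * (b.1.2 - a.1.2))%:E.
  apply: (etrans (product_measure1E _ _ (measurableX (mI _ _) (mI _ _)) (mI _ _))).
  by rewrite EFinM; congr (_ * _)%E; [exact: E2|exact: (L 2%N isT)].
apply: (etrans (product_measure1E _ _ (measurableX (measurableX (mI _ _) (mI _ _)) (mI _ _)) (mI _ _))).
transitivity (((b.1.1.1 - a.1.1.1) * (b.1.1.2 - a.1.1.2) * (b.1.2 - a.1.2))%:E * (b.2 - a.2)%:E)%E.
  by congr (_ * _)%E; [exact: E3|exact: (L 3%N isT)].
by rewrite -!EFinM; congr EFin; rewrite !big_ord_recr big_ord0/= !coord4E/= mul1r.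
Qed.

Definition cst4 (c : R) : R4 R := mk4 c c c c.

Lemma coord4_cst4 c i : coord4 (cst4 c) i = c.
Proof. by rewrite coord4E; case: i => [[|[|[|[|//]]]] H]. Qed.

Lemma uball_sub_box : B `<=` box (cst4 (-1)) (cst4 1).
Proof.
move=> x; rewrite uballE => x1 i; rewrite !coord4_cst4.
rewrite -ltr_norml -(ltr_pXn2r (n := 2)) ?nnegrE// real_normK ?num_real// expr1n.
exact: le_lt_trans (coord4_le_sqnorm _ _) x1.
Qed.

Lemma mu_uball_lty : (mu B < +oo)%E.
Proof.
apply: (@le_lt_trans _ _ (mu (box (cst4 (-1)) (cst4 1)))).
  apply: le_measure; rewrite ?inE; [exact: measurable_uball|exact: measurable_box|exact: uball_sub_box].
by rewrite lebesgue4_box ?ltry// => i; rewrite !coord4_cst4; lra.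
Qed.

Lemma mu_uball_gt0 : (0 < mu B)%E.
Proof.
apply: (@lt_le_trans _ _ (mu (box (cst4 (-(1/3))) (cst4 (1/3))))).
  rewrite lebesgue4_box => [|i]; last by rewrite !coord4_cst4; lra.
  by rewrite lte_fin; apply: prodr_gt0 => i _; rewrite !coord4_cst4; lra.
apply: le_measure; rewrite ?inE; [exact: measurable_box|exact: measurable_uball|].
move=> x xb; rewrite uballE.
apply: (@le_lt_trans _ _ (\sum_(i < 4) ((1/9) : R))).
  apply: ler_sum => i _; have := xb i; rewrite !coord4_cst4; nra.
by rewrite sumr_const card_ord; lra.
Qed.

Lemma integrable_ball_bounded f (M : R) : measurable_fun B f ->
  (forall x, B x -> `|f x| <= M) -> integrable_ball f.
Proof.
move=> mf fM; apply: measurable_bounded_integrable => //.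
- exact: measurable_uball.
- exact: mu_uball_lty.
exists M; split; first exact: num_real.
by move=> y My x Bx /=; apply: le_trans (fM x Bx) (ltW My).
Qed.

Lemma L2BP u : L2B u <-> measurable_fun B u /\ integrable_ball (fun x => u x ^+ 2).
Proof.
have mB := measurable_uball.
have E : (EFin \o (fun x => u x ^+ 2)) \_ B = EFin \o (fun x => (u \_ B) x ^+ 2).
  apply/funext => x; rewrite /patch /=; case: ifP => //; by rewrite expr0n.
split.
  move=> Lu; split.
    move: Lu; rewrite /L2B inE => /andP[]; rewrite inE /= => mu_ _.
    by apply/(measurable_restrictT _ mB).
  by apply/(integrable_mkcond _ mB); rewrite E; exact: Lfun2_integrable_sqr.
move=> [mu_ iu]; rewrite /L2B inE; apply/andP; split; rewrite inE /=.
  by apply/(measurable_restrictT _ mB).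
move/(integrable_mkcond _ mB): iu; rewrite E => /integrableP[_].
rewrite /finite_norm unlock => H; apply: poweR_lty.
apply: le_lt_trans H; rewrite le_eqVlt; apply/orP; left; apply/eqP.
apply: eq_integral => x _ /=; congr EFin.
by rewrite powR_mulrn// normrX.
Qed.

Lemma L2B_mul u v : L2B u -> L2B v -> integrable_ball (fun x => u x * v x).
Proof.
move=> Lu Lv; have mB := measurable_uball.
apply/(integrable_mkcond _ mB).
have -> : (EFin \o (fun x => u x * v x)) \_ B = EFin \o ((u \_ B) \* (v \_ B)).
  by apply/funext => x; rewrite /patch /=; case: ifP => //; rewrite mul0r.
by apply/Lfun1_integrable; exact: Lfun2_mul_Lfun1.
Qed.

Lemma L2B_measurable u : L2B u -> measurable_fun B u.
Proof. by move=> /L2BP[]. Qed.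

Lemma L2B_bounded f (M : R) : measurable_fun B f ->
  (forall x, B x -> `|f x| <= M) -> L2B f.
Proof.
move=> mf fM; apply/L2BP; split => //.
apply: (@integrable_ball_bounded _ (M ^+ 2)); first exact: measurable_funX.
by move=> x Bx; rewrite normrX lerXn2r// ?nnegrE// ?(le_trans _ (fM x Bx))// fM.
Qed.

Lemma L2B_cst (c : R) : L2B (fun=> c).
Proof. by apply: (@L2B_bounded _ `|c|) => //; exact: measurable_cst. Qed.

Lemma L2B_integrable u : L2B u -> integrable_ball u.
Proof.
move=> Lu; have := L2B_mul Lu (L2B_cst 1).
by under eq_fun do rewrite mulr1.
Qed.

Lemma L2BZ (c : R) u : L2B u -> L2B (fun x => c * u x).
Proof.
move=> /L2BP[mu_ iu]; apply/L2BP; split; first exact: measurable_funM.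
have := integrableZl measurable_uball (c ^+ 2) iu.
by apply: eq_integrable; [exact: measurable_uball|move=> x _ /=; rewrite exprMn EFinM].
Qed.

Lemma L2BD u v : L2B u -> L2B v -> L2B (fun x => u x + v x).
Proof.
move=> Lu Lv; have mB := measurable_uball.
have [mu_ iu] := (L2BP u).1 Lu; have [mv iv] := (L2BP v).1 Lv.
apply/L2BP; split; first exact: measurable_funD.
have iuv := integrableZl mB 2 (L2B_mul Lu Lv).
have := integrableD mB (integrableD mB iu iv) iuv.
apply: eq_integrable => // x _ /=.
by rewrite -EFinM -!EFinD; congr EFin; ring.
Qed.

Lemma L2BB u v : L2B u -> L2B v -> L2B (fun x => u x - v x).
Proof.
move=> Lu Lv; have := L2BD Lu (L2BZ (-1) Lv).
by under eq_fun do rewrite mulN1r.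
Qed.

Lemma L2B_sum (I : Type) (r : seq I) (F : I -> R4 R -> R) :
  (forall i, L2B (F i)) -> L2B (fun x => \sum_(i <- r) F i x).
Proof.
move=> LF; elim: r => [|a r IH].
  by under eq_fun do rewrite big_nil; exact: L2B_cst.
by under eq_fun do rewrite big_cons; apply: L2BD.
Qed.

Lemma intBZ (c : R) f : integrable_ball f -> intB (fun x => c * f x) = c * intB f.
Proof. by move=> i; rewrite /intB RintegralZl//; exact: measurable_uball. Qed.

Lemma intBD f g : integrable_ball f -> integrable_ball g ->
  intB (fun x => f x + g x) = intB f + intB g.
Proof. by move=> i1 i2; rewrite /intB RintegralD//; exact: measurable_uball. Qed.

Lemma intBB f g : integrable_ball f -> integrable_ball g ->
  intB (fun x => f x - g x) = intB f - intB g.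
Proof. by move=> i1 i2; rewrite /intB RintegralB//; exact: measurable_uball. Qed.

Lemma integrable_ballZ (c : R) f : integrable_ball f -> integrable_ball (fun x => c * f x).
Proof. by move=> i; exact: (integrableZl measurable_uball c i). Qed.

Lemma integrable_ballD f g : integrable_ball f -> integrable_ball g ->
  integrable_ball (fun x => f x + g x).
Proof. by move=> i1 i2; exact: (integrableD measurable_uball i1 i2). Qed.

Lemma integrable_ball_sum (I : Type) (r : seq I) (F : I -> R4 R -> R) :
  (forall i, integrable_ball (F i)) -> integrable_ball (fun x => \sum_(i <- r) F i x).
Proof.
move=> LF; elim: r => [|a r IH].
  under eq_fun do rewrite big_nil.
  exact: L2B_integrable (L2B_cst 0).
by under eq_fun do rewrite big_cons; apply: integrable_ballD.
Qed.

Lemma intB_sum (I : Type) (r : seq I) (F : I -> R4 R -> R) :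
  (forall i, integrable_ball (F i)) -> intB (fun x => \sum_(i <- r) F i x) = \sum_(i <- r) intB (F i).
Proof.
move=> LF; elim: r => [|a r IH].
  under eq_fun do rewrite big_nil.
  by rewrite big_nil /intB /Rintegral integral0.
under eq_fun do rewrite big_cons.
by rewrite intBD ?IH ?big_cons//; exact: integrable_ball_sum.
Qed.

Lemma intB_ge0 f : (forall x, B x -> 0 <= f x) -> 0 <= intB f.
Proof. by move=> f0; exact: Rintegral_ge0. Qed.

Lemma intB_le f g : integrable_ball f -> integrable_ball g -> (forall x, B x -> f x <= g x) ->
  intB f <= intB g.
Proof. by move=> i1 i2 fg; apply: le_Rintegral => //; exact: measurable_uball. Qed.

Lemma intB_cst (c : R) : intB (fun=> c) = c * fine (mu B).
Proof. by rewrite /intB Rintegral_cst//; exact: measurable_uball. Qed.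

Lemma intBE f : integrable_ball f -> (\int[mu]_(x in B) (f x)%:E)%E = (intB f)%:E.
Proof. by move=> i; rewrite /intB /Rintegral fineK// integrable_fin_num//; exact: measurable_uball. Qed.

Lemma normL2BE u : L2B u -> normL2B u = (Num.sqrt (intB (fun x => u x ^+ 2)))%:E.
Proof.
move=> /[dup] Lu /L2BP[_ iu]; have mB := measurable_uball.
rewrite /normL2B unlock.
have -> : (\int[mu]_x (`|(EFin \o u \_ B) x| `^ 2) = (intB (fun x => u x ^+ 2))%:E)%E.
  rewrite -intBE// [RHS]integral_mkcond; apply: eq_integral => x _.
  rewrite /patch /=; case: ifP => _.
    by congr EFin; rewrite powR_mulrn// real_normK// num_real.
  by congr EFin; rewrite powR_mulrn// normr0 expr0n.
by rewrite poweR_EFin powR12_sqrt//; apply: intB_ge0 => x _; exact: sqr_ge0.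
Qed.

Lemma cauchy_schwarzB u v : L2B u -> L2B v ->
  `|intB (fun x => u x * v x)| <=
    Num.sqrt (intB (fun x => u x ^+ 2)) * Num.sqrt (intB (fun x => v x ^+ 2)).
Proof.
move=> Lu Lv; have [_ iu] := (L2BP u).1 Lu; have [_ iv] := (L2BP v).1 Lv.
have iuv := L2B_mul Lu Lv.
set a := intB (fun x => u x ^+ 2); set b := intB (fun x => v x ^+ 2); set c := intB _.
have a0 : 0 <= a by apply: intB_ge0 => x _; exact: sqr_ge0.
have b0 : 0 <= b by apply: intB_ge0 => x _; exact: sqr_ge0.
have H (t : R) : 0 <= a + t * (2 * c) + t ^+ 2 * b.
  have : 0 <= intB (fun x => u x ^+ 2 + t * (2 * (u x * v x)) + t ^+ 2 * v x ^+ 2).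
    apply: intB_ge0 => x _.
    have -> : u x ^+ 2 + t * (2 * (u x * v x)) + t ^+ 2 * v x ^+ 2 = (u x + t * v x) ^+ 2 by ring.
    exact: sqr_ge0.
  rewrite !intBD ?intBZ//; try exact: integrable_ballZ.
    by apply: integrable_ballZ; apply: integrable_ballZ.
  by apply: integrable_ballD => //; apply: integrable_ballZ; apply: integrable_ballZ.
suff c2 : c ^+ 2 <= a * b.
  rewrite -sqrtrM// -(ler_pXn2r (n := 2)) ?nnegrE ?sqrtr_ge0//.
  by rewrite real_normK ?num_real// sqr_sqrtr ?mulr_ge0.
have [bz|bp] := eqVneq b 0.
  have cz : c = 0.
    apply/eqP; apply: contraT => cn.
    (* At this [t] the nonnegative affine function [a + 2 c t] would take the value -1. *)
    have := H (- (a + 1) / (2 * c)); rewrite bz mulr0 addr0 -mulrA mulVf ?mulf_neq0//.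
    by move=> h; exfalso; move: h; rewrite mulr1; lra.
  by rewrite cz bz mulr0 expr0n.
have bp' : 0 < b by rewrite lt_neqAle eq_sym bp.
have := H (- c / b).
have -> : a + - c / b * (2 * c) + (- c / b) ^+ 2 * b = (a * b - c ^+ 2) / b by field.
by rewrite pmulr_lge0 ?invr_gt0// subr_ge0.
Qed.

Lemma dominated_intB v (f_ : nat -> R4 R -> R) f (M : R) : integrable_ball v ->
  (forall k, measurable_fun B (f_ k)) ->
  (forall k x, B x -> `|f_ k x| <= M) ->
  (forall x, B x -> f_ k x @[k --> \oo] --> f x) ->
  intB (fun x => v x * f_ k x) @[k --> \oo] --> intB (fun x => v x * f x).
Proof.
move=> iv mf fM fc; have mB := measurable_uball.
have mv : measurable_fun B v by apply/measurable_EFinP; exact: measurable_int iv.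
have mfl : measurable_fun B f by exact: measurable_fun_cvg mf fc.
have ig : mu.-integrable B (fun x => (M%:E * `|(EFin \o v) x|)%E).
  by apply: integrableZl => //; exact: integrable_abse.
have M0 x : B x -> 0 <= M by move=> Bx; rewrite (le_trans _ (fM 0%N x Bx)).
have [] := @dominated_convergence _ _ _ mu B mB (fun k x => (v x * f_ k x)%:E)
  (fun x => (v x * f x)%:E) _ _ _ _ ig _.
- by move=> k; apply/measurable_EFinP; exact: measurable_funM.
- by apply/measurable_EFinP; exact: measurable_funM.
- apply: aeW => x Bx; apply: cvg_EFin; first by apply: nearW => k.
  by apply: cvgM; [exact: cvg_cst|exact: fc].
- apply: aeW => x k Bx /=; rewrite lee_fin normrM mulrC ler_wpM2r//; exact: fM.
move=> ifl _ H; apply: fine_cvg; rewrite fineK//; exact: integrable_fin_num.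
Qed.

End L2ball.

(** * Test functions and weak derivatives *)

Section TestFunctions.
Context {R : realType}.
Local Notation mu := (@lebesgue4 R).
Local Notation B := (@uball R).
Implicit Types (f g u v w phi theta : R4 R -> R) (x : R4 R).

Lemma compact_sqnorm_le (r : R) : r <= 1 -> compact [set x : R4 R | sqnorm x <= r].
Proof.
move=> r1.
apply: (@subclosed_compact _ _ ((((`[(-1 : R), 1] `*` `[(-1 : R), 1]) `*` `[(-1 : R), 1]) `*` `[(-1 : R), 1])%classic : set (R4 R))).
- have -> : [set x : R4 R | sqnorm x <= r] = (@sqnorm R) @^-1` [set` `]-oo, r]].
    by apply/seteqP; split => x /=; rewrite in_itv.
  apply: preimage_closed; last exact: interval_closed.
  by move=> x _; exact: (smooth_continuous smooth_sqnorm).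
- do ! apply: compact_setX; exact: segment_compact.
move=> x /= xr.
have H i : -1 <= coord4 x i <= 1.
  rewrite -ler_norml -(ler_pXn2r (n := 2)) ?nnegrE// real_normK ?num_real// expr1n.
  exact: le_trans (coord4_le_sqnorm _ _) (le_trans xr r1).
have := H (@Ordinal 4 0 isT); have := H (@Ordinal 4 1 isT).
have := H (@Ordinal 4 2 isT); have := H (@Ordinal 4 3 isT).
by rewrite !coord4E /= => ? ? ? ?; split; [split; [split|]|]; rewrite /= in_itv.
Qed.

Lemma test_fun_intro phi (r : R) : r < 1 -> is_smooth phi ->
  (forall x, phi x != 0 -> sqnorm x <= r) -> test_fun phi.
Proof.
move=> r1 sphi H.
have cl : closed [set x : R4 R | sqnorm x <= r].
  have -> : [set x : R4 R | sqnorm x <= r] = (@sqnorm R) @^-1` [set` `]-oo, r]].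
    by apply/seteqP; split => x /=; rewrite in_itv.
  apply: preimage_closed; last exact: interval_closed.
  by move=> x _; exact: (smooth_continuous smooth_sqnorm).
have sub : closure [set x | phi x != 0] `<=` [set x : R4 R | sqnorm x <= r].
  by rewrite [X in _ `<=` X]((closure_id _).1 cl); apply: closureS => x /H.
case: sphi => sphi; split => //.
  apply: subclosed_compact (compact_sqnorm_le (ltW r1)) sub.
  exact: closed_closure.
by move=> x /sub /= xr; rewrite uballE; exact: le_lt_trans xr r1.
Qed.

Lemma test_fun_smooth phi : test_fun phi -> is_smooth phi.
Proof. by case => sphi _ _; constructor. Qed.

Lemma test_fun_eq0 phi x : test_fun phi -> ~ B x -> phi x = 0.
Proof.
move=> [_ _ sB] nB; apply: contra_notP nB => /eqP h.
by apply: sB; apply: subset_closure.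
Qed.

Lemma test_fun_sub phi f : test_fun phi -> is_smooth f ->
  [set x | f x != 0] `<=` closure [set x | phi x != 0] -> test_fun f.
Proof.
move=> [sphi cphi sB] sf sub.
have sub' : closure [set x | f x != 0] `<=` closure [set x | phi x != 0].
  rewrite [X in _ `<=` X]((closure_id _).1 (@closed_closure _ _)); exact: closureS.
case: sf => sf; split => //; last exact: subset_trans sub' sB.
by apply: subclosed_compact cphi sub'; exact: closed_closure.
Qed.

Lemma test_funM f phi : is_smooth f -> test_fun phi -> test_fun (fun x => f x * phi x).
Proof.
move=> sf tphi; apply: (test_fun_sub tphi).
  by apply: smoothM => //; exact: test_fun_smooth.
by move=> x /=; rewrite mulf_eq0 negb_or => /andP[_ h]; exact: subset_closure.
Qed.

Lemma test_fun_pderiv s phi : test_fun phi -> test_fun (pderiv s phi).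
Proof.
elim: s => //= i s IH tphi; have {IH tphi} := IH tphi.
set psi := pderiv s phi => tpsi; have spsi := test_fun_smooth tpsi.
apply: (test_fun_sub tpsi); first exact: (smooth_pderiv [:: i]).
move=> x /= /eqP h; apply: contrapT => nc; apply: h.
rewrite -[RHS](@derive_cst _ (R4 R) R (0:R) x (basis4 i)); apply: near_eq_derive.
have op : open (~` closure [set x | psi x != 0]) by apply/closed_openC/closed_closure.
have := open_nbhs_nbhs (conj op nc).
apply: filterS => y ny; apply/eqP; apply: contrapT => /negP h; apply: ny.
exact: subset_closure.
Qed.

Lemma test_funZ (c : R) phi : test_fun phi -> test_fun (fun x => c * phi x).
Proof. by move=> t; apply: test_funM => //; exact: smooth_cst. Qed.

Lemma smooth_bounded phi : is_smooth phi -> exists2 M, 0 < M & forall x, B x -> `|phi x| <= M.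
Proof.
move=> /smooth_continuous cphi.
have cK := compact_sqnorm_le (lexx 1).
have cn : {within [set x : R4 R | sqnorm x <= 1], continuous (fun x => `|phi x|)}.
  apply: continuous_subspaceT => x.
  by apply: continuous_comp; [exact: cphi|exact: norm_continuous].
have [|c _ Hc] := compact_EVT_max _ cK cn.
  by exists 0; rewrite /= /sqnorm big1// => i _; rewrite coord4E; case: i => [[|[|[|[|//]]]] H]; rewrite /= expr0n.
exists (`|phi c| + 1); first by rewrite ltr_wpDl.
move=> x; rewrite uballE => x1; rewrite (le_trans (Hc x _)) ?lerDl//.
by rewrite inE /=; exact: ltW.
Qed.

Lemma test_fun_bounded phi : test_fun phi -> exists2 M, 0 < M & forall x, `|phi x| <= M.
Proof.
move=> tphi; have [M M0 HM] := smooth_bounded (test_fun_smooth tphi).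
exists M => // x; have [/HM//|nB] := pselect (B x).
by rewrite (test_fun_eq0 tphi nB) normr0 ltW.
Qed.

Lemma smooth_L2B f : is_smooth f -> L2B f.
Proof.
move=> sf; have [M _ HM] := smooth_bounded sf.
by apply: L2B_bounded HM; apply: smooth_measurable => //; exact: measurable_uball.
Qed.

(** Difference quotients of step [1/(k+1)] integrate to 0 by translation invariance, and dominated
    convergence passes to the derivative. The mean value theorem supplies the dominating
    constant. *)
Lemma intB_pderiv1 theta i : test_fun theta -> intB (pderiv [:: i] theta) = 0.
Proof.
move=> tt; have st := test_fun_smooth tt.
have tdt := test_fun_pderiv [:: i] tt.
have [M M0 HM] := test_fun_bounded tdt.
have mt : measurable_fun setT theta by apply: smooth_measurable.
have mB := measurable_uball (R := R).
pose h (k : nat) : R := k.+1%:R^-1.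
have h0 k : 0 < h k by rewrite invr_gt0.
have h1 k : h k <= 1 by rewrite invf_le1 ?ler1n.
pose T (k : nat) x : R4 R := 1 *: x + h k *: (basis4 i : R4 R).
have TE k x : T k x = h k *: (basis4 i : R4 R) + x by rewrite /T scale1r addrC.
have mT k : measurable_fun setT (T k) by exact: measurable_affine4.
have it : mu.-integrable setT (EFin \o theta).
  have -> : EFin \o theta = (EFin \o theta) \_ B.
    apply/funext => x; rewrite /patch; case: ifPn => // /negP nB; rewrite /= (test_fun_eq0 tt)//.
    by move=> Bx; apply: nB; rewrite inE.
  by apply/(integrable_mkcond _ mB); exact: L2B_integrable (smooth_L2B st).
have pw k (A : set (R4 R)) : measurable A -> pushforward mu (T k) A = mu A.
  by move=> mA; rewrite /pushforward (lebesgue4_affine _ ltr01 mA) expr1n invr1 mul1e.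
have itk k : mu.-integrable setT (EFin \o (theta \o T k)).
  apply/integrableP; split; first by apply/measurable_EFinP; exact: measurableT_comp.
  have /integrableP[_] := it.
  rewrite (eq_measure_integral (pushforward mu (T k))); last by move=> A mA _; exact/esym/pw.
  rewrite ge0_integral_pushforward//=.
  by apply/measurable_EFinP; apply: measurableT_comp.
have eqk k : (\int[mu]_x (theta (T k x))%:E = \int[mu]_x (theta x)%:E)%E.
  rewrite [RHS](eq_measure_integral (pushforward mu (T k))); last by move=> A mA _; exact/esym/pw.
  exact/esym/(@integral_pushforward _ _ _ _ _ _ (mT k) mu setT (EFin \o theta) ((measurable_EFinP _ _).2 mt) (itk k) measurableT).
(* The steps are at most 1, so this fixed box contains the supports of all the translates. *)
pose D := box (cst4 (-2) : R4 R) (cst4 2).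
have mD : measurable D by exact: measurable_box.
have Dlt : (mu D < +oo)%E.
  by rewrite lebesgue4_box ?ltry// => j; rewrite !coord4_cst4; lra.
have BD : B `<=` D.
  by move=> x /uball_sub_box xb j; have := xb j; rewrite !coord4_cst4; lra.
have lip k x : `|theta (T k x) - theta x| <= M * h k.
  pose g (t : R) := theta (t *: (basis4 i : R4 R) + x).
  have dg (t : R) : is_derive t (1:R) g (pderiv [:: i] theta (t *: (basis4 i : R4 R) + x)).
    by apply/is_derive_line; exact: smooth_is_derive.
  have [c _ Hc] := @MVT _ g (fun t => pderiv [:: i] theta (t *: (basis4 i : R4 R) + x)) 0 (h k) (h0 k)
    (fun t _ => dg t) (derivable_within_continuous (fun t _ => @ex_derive _ _ _ _ _ _ _ (dg t))).
  rewrite TE; move: Hc; rewrite /g scale0r add0r subr0 => ->.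
  by rewrite normrM (gtr0_norm (h0 k)) ler_pM2r// HM.
have supp k x : ~ D x -> theta (T k x) = 0.
  move=> nD; apply: test_fun_eq0 => // /uball_sub_box bT; apply: nD => j.
  have := bT j; rewrite TE coord4_linear coord4_basis !coord4_cst4.
  have := h0 k; have := h1 k; case: (j == i); rewrite ?mulr1 ?mulr0; lra.
pose q k x : R := (h k)^-1 * (theta (T k x) - theta x).
have ig : mu.-integrable setT (EFin \o (fun x => M * \1_D x)).
  have -> : EFin \o (fun x => M * \1_D x) = (EFin \o (fun=> M)) \_ D.
    by apply/funext => x; rewrite /patch /= indicE; case: ifPn; rewrite ?mulr1 ?mulr0.
  apply/(integrable_mkcond _ mD); apply: measurable_bounded_integrable => //.
  exists M; split; first exact: num_real.
  by move=> y My z _ /=; rewrite gtr0_norm// ltW.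
have [] := @dominated_convergence _ _ _ mu setT measurableT (fun k x => (q k x)%:E)
  (fun x => (pderiv [:: i] theta x)%:E) _ _ _ _ ig _.
- move=> k; apply/measurable_EFinP; apply: measurable_funM => //; apply: measurable_funB => //.
  exact: measurableT_comp.
- by apply/measurable_EFinP; apply: smooth_measurable => //; exact: test_fun_smooth.
- apply: aeW => x _; apply: cvg_EFin; first by apply: nearW => k.
  have [/(_ [::])[_ /(_ x i) dx]] := st.
  move/cvg_ex: (dx) => [l Hl].
  have El : pderiv [:: i] theta x = l by exact: cvg_lim Hl.
  rewrite El.
  have Hc := (cvgr_dnbhsP _ _ _).1 Hl h (conj (fun n => lt0r_neq0 (h0 n)) cvg_harmonic).
  rewrite (_ : fine \o _ = fun n => (h n)^-1 *:
    ((theta \o shift x) (h n *: (basis4 i : R4 R)) - theta x)); first exact: Hc.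
  by apply/funext => k; rewrite /= /q TE.
- apply: aeW => x k _; rewrite /= lee_fin /q normrM ger0_norm ?invr_ge0 ?(ltW (h0 k))//.
  rewrite indicE; case: (pselect (D x)) => Dx.
    rewrite mem_set// mulr1 ler_pdivrMl// mulrC; exact: lip.
  rewrite memNset// mulr0 supp// (test_fun_eq0 tt); last by move=> /BD.
  by rewrite subrr normr0 mulr0.
move=> _ _ H.
have Z k : (\int[mu]_x (q k x)%:E = 0)%E.
  under eq_integral do rewrite /q EFinM.
  rewrite integralZl//; last by apply: (integrableB measurableT (itk k) it).
  rewrite (_ : (\int[mu]_x (theta (T k x) - theta x)%:E = 0)%E) ?mule0//.
  rewrite (integralB_EFin measurableT (itk k) it) eqk subee//.
  exact: integrable_fin_num it.
have : (\int[mu]_x (pderiv [:: i] theta x)%:E = 0)%E.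
  have Hz : (fun k => \int[mu]_x (q k x)%:E)%E = cst 0%E by apply/funext => k; exact: Z.
  rewrite -(cvg_lim (@ereal_hausdorff R) H) Hz; exact: lim_cst.
rewrite /intB /Rintegral integral_mkcond => E.
rewrite (_ : (\int[mu]_x _)%E = 0%E)// -[RHS]E.
apply: eq_integral => x _; rewrite /patch; case: ifPn => // /negP nB.
by rewrite (test_fun_eq0 tdt)// => Bx; apply: nB; rewrite inE.
Qed.
End TestFunctions.

(** * Weak derivatives: agreement with the classical ones, uniqueness *)

Section WeakDerivatives.
Context {R : realType}.
Local Notation mu := (@lebesgue4 R).
Local Notation B := (@uball R).
Implicit Types (f g u v w phi theta : R4 R -> R) (x : R4 R).

Lemma intB_pderiv1_by_parts f phi i : is_smooth f -> test_fun phi ->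
  intB (fun x => f x * pderiv [:: i] phi x) = - intB (fun x => pderiv [:: i] f x * phi x).
Proof.
move=> sf tphi; have sphi := test_fun_smooth tphi.
have := intB_pderiv1 i (test_funM sf tphi).
rewrite pderiv1M// intBD; last 2 first.
- by apply: L2B_mul; apply: smooth_L2B => //; exact: smooth_pderiv.
- by apply: L2B_mul; apply: smooth_L2B => //; exact: smooth_pderiv.
move/eqP; rewrite addr_eq0 => /eqP ->; congr (- intB _).
by apply/funext => x; rewrite mulrC.
Qed.

(* The partial derivatives come out in reverse order; that they commute is
   never needed. *)
Lemma intB_pderiv_by_parts s f phi : is_smooth f -> test_fun phi ->
  intB (fun x => f x * pderiv s phi x) =
  (-1) ^+ size s * intB (fun x => pderiv (rev s) f x * phi x).
Proof.
elim: s f => [|i s IH] f sf tphi; first by rewrite /= expr0 mul1r.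
rewrite (intB_pderiv1_by_parts _ sf (test_fun_pderiv s tphi)).
rewrite IH//; last exact: (smooth_pderiv [:: i]).
by rewrite -pderiv_cat cats1 -rev_cons exprS mulN1r mulNr.
Qed.

Lemma smooth_weak_deriv s f : is_smooth f -> weak_deriv s f (pderiv (rev s) f).
Proof. by move=> sf phi tphi; exact: intB_pderiv_by_parts. Qed.

Lemma smooth_Hk k f : is_smooth f -> Hk k f.
Proof.
move=> sf; split; first exact: smooth_L2B.
move=> s _; exists (pderiv (rev s) f); first exact/smooth_L2B/smooth_pderiv.
exact: smooth_weak_deriv.
Qed.

(** It vanishes where [1 - |x|^2 <= 1/(k+1)], hence near the sphere, and equals 1 where
    [1 - |x|^2 >= 2/(k+1)]. *)
Definition cutoff (k : nat) x : R := ramp (k.+1%:R * (1 - sqnorm x)).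

Lemma smooth1_affine (a b : R) : smooth1 (fun t => a * (b - t)).
Proof.
by apply: smooth1M; [exact: smooth1_cst|apply: smooth1B; [exact: smooth1_cst|exact: smooth1_id]].
Qed.

Lemma smooth_cutoff k : is_smooth (cutoff k).
Proof.
apply: (smooth_comp smooth1_ramp).
by apply: (smooth_comp (smooth1_affine k.+1%:R 1)); exact: smooth_sqnorm.
Qed.

Lemma test_fun_cutoff k : test_fun (cutoff k).
Proof.
apply: (@test_fun_intro _ _ (1 - k.+1%:R^-1)).
- by rewrite ltrBlDr ltrDl invr_gt0.
- exact: smooth_cutoff.
move=> x; apply: contraNT; rewrite -ltNge => h; apply/eqP/ramp_eq0.
by rewrite mulrC -ler_pdivlMr// div1r lerBlDr addrC -lerBlDr ltW.
Qed.

Lemma cutoff_bound k x : `|cutoff k x| <= 1.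
Proof. by rewrite ger0_norm ?ramp_le1 ?ramp_ge0. Qed.

Lemma cutoff_near1 x : B x -> \forall k \near \oo, cutoff k x = 1.
Proof.
rewrite uballE -subr_gt0 => s0.
near=> k; apply: ramp_eq1.
rewrite -ler_pdivrMr//.
apply: ltW; apply: lt_trans (_ : k%:R < _); last by rewrite ltr_nat.
by near: k; exact: nbhs_infty_gtr.
Unshelve. all: by end_near. Qed.

Lemma cutoff_cvg x : B x -> cutoff k x @[k --> \oo] --> (1 : R).
Proof.
move=> Bx; apply: cvg_near_cst; exact: cutoff_near1.
Qed.

Definition vec4 (F : 'I_4 -> R) : R4 R :=
  mk4 (F ord0) (F (inord 1)) (F (inord 2)) (F (inord 3)).

Lemma coord4_vec4 F i : coord4 (vec4 F) i = F i.
Proof.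
by rewrite coord4E; case: i => [[|[|[|[|//]]]] H] /=; congr F; apply/val_inj; rewrite /= ?inordK.
Qed.

Lemma vec4_coord4 x : vec4 (coord4 x) = x.
Proof. by rewrite /vec4 !coord4E /= !inordK// -mk4E. Qed.

(** An open half-space is a countable union of boxes, so the coordinates, and with them the
    identity, are measurable for the sigma-algebra generated by boxes. *)
Lemma sigma_boxes (A : set (R4 R)) : measurable A ->
  <<s [set box a b | a in [set: R4 R] & b in [set: R4 R]] >> A.
Proof.
set G := [set box a b | a in _ & b in _].
move=> mA.
pose T := g_sigma_algebraType G.
have mc (i : 'I_4) : measurable_fun [set: T] (fun x : T => coord4 x i : R).
  apply: (measurability _ (RGenOInfty.measurableE R)) => _ [_ [t -> <-]].
  rewrite setTI.
  have -> : (fun x : T => coord4 x i) @^-1` [set` `]t, +oo[] =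
    \bigcup_n (box (vec4 (fun j => if j == i then t else - n%:R)) (cst4 n%:R) : set T).
    apply/seteqP; split => x /=; rewrite in_itv/= andbT.
      move=> tx; near \oo => n; exists n => // j.
      have : `|coord4 x j| < n%:R.
        move: j; near: n; apply: filter_forall => j; exact: nbhs_infty_gtr.
      rewrite coord4_vec4 coord4_cst4 ltr_norml => /andP[h1 h2].
      by case: eqP => [ji|_]; rewrite ?h1 ?h2// andbT ji.
    by move=> [n _ /(_ i)]; rewrite coord4_vec4 eqxx => /andP[].
  apply: bigcupT_measurable => n; apply: sub_sigma_algebra.
  by exists (vec4 (fun j => if j == i then t else - n%:R)) => //; exists (cst4 n%:R).
have mid : measurable_fun [set: T] (fun x : T => vec4 (coord4 x)).
  by apply: measurable_fun_mk4.
have := mid measurableT A mA; rewrite setTI.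
rewrite (_ : _ @^-1` A = A) //.
by apply/seteqP; split => x /=; rewrite vec4_coord4.
Unshelve. all: by end_near. Qed.

Lemma box_setI_closed : setI_closed [set box a b | a in [set: R4 R] & b in [set: R4 R]].
Proof.
move=> _ _ [a _ [b _ <-]] [c _ [d _ <-]].
exists (vec4 (fun i => Num.max (coord4 a i) (coord4 c i))) => //.
exists (vec4 (fun i => Num.min (coord4 b i) (coord4 d i))) => //.
apply/seteqP; split => x; rewrite /box /=.
  move=> h; split=> i; have := h i; rewrite !coord4_vec4 gt_max lt_min.
    by move=> /andP[/andP[-> _] /andP[-> _]].
  by move=> /andP[/andP[_ ->] /andP[_ ->]].
by move=> [h1 h2] i; rewrite !coord4_vec4 gt_max lt_min;
  have /andP[-> ->] := h1 i; have /andP[-> ->] := h2 i.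
Qed.

(** The measurable sets over which the extension of [w] by 0 has zero integral form a Dynkin class.
    The hypothesis [intB w = 0] puts the whole space in it, and boxes are stable under
    intersection. *)
Lemma ae_eq0_boxes w : integrable_ball w ->
  intB w = 0 -> (forall a b, intB (fun x => w x * \1_(box a b) x) = 0) ->
  {ae mu, forall x, B x -> w x = 0}.
Proof.
move=> iw w0 wbox; have mB := measurable_uball (R := R).
pose g := (EFin \o w) \_ B.
have ig : mu.-integrable setT g by exact/(integrable_mkcond _ mB).
have gA (A : set (R4 R)) : measurable A -> mu.-integrable A g.
  by move=> mA; apply: integrableS ig.
pose D := [set A : set (R4 R) | measurable A /\ (\int[mu]_(x in A) g x = 0)%E].
have dD : dynkin D.
  have DT : D setT.
    split => //; rewrite -integral_mkcond.
    by rewrite -[LHS]fineK; [rewrite -/(Rintegral _ _ _) -/(intB _) w0|exact: integrable_fin_num].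
  split => //.
    move=> A [mA A0]; split; first exact: measurableC.
    have [_] := DT; rewrite -(setUv A) integral_setU//; last 3 first.
    - exact: measurableC.
    - by rewrite setUv; case/integrableP: ig.
    - by apply/disj_setPS => x [].
    by rewrite A0 add0e.
  move=> F tF DF; split; first by apply: bigcupT_measurable => k; have [] := DF k.
  rewrite integral_bigcup//; first by rewrite eseries0// => k _ _; have [] := DF k.
    by move=> k; have [] := DF k.
  by apply: gA; apply: bigcupT_measurable => k; have [] := DF k.
have GD : [set box a b | a in [set: R4 R] & b in [set: R4 R]] `<=` D.
  move=> _ [a _ [b _ <-]]; have mbx := measurable_box a b; split => //.
  have := wbox a b; rewrite /intB /Rintegral.
  rewrite integral_mkcond [in X in _ -> X]integral_mkcond.
  rewrite (_ : (fun x => (w x * \1_(box a b) x)%:E) \_ B = g \_ (box a b)).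
    move=> h; rewrite -[LHS]fineK ?h//.
    apply: integrable_fin_num => //; exact: ((integrable_mkcond _ mbx).1 (gA _ mbx)).
  apply/funext => x; rewrite /g /patch /= indicE.
  by case: ifP; case: ifP; rewrite ?mulr1 ?mulr0.
have mD (A : set (R4 R)) : measurable A -> D A.
  move=> mA; have := sigma_boxes mA.
  rewrite -(setI_closed_g_dynkin_g_sigma_algebra box_setI_closed).
  apply: smallest_sub => //.
have := @integral_ae_eq _ _ _ mu setT measurableT (cst 0%E) g ig (measurable_cst _).
case; first by move=> E _ mE; rewrite integral0; have [_ ->] := mD E mE.
move=> N HN; exists N; case: HN => mN N0 sN; split => // x /= nx; apply: sN => /= h.
apply: nx => Bx; have := h I; rewrite /g /patch mem_set// => -[]//.
Qed.

(** The fundamental lemma of the calculus of variations, by two approximations: cutoffs lead from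
    test functions to bounded smooth functions, and products of bumps lead from those to indicators
    of boxes. *)
Lemma test_fun_ae_eq0 w : integrable_ball w ->
  (forall phi, test_fun phi -> intB (fun x => w x * phi x) = 0) ->
  {ae mu, forall x, B x -> w x = 0}.
Proof.
move=> iw H; have mB := measurable_uball (R := R).
have bd f : is_smooth f -> (forall x, `|f x| <= 1) -> intB (fun x => w x * f x) = 0.
  move=> sf f1.
  have Hc : intB (fun x => w x * (f x * cutoff k x)) @[k --> \oo] --> intB (fun x => w x * f x).
    apply: (@dominated_intB _ w (fun k x => f x * cutoff k x) f 1) => //.
    - move=> k; apply: smooth_measurable => //; apply: smoothM => //; exact: smooth_cutoff.
    - by move=> k x _; rewrite normrM mulr_ile1 ?cutoff_bound.
    - move=> x Bx; rewrite -[X in _ --> X]mulr1; apply: cvgM; first exact: cvg_cst.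
      exact: cutoff_cvg.
  have Z : (fun k => intB (fun x => w x * (f x * cutoff k x))) = cst 0.
    by apply/funext => k; apply: H; apply: test_funM => //; exact: test_fun_cutoff.
  by rewrite -(cvg_lim (@Rhausdorff R) Hc) Z; exact: lim_cst.
apply: ae_eq0_boxes => //.
  have := bd (fun=> 1) (smooth_cst 1); under eq_fun do rewrite mulr1; apply => x.
  by rewrite normr1.
move=> a b.
pose p k x := \prod_(i < 4) bump (coord4 a i) (coord4 b i) k (coord4 x i).
have p1 k x : `|p k x| <= 1.
  rewrite normr_prod; apply: prodr_ile1 => i _.
  by rewrite normr_ge0 ger0_norm ?bump_ge0// bump_le1.
have sp k : is_smooth (p k).
  apply: smooth_prod => i; apply: smooth_comp; [exact: smooth1_bump|exact: smooth_coord4].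
have Hc : intB (fun x => w x * p k x) @[k --> \oo] --> intB (fun x => w x * \1_(box a b) x).
  apply: (@dominated_intB _ w p (\1_(box a b)) 1) => //.
    by move=> k; apply: smooth_measurable.
  move=> x _.
  have -> : \1_(box a b) x = \prod_(i < 4) \1_`]coord4 a i, coord4 b i[ (coord4 x i) :> R.
    rewrite indicE; case: (pselect (box a b x)) => bx.
      by rewrite mem_set// big1// => i _; rewrite indicE mem_set//= in_itv/= bx.
    rewrite memNset//; have [i hi] : exists i, ~ (coord4 a i < coord4 x i < coord4 b i).
      by apply: contrapT => h; apply: bx => i; apply: contrapT => h'; apply: h; exists i.
    by rewrite (bigD1 i)//= indicE memNset ?mul0r//= in_itv.
  apply: (@cvg_big R _ *%R 1 xpredT (@mul_continuous R) _ _ (index_enum 'I_4)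
    (fun i k => bump (coord4 a i) (coord4 b i) k (coord4 x i))) => i _.
  exact: bump_cvg.
have Z : (fun k => intB (fun x => w x * p k x)) = cst 0.
  by apply/funext => k; exact: bd.
by rewrite -(cvg_lim (@Rhausdorff R) Hc) Z; exact: lim_cst.
Qed.

Lemma intB_ae_eq f g : measurable_fun B f -> measurable_fun B g ->
  {ae mu, forall x, B x -> f x = g x} -> intB f = intB g.
Proof.
move=> mf mg H; rewrite /intB /Rintegral; congr fine.
apply: ae_eq_integral; [exact: measurable_uball|exact/measurable_EFinP|exact/measurable_EFinP|].
by apply: filterS H => x Hx Bx /=; rewrite Hx.
Qed.

Lemma weak_deriv_unique s u w1 w2 : L2B w1 -> L2B w2 ->
  weak_deriv s u w1 -> weak_deriv s u w2 -> {ae mu, forall x, B x -> w1 x = w2 x}.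
Proof.
move=> L1 L2 H1 H2.
have := @test_fun_ae_eq0 (fun x => w1 x - w2 x) (L2B_integrable (L2BB L1 L2)) _.
case.
  move=> phi tphi; have Lp := smooth_L2B (test_fun_smooth tphi).
  under eq_fun do rewrite mulrBl.
  rewrite intBB; [|exact: L2B_mul|exact: L2B_mul].
  have := H1 phi tphi; rewrite (H2 phi tphi) => /(can_inj (mulKr _)); rewrite -/(intB _) -/(intB _) => h.
  by rewrite -h ?subrr// unitrX// unitrN1.
move=> N [mN N0 sN]; exists N; split => // x /= nx; apply: sN => /= h; apply: nx => Bx.
by apply/eqP; rewrite -subr_eq0 h.
Qed.

Lemma wderivP s u : (exists2 w, L2B w & weak_deriv s u w) ->
  L2B (wderiv s u) /\ weak_deriv s u (wderiv s u).
Proof.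
move=> [w Lw dw]; rewrite /wderiv.
by apply: (@xgetPex _ (cst 0) [set w | L2B w /\ weak_deriv s u w]); exists w.
Qed.

Lemma Hk_wderiv k s u : Hk k u -> (size s <= k)%N ->
  L2B (wderiv s u) /\ weak_deriv s u (wderiv s u).
Proof. by move=> [_ H] /H /wderivP. Qed.

Lemma wderiv_smooth s f : is_smooth f ->
  {ae mu, forall x, B x -> wderiv s f x = pderiv (rev s) f x}.
Proof.
move=> sf; have [L d] := Hk_wderiv (smooth_Hk (size s) sf) (leqnn _).
apply: weak_deriv_unique L _ d _; first exact/smooth_L2B/smooth_pderiv.
exact: smooth_weak_deriv.
Qed.

(** The classical counterpart of [laplacian], which is built from chosen weak derivatives; for
    smooth functions the two agree only almost everywhere. *)
Definition lap f x : R := \sum_(i < 4) pderiv [:: i; i] f x.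

Lemma smooth_lap f : is_smooth f -> is_smooth (lap f).
Proof. by move=> sf; apply: smooth_sum => i; exact: (smooth_pderiv [:: i; i]). Qed.

Lemma laplacian_smooth f : is_smooth f ->
  {ae mu, forall x, B x -> laplacian f x = lap f x}.
Proof.
move=> sf.
have H : {ae mu, forall x, forall i : 'I_4, B x -> wderiv [:: i; i] f x = pderiv [:: i; i] f x}.
  apply: filter_forall => i; exact: wderiv_smooth.
apply: filterS H => x Hx Bx; apply: eq_bigr => i _; exact: Hx.
Qed.

Lemma Hk_laplacian u : Hk 2 u -> L2B (laplacian u).
Proof. by move=> H; apply: L2B_sum => i; have [] := Hk_wderiv (s := [:: i; i]) H isT. Qed.

Lemma normL2B_ae_eq u v : L2B u -> L2B v -> {ae mu, forall x, B x -> u x = v x} ->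
  normL2B u = normL2B v.
Proof.
move=> Lu Lv H; rewrite !normL2BE//; congr (Num.sqrt _)%:E.
have mu_ := L2B_measurable Lu; have mv := L2B_measurable Lv.
apply: intB_ae_eq; [exact: measurable_funX|exact: measurable_funX|].
by apply: filterS H => x Hx Bx; rewrite Hx.
Qed.

(** This is not a mere computation: [wderiv s 0] is some representative of the weak derivative,
    known to vanish only almost everywhere. *)
Lemma normHk_cst0 k : normHk k (fun _ : R4 R => 0) = 0%E.
Proof.
rewrite /normHk big1; first by rewrite poweR0r// invr_eq0 pnatr_eq0.
move=> j _; rewrite big1// => s _.
have s0 := smooth_cst (0 : R).
have -> : normL2B (wderiv s (fun _ : R4 R => 0)) = 0%E.
  have [L d] := Hk_wderiv (smooth_Hk (size s) s0) (leqnn _).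
  rewrite (normL2B_ae_eq L (L2B_cst 0)).
    rewrite normL2BE; last exact: L2B_cst.
    by under eq_fun do rewrite expr0n; rewrite intB_cst mul0r sqrtr0.
  have := wderiv_smooth s s0; apply: filterS => x H Bx; rewrite H//.
  suff -> : pderiv (rev s) (fun _ : R4 R => 0 : R) = fun=> 0 by [].
  elim: (rev s) => //= i l ->.
  by apply/funext => y; exact: (@derive_cst R (R4 R) R 0).
by rewrite expe2 mule0.
Qed.

Lemma test_fun_Hk0 k phi : test_fun phi -> Hk0 R k phi.
Proof.
move=> tphi; split; first exact/smooth_Hk/test_fun_smooth.
move=> e e0; exists phi => //.
have -> : (fun x => phi x - phi x) = fun=> 0 by apply/funext => x; rewrite subrr.
by rewrite normHk_cst0 lte_fin.
Qed.

(** The sum in [normHk 1] is the sum in [normHk 2] without its last, nonnegative, term, so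
    approximation in H^2 implies approximation in H^1. *)
Lemma Hk0_H2N u : Hk0 R 2 u -> H2N R u.
Proof.
move=> [H2 Ha]; split => //; split.
  by have [L H] := H2; split => // s s1; apply: H; exact: leq_trans s1 _.
move=> e e0; have [phi tphi ltphi] := Ha e e0; exists phi => //.
apply: le_lt_trans ltphi; rewrite /normHk.
apply: gt0_ler_poweR; rewrite ?invr_ge0// ?in_itv/= ?leey ?andbT.
- by apply: sume_ge0 => j _; apply: sume_ge0 => s _; rewrite mule_ge0// Lnorm_ge0.
- by apply: sume_ge0 => j _; apply: sume_ge0 => s _; rewrite mule_ge0// Lnorm_ge0.
rewrite [leRHS]big_ord_recr/= leeDl//.
by apply: sume_ge0 => s _; rewrite mule_ge0// Lnorm_ge0.
Qed.

End WeakDerivatives.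

(** * Lower bound by non-radial functions *)

Section ExponentialTail.
Context {R : realType}.

Definition exp_tail (n : nat) (t : R) : R := expR t - \sum_(0 <= k < n) t ^+ k / k`!%:R.

Lemma exp_tailS n t : exp_tail n t = t ^+ n / n`!%:R + exp_tail n.+1 t.
Proof. by rewrite /exp_tail big_nat_recr//=; ring. Qed.

Lemma exp_tail0 t : exp_tail 0 t = expR t.
Proof. by rewrite /exp_tail big_geq// subr0. Qed.

Lemma exp_tail_at0 n : exp_tail n.+1 0 = 0.
Proof.
rewrite /exp_tail expR0 big_nat_recl//= expr0 fact0 divr1 big1_seq ?addr0 ?subrr// => k _.
by rewrite exprS !mul0r.
Qed.

Lemma is_derive_monomial n (t : R) :
  is_derive t (1:R) (fun t => t ^+ n.+1 / n.+1`!%:R) (t ^+ n / n`!%:R).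
Proof.
have d := @is_deriveX R (R : normedModType R) id n.+1 t 1 1 (is_derive_id _ _).
have -> : (fun t : R => t ^+ n.+1 / n.+1`!%:R) = (n.+1`!%:R^-1 : R) *: (id ^+ n.+1 : R -> R).
  by apply/funext => y; rewrite /= /GRing.scale/= !fctE mulrC.
apply: is_derive_eq (is_deriveZ _ d) _.
rewrite /GRing.scale/= mulr1 factS natrM.
by rewrite invfM mulrACA mulVf ?pnatr_eq0// mul1r mulrC.
Qed.

Lemma is_derive_exp_tail n (t : R) : is_derive t (1:R) (exp_tail n.+1) (exp_tail n t).
Proof.
elim: n => [|n IH].
  have -> : exp_tail 1 = (fun t => expR t + (-1)).
    by apply/funext => y; rewrite /exp_tail big_nat1 expr0 fact0 divr1.
  rewrite exp_tail0 -[X in is_derive _ _ _ X]addr0.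
  by apply: is_deriveD.
have -> : exp_tail n.+2 = (fun t => exp_tail n.+1 t - t ^+ n.+1 / n.+1`!%:R).
  by apply/funext => y; rewrite (exp_tailS n.+1); ring.
have -> : exp_tail n.+1 t = exp_tail n t - t ^+ n / n`!%:R by rewrite (exp_tailS n); ring.
by apply: is_deriveB; exact: is_derive_monomial.
Qed.

Lemma nondecreasing_from0 (f f' : R -> R) (t : R) : (forall x : R, is_derive x (1:R) f (f' x)) ->
  (forall x, 0 <= x -> 0 <= f' x) -> 0 <= t -> f 0 <= f t.
Proof.
move=> df f'0; rewrite le_eqVlt => /orP[/eqP<-//|t0].
have [c] := @MVT _ f f' 0 t t0 (fun x _ => df x)
  (derivable_within_continuous (fun x _ => @ex_derive _ _ _ _ _ _ _ (df x))).
rewrite in_itv/= => /andP[c0 _] E; rewrite -subr_ge0 E subr0 mulr_ge0// ?f'0//; exact: ltW.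
Qed.

Lemma exp_tail_ge0 n t : 0 <= t -> 0 <= exp_tail n t.
Proof.
elim: n t => [|n IH] t t0; first by rewrite exp_tail0 expR_ge0.
by rewrite -(exp_tail_at0 n); apply: nondecreasing_from0 (is_derive_exp_tail n) _ t0.
Qed.

Lemma exp_tail_ge n t : 0 <= t -> t ^+ n / n`!%:R <= exp_tail n t.
Proof. by move=> t0; rewrite exp_tailS lerDl exp_tail_ge0. Qed.

(** Induction through derivatives: the tail of order [n + 1] is a primitive of the tail of order
    [n], and by the induction hypothesis the right-hand side grows at least as fast. *)
Lemma exp_tail_le n t : 0 <= t -> exp_tail n t <= t ^+ n / n`!%:R * expR t.
Proof.
elim: n t => [|n IH] t t0; first by rewrite exp_tail0 expr0 fact0 divr1 mul1r.
rewrite -subr_ge0.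
have -> : 0 = 0 ^+ n.+1 / n.+1`!%:R * expR 0 - exp_tail n.+1 0 :> R.
  by rewrite exp_tail_at0 exprS !mul0r subr0.
pose f (t : R) := t ^+ n.+1 / n.+1`!%:R * expR t - exp_tail n.+1 t.
pose f' (t : R) := (t ^+ n.+1 / n.+1`!%:R * expR t + expR t * (t ^+ n / n`!%:R)) - exp_tail n t.
apply: (@nondecreasing_from0 f f' t) => //.
  move=> x; apply: is_deriveB; last exact: is_derive_exp_tail.
  by apply: is_deriveM; exact: is_derive_monomial.
move=> x x0; rewrite /f' subr_ge0; apply: le_trans (IH x x0) _.
rewrite [leRHS]addrC mulrC lerDl !mulr_ge0 ?expR_ge0 ?exprn_ge0//.
Qed.

End ExponentialTail.

(** * Tensor products and the basic bump *)

Section ProductFunctions.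
Context {R : realType}.
Implicit Types (A : 'I_4 -> R -> R) (x p : R4 R).

Definition tensor A x : R := \prod_(i < 4) A i (coord4 x i).

Lemma smooth_tensor A : (forall i, smooth1 (A i)) -> is_smooth (tensor A).
Proof.
by move=> sA; apply: smooth_prod => i; apply: smooth_comp => //; exact: smooth_coord4.
Qed.

Lemma pderiv1_tensor A i : (forall j, smooth1 (A j)) ->
  pderiv [:: i] (tensor A) = tensor (fun j => if j == i then (A j)^`()%classic else A j).
Proof.
move=> sA; apply: pderiv1E => x; apply/is_derive_line0.
pose C := \prod_(j < 4 | j != i) A j (coord4 x j).
have -> : (fun h : R => tensor A (h *: (basis4 i : R4 R) + x)) = (fun h : R => C * A i (h + coord4 x i)).
  apply/funext => h; rewrite /tensor (bigD1 i)//= mulrC coord4_linear coord4_basis eqxx mulr1; congr (_ * _).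
  by apply: eq_bigr => j /negbTE ji; rewrite coord4_linear coord4_basis ji mulr0 add0r.
rewrite /tensor (bigD1 i)//= eqxx mulrC.
have -> : \prod_(j < 4 | j != i) (if j == i then (A j)^`()%classic else A j) (coord4 x j) = C.
  by apply: eq_bigr => j /negbTE ->.
apply: is_deriveZ.
rewrite -[X in is_derive _ _ _ X]mulr1.
apply: (@is_derive1_comp _ (A i) (fun h => h + coord4 x i)).
  by rewrite add0r; have [_] := smooth1_derive1 (sA i).
by rewrite -[X in is_derive _ _ _ X]addr0; apply: is_deriveD.
Qed.

Lemma pderiv2_tensor A i : (forall j, smooth1 (A j)) ->
  pderiv [:: i; i] (tensor A) = tensor (fun j => if j == i then ((A j)^`()%classic)^`()%classic else A j).
Proof.
move=> sA; rewrite -[[:: i; i]]/([:: i] ++ [:: i]) pderiv_cat pderiv1_tensor//.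
rewrite pderiv1_tensor; last by move=> j; case: ifP => // _; have [] := smooth1_derive1 (sA j).
by congr tensor; apply/funext => j; case: (j == i).
Qed.

Lemma derive1_affine (f : R -> R) (r c : R) : smooth1 f ->
  (fun t => f (r * (t - c)))^`()%classic = fun t => r * f^`()%classic (r * (t - c)).
Proof.
move=> /smooth1_derive1[_ df]; apply/funext => t; rewrite derive1E; apply: derive_val.
rewrite mulrC; apply: (@is_derive1_comp _ f (fun t => r * (t - c))) => //.
rewrite -[X in is_derive _ _ _ X]mulr1; apply: is_deriveZ.
by rewrite -[X in is_derive _ _ _ X]subr0; apply: is_deriveB.
Qed.

Lemma derive1Z (f : R -> R) (r : R) : smooth1 f ->
  (fun t => r * f t)^`()%classic = fun t => r * f^`()%classic t.
Proof.
move=> /smooth1_derive1[_ df]; apply/funext => t; by rewrite derive1E; apply: derive_val.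
Qed.

(** The denominator is the value of the numerator at [|t| = 1]; the quotient is therefore at least 1
    on [-1, 1], and it vanishes for [|t| >= 2]. *)
Definition plateau (t : R) : R := hstep (4 - t ^+ 2) / hstep 3.

Lemma smooth1_plateau : smooth1 plateau.
Proof.
apply: smooth1M; last exact: smooth1_cst.
apply: smooth1_comp smooth1_hstep _; apply: smooth1B; first exact: smooth1_cst.
rewrite (_ : (fun t => t ^+ 2) = (fun t : R => t * t)); last by apply/funext => t; rewrite expr2.
by apply: smooth1M; exact: smooth1_id.
Qed.

Lemma plateau_ge0 t : 0 <= plateau t.
Proof. by rewrite mulr_ge0 ?invr_ge0 ?hstep_ge0. Qed.

Lemma plateau_ge1 t : `|t| <= 1 -> 1 <= plateau t.
Proof.
move=> t1; have h3 : (0 : R) < 3 by [].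
rewrite /plateau ler_pdivlMr ?hstep_gt0// mul1r.
have t2 : t ^+ 2 <= 1 by rewrite -real_normK ?num_real// expr_le1.
have h4 : 3 <= 4 - t ^+ 2 by lra.
have h5 := lt_le_trans h3 h4.
rewrite /hstep /expinv h3 h5 !expr0 !mul1r ler_expR lerN2 lef_pV2 ?posrE//.
Qed.

Lemma plateau_eq0 t : 2 <= `|t| -> plateau t = 0.
Proof.
move=> t2; rewrite /plateau hstep_eq0 ?mul0r// subr_le0 -[t ^+ 2]real_normK ?num_real//.
by rewrite (_ : 4 = 2 ^+ 2 :> R) ?lerXn2r ?nnegrE// -natrX.
Qed.

Lemma plateau_derive_eq0 t : 2 <= `|t| -> (plateau^`()%classic)^`()%classic t = 0.
Proof.
have [s1 d1] := smooth1_derive1 smooth1_plateau; have [s2 d2] := smooth1_derive1 s1.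
have c2 := smooth1_continuous s2.
have H (u : R) : 2 < `|u| -> (plateau^`()%classic)^`()%classic u = 0.
  move=> u2; rewrite derive1E -[RHS](@derive_cst R R R (0:R) u 1); apply: near_eq_derive.
  have opn : open [set y : R | 2 < `|y|].
    by apply: (@open_comp _ _ (fun y : R => `|y|) [set y | 2 < y]);
     [move=> y _; exact: norm_continuous|exact: open_gt].
  have := open_nbhs_nbhs (conj opn u2); apply: filterS => y y2.
  rewrite derive1E -[RHS](@derive_cst R R R (0:R) y 1); apply: near_eq_derive.
  have := open_nbhs_nbhs (conj opn y2); apply: filterS => z z2.
  by rewrite plateau_eq0// ltW.
rewrite le_eqVlt => /orP[/eqP t2|/H//].
(* At [|t| = 2] the second derivative is the limit of its values at the points [t (1 + 1/(k+1))],
   where it vanishes. *)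
pose h (k : nat) : R := k.+1%:R^-1.
have Hc : (plateau^`()%classic)^`()%classic (t * (1 + h k)) @[k --> \oo] --> (plateau^`()%classic)^`()%classic t.
  apply: continuous_cvg; first exact: c2.
  suff : t * (1 + h k) @[k --> \oo] --> t * (1 + 0) by rewrite addr0 mulr1.
  by apply: cvgM; [exact: cvg_cst|apply: cvgD; [exact: cvg_cst|exact: cvg_harmonic]].
rewrite -(cvg_lim (@Rhausdorff R) Hc) (_ : (fun k => _) = cst 0) ?lim_cst//.
apply/funext => k; apply: H; rewrite normrM -t2 ltr_pMr// ger0_norm ?addr_ge0//.
  by rewrite ltrDl invr_gt0.
by rewrite invr_ge0.
Qed.

Lemma plateau_bounds : exists2 H, 0 < H & forall i x,
  `|tensor (fun j => if j == i then (plateau^`()%classic)^`()%classic else plateau) x| <= H.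
Proof.
have [s1 _] := smooth1_derive1 smooth1_plateau; have [s2 _] := smooth1_derive1 s1.
have [M M0 HM] := smooth1_bounded (-2) 2 smooth1_plateau.
have [M' M'0 HM'] := smooth1_bounded (-2) 2 s2.
have bM t : `|plateau t| <= M.
  have [t2|t2] := leP `|t| 2; first by apply: HM; rewrite -ler_norml.
  by rewrite plateau_eq0 ?normr0 ltW.
have bM' t : `|(plateau^`()%classic)^`()%classic t| <= M'.
  have [t2|t2] := leP `|t| 2; first by apply: HM'; rewrite -ler_norml.
  by rewrite plateau_derive_eq0 ?normr0 ltW.
exists (\prod_(j < 4) (M + M')); first by apply: prodr_gt0 => j _; rewrite addr_gt0.
move=> i x; rewrite normr_prod; apply: ler_prod => j _; rewrite normr_ge0/=.
case: ifP => _; [apply: le_trans (bM' _) _|apply: le_trans (bM _) _]; lra.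
Qed.

End ProductFunctions.

(** * Superposition of dyadic rescalings *)

Section LowerBound.
Context {R : realType}.
Local Notation mu := (@lebesgue4 R).
Local Notation B := (@uball R).
Implicit Types (f g u v w phi : R4 R -> R) (x p : R4 R).

Definition cube p (r : R) : set (R4 R) :=
  box (vec4 (fun i => coord4 p i - r)) (vec4 (fun i => coord4 p i + r)).

Lemma cubeP p r x : cube p r x <-> forall i, `|coord4 x i - coord4 p i| < r.
Proof.
by split => h i; have := h i; rewrite ?coord4_vec4 ltr_distl.
Qed.

Lemma measurable_cube p r : measurable (cube p r).
Proof. exact: measurable_box. Qed.

Lemma lebesgue4_cube p r : 0 <= r -> mu (cube p r) = ((2 * r) ^+ 4)%:E.
Proof.
move=> r0; rewrite lebesgue4_box => [|i]; last by rewrite !coord4_vec4; lra.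
congr EFin; rewrite -[RHS]/((2 * r) ^+ 4) -[in RHS](card_ord 4) -prodr_const.
by apply: eq_bigr => i _; rewrite !coord4_vec4; lra.
Qed.

Definition atom p (r : R) : R4 R -> R :=
  tensor (fun i t => plateau (r * (t - coord4 p i))).

Lemma smooth_atom p r : is_smooth (atom p r).
Proof.
apply: smooth_tensor => i; apply: smooth1_comp smooth1_plateau _.
apply: smooth1M; first exact: smooth1_cst.
by apply: smooth1B; [exact: smooth1_id|exact: smooth1_cst].
Qed.

Lemma atom_ge0 p r x : 0 <= atom p r x.
Proof. by apply: prodr_ge0 => i _; exact: plateau_ge0. Qed.

Lemma atom_ge1 p r x : 0 < r -> cube p r^-1 x -> 1 <= atom p r x.
Proof.
move=> r0 /cubeP xp; rewrite /atom /tensor.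
apply: (big_ind (fun y : R => 1 <= y)) => // [y z y1 z1|i _].
  by rewrite -[1]mulr1 ler_pM.
apply: plateau_ge1; rewrite normrM gtr0_norm// mulrC -ler_pdivlMr// div1r; exact: ltW.
Qed.

Lemma not_cubeP p r x : ~ cube p r x -> exists i, r <= `|coord4 x i - coord4 p i|.
Proof.
move=> n; apply: contrapT => h; apply: n; apply/cubeP => i.
by rewrite ltNge; apply/negP => h'; apply: h; exists i.
Qed.

Lemma atom_eq0 p r x : 0 < r -> ~ cube p (2 / r) x -> atom p r x = 0.
Proof.
move=> r0 /not_cubeP[i hi]; rewrite /atom /tensor (bigD1 i)//= plateau_eq0 ?mul0r//.
by rewrite normrM gtr0_norm// mulrC -ler_pdivrMr.
Qed.

Lemma pderiv2_atom p r i x : pderiv [:: i; i] (atom p r) x =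
  r ^+ 2 * tensor (fun j => if j == i then (plateau^`()%classic)^`()%classic else plateau)
   (vec4 (fun j => r * (coord4 x j - coord4 p j))).
Proof.
have [s1 d1] := smooth1_derive1 (@smooth1_plateau R).
have sa j : smooth1 (fun t => plateau (r * (t - coord4 p j))).
  apply: smooth1_comp smooth1_plateau _; apply: smooth1M; first exact: smooth1_cst.
  by apply: smooth1B; [exact: smooth1_id|exact: smooth1_cst].
have sb j : smooth1 (fun t => plateau^`()%classic (r * (t - coord4 p j))).
  apply: smooth1_comp s1 _; apply: smooth1M; first exact: smooth1_cst.
  by apply: smooth1B; [exact: smooth1_id|exact: smooth1_cst].
rewrite /atom pderiv2_tensor// /tensor (bigD1 i)//= eqxx [in RHS](bigD1 i)//= eqxx.
rewrite mulrA; congr (_ * _); last first.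
  by apply: eq_bigr => j /negbTE ->; rewrite coord4_vec4.
rewrite derive1_affine; last exact: smooth1_plateau.
rewrite (derive1Z r (sb i)) (derive1_affine r (coord4 p i) s1).
by rewrite coord4_vec4 mulrA expr2.
Qed.

(** Two derivatives cost [r^2] on a cube of volume of order [r^-4], so the L^2 norm is bounded
    independently of [r]. The indicator is kept in order to control the interaction between
    scales. *)
Lemma lap_atom_bound : exists2 H : R, 0 < H & forall p r x, 0 < r ->
  `|lap (atom p r) x| <= H * r ^+ 2 * \1_(cube p (2 / r)) x.
Proof.
have [H H0 HH] := @plateau_bounds R.
exists (4 * H); first by rewrite mulr_gt0.
move=> p r x r0.
rewrite indicE; case: (pselect (cube p (2 / r) x)) => xc.
  rewrite mem_set// mulr1 /lap; apply: le_trans (ler_norm_sum _ _ _) _.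
  apply: (@le_trans _ _ (\sum_(i < 4) r ^+ 2 * H)).
    apply: ler_sum => i _; rewrite pderiv2_atom normrM ger0_norm ?sqr_ge0//.
    by rewrite ler_wpM2l ?sqr_ge0.
  by rewrite sumr_const card_ord -mulr_natl; lra.
rewrite memNset// mulr0 /lap big1 ?normr0// => i _.
rewrite pderiv2_atom; have [j hj] := not_cubeP xc.
rewrite /tensor (bigD1 j)//= (_ : (if j == i then _ else _) _ = 0) ?mul0r ?mulr0//.
have h2 : 2 <= `|coord4 (vec4 (fun j => r * (coord4 x j - coord4 p j))) j|.
  by rewrite coord4_vec4 normrM gtr0_norm// mulrC -ler_pdivrMr.
by case: ifP => _; [exact: plateau_derive_eq0|exact: plateau_eq0].
Qed.

(* The Laplacian is scale invariant in L^2, so that [N] dyadic rescalings of a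
   bump add up to a function of height [N] whose Laplacian has norm [sqrt N]. *)
Definition tower p (r : R) (N : nat) x : R := \sum_(j <- iota 0 N) atom p (r * 2 ^+ j) x.

Lemma smooth_tower p r N : is_smooth (tower p r N).
Proof. by apply: smooth_sum => j; exact: smooth_atom. Qed.

Lemma pderiv_sum (I : Type) (s : seq 'I_4) (r : seq I) (F : I -> R4 R -> R) :
  (forall i, is_smooth (F i)) ->
  pderiv s (fun x => \sum_(i <- r) F i x) = fun x => \sum_(i <- r) pderiv s (F i) x.
Proof.
move=> sF; elim: r => [|a r IH].
  under eq_fun do rewrite big_nil; under [in RHS]eq_fun do rewrite big_nil.
  elim: s => //= i s ->; apply/funext => y; exact: (@derive_cst R (R4 R) R 0).
under eq_fun do rewrite big_cons; under [in RHS]eq_fun do rewrite big_cons.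
by rewrite pderivD ?IH//; exact: smooth_sum.
Qed.

Lemma lap_tower p r N x : lap (tower p r N) x = \sum_(j <- iota 0 N) lap (atom p (r * 2 ^+ j)) x.
Proof.
rewrite /lap exchange_big/=; apply: eq_bigr => i _.
rewrite -[LHS]/(pderiv [:: i; i] (fun x => \sum_(j <- iota 0 N) atom p (r * 2 ^+ j) x) x).
by rewrite pderiv_sum// => j; exact: smooth_atom.
Qed.

(** The diagonal absorbs the cross terms: the partial sum below [n] is at most [4^n / 3], so a new
    term adds at most [(2/3 + 1) 16^n a_n] to the square. The squared norm of a superposition of N
    bumps is thus of order N and not N^2. *)
Lemma sqr_sum_geometric (a : nat -> R) N : (forall j, 0 <= a j <= 1) ->
  (\sum_(j <- iota 0 N) 4 ^+ j * a j) ^+ 2 <= 2 * \sum_(j <- iota 0 N) 16 ^+ j * a j.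
Proof.
move=> a01.
have I N' (F : nat -> R) : \sum_(j <- iota 0 N') F j = \sum_(0 <= j < N') F j by rewrite /index_iota subn0.
rewrite (I N (fun j => 4 ^+ j * a j)) (I N (fun j => 16 ^+ j * a j)).
have S N' : 0 <= \sum_(0 <= j < N') 4 ^+ j * a j <= 4 ^+ N' / 3.
  elim: N' => [|n /andP[h1 h2]]; first by rewrite big_geq// expr0; lra.
  rewrite big_nat_recr//= exprS; have /andP[a0 a1] := a01 n.
  have p4 : 0 < 4 ^+ n :> R by rewrite exprn_gt0.
  by apply/andP; split; nra.
elim: N => [|n IH]; first by rewrite !big_geq// expr0n mulr0.
rewrite !big_nat_recr//=.
have /andP[h1 h2] := S n; have /andP[a0 a1] := a01 n.
have -> : 16 ^+ n = 4 ^+ n * 4 ^+ n :> R by rewrite -exprMn; congr (_ ^+ _); ring.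
move: h2 h1 IH; set s := \sum_(0 <= i < n) 4 ^+ i * a i; set t := \sum_(0 <= i < n) _.
have p4 : 0 < 4 ^+ n :> R by rewrite exprn_gt0.
move: p4; set q := 4 ^+ n => q0 h2 h1 IH.
have h3 : s * (q * a n) <= q / 3 * (q * a n) by rewrite ler_wpM2r// mulr_ge0// ltW.
have h4 : (q * a n) ^+ 2 <= q * q * a n.
  have -> : (q * a n) ^+ 2 = q * q * a n * a n by ring.
  by rewrite ler_piMr// !mulr_ge0// ltW.
have -> : (s + q * a n) ^+ 2 = s ^+ 2 + 2 * (s * (q * a n)) + (q * a n) ^+ 2 by ring.
have h5 : 0 <= q * q * a n by rewrite !mulr_ge0// ltW.
lra.
Qed.

Lemma intB_indic_cube p r : 0 <= r -> intB (\1_(cube p r)) <= (2 * r) ^+ 4.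
Proof.
move=> r0; have mB := measurable_uball (R := R).
rewrite /intB /Rintegral -lee_fin fineK.
  rewrite integral_indic//; last exact: measurable_cube.
  rewrite -(lebesgue4_cube p r0); apply: le_measure; rewrite ?inE//.
    by apply: measurableI => //; exact: measurable_cube.
  exact: measurable_cube.
apply: (integrable_fin_num mB).
apply: (@integrable_ball_bounded _ _ 1); first by apply: measurable_indic; exact: measurable_cube.
by move=> x _; rewrite indicE normr_nat; case: (_ \in _); rewrite ?lexx ?ler01.
Qed.

Lemma intB_lap_tower : exists2 A : R, 0 < A & forall p r N, 0 < r ->
  intB (fun x => lap (tower p r N) x ^+ 2) <= A * N%:R.
Proof.
have [H H0 HH] := lap_atom_bound.
exists (2 * 4 ^+ 4 * H ^+ 2); first by rewrite !mulr_gt0 ?exprn_gt0.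
move=> p r N r0.
pose a j x : R := \1_(cube p (2 / (r * 2 ^+ j))) x.
have a01 j x : 0 <= a j x <= 1 by rewrite /a indicE; case: (_ \in _); rewrite ?lexx ?ler01.
have ia j : integrable_ball (a j).
  apply: (@integrable_ball_bounded _ _ 1); first by apply: measurable_indic; exact: measurable_cube.
  by move=> x _; have /andP[h1 h2] := a01 j x; rewrite ger0_norm.
have r2 j : 0 < r * 2 ^+ j by rewrite mulr_gt0// exprn_gt0.
have pw x : lap (tower p r N) x ^+ 2 <= (H * r ^+ 2) ^+ 2 * 2 * \sum_(j <- iota 0 N) 16 ^+ j * a j x.
  rewrite -mulrA; apply: le_trans (_ : (H * r ^+ 2) ^+ 2 * (\sum_(j <- iota 0 N) 4 ^+ j * a j x) ^+ 2 <= _); last first.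
    by rewrite ler_wpM2l ?sqr_ge0// sqr_sum_geometric.
  rewrite -exprMn -real_normK ?num_real// lerXn2r ?nnegrE//.
    apply: mulr_ge0; first by rewrite mulr_ge0 ?sqr_ge0 ?(ltW H0).
    apply: sumr_ge0 => j _; have /andP[? _] := a01 j x; rewrite mulr_ge0// exprn_ge0.
  rewrite lap_tower mulr_sumr; apply: le_trans (ler_norm_sum _ _ _) _.
  apply: ler_sum => j _; apply: le_trans (HH _ _ _ (r2 j)) _.
  rewrite -/(a j x) exprMn -exprM mulnC exprM (_ : 2 ^+ 2 = 4) ?mulrA// -natrX//.
have iS : integrable_ball (fun x => \sum_(j <- iota 0 N) 16 ^+ j * a j x).
  by apply: integrable_ball_sum => j; apply: integrable_ballZ.
apply: le_trans (intB_le _ _ (fun x _ => pw x)) _.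
- by have [] := (L2BP _).1 (smooth_L2B (smooth_lap (smooth_tower p r N))).
- exact: integrable_ballZ.
rewrite intBZ// intB_sum; last by move=> j; apply: integrable_ballZ.
(* The factor [16^j] is cancelled by the volume [(4 / (r 2^j))^4] of the cube at scale [j], so every
   scale contributes the same amount. *)
apply: le_trans (_ : (H * r ^+ 2) ^+ 2 * 2 * \sum_(j <- iota 0 N) (4 ^+ 4 * r ^- 4) <= _).
  apply: ler_wpM2l; first by rewrite mulr_ge0 ?sqr_ge0.
  apply: ler_sum => j _; rewrite intBZ//.
  have /(ler_wpM2l (exprn_ge0 j (ler0n R 16))) := intB_indic_cube p (ltW (divr_gt0 (ltr0n R 2) (r2 j))).
  move/le_trans; apply; rewrite le_eqVlt; apply/orP; left; apply/eqP.
  rewrite !exprMn exprVn !exprMn -exprM mulnC exprM.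
  have -> : (2 ^+ 4 : R) = 16 by rewrite -natrX.
  have n16 : (16 : R) ^+ j != 0 by rewrite expf_neq0.
  by field; rewrite n16 gt_eqF.
rewrite big_const_seq count_predT size_iota -Monoid.iteropE /= -/(GRing.natmul _ _).
rewrite -[X in _ * X]mulr_natr le_eqVlt; apply/orP; left; apply/eqP.
by field; rewrite gt_eqF.
Qed.

End LowerBound.

(** * Test functions concentrated near the boundary *)

Section AdamsLower.
Context {R : realType}.
Local Notation mu := (@lebesgue4 R).
Local Notation B := (@uball R).
Implicit Types (f g u v w phi : R4 R -> R) (x p : R4 R).

Definition adams_integrand (sigma alpha : R) (n : nat) u x : R :=
  enorm x `^ alpha * exp_tail n (sigma * u x ^+ 2).

(** The sum in [adamsF] includes [k = m], hence the tail of order [m + 1]. *)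
Lemma adamsFE sigma alpha m u :
  adamsF sigma alpha m u = (\int[mu]_(x in B) (adams_integrand sigma alpha m.+1 u x)%:E)%E.
Proof.
apply: eq_integral => x _; congr (_ * _)%:E; congr (_ - _).
by apply: eq_bigr => k _; rewrite exprMn -exprM.
Qed.

Lemma measurable_enorm : measurable_fun setT (@enorm R).
Proof.
have ms : measurable_fun setT (Num.sqrt : R -> R).
  by apply: continuous_measurable_fun; exact: sqrt_continuous.
exact: measurableT_comp ms measurable_sqnorm.
Qed.

Lemma measurable_exp_tail n : measurable_fun setT (@exp_tail R n).
Proof.
apply: continuous_measurable_fun => t.
case: n => [|n].
  rewrite (_ : exp_tail 0 = expR); last by apply/funext => y; rewrite exp_tail0.
  exact: continuous_expR.
apply: differentiable_continuous; apply/derivable1_diffP.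
by have [] := is_derive_exp_tail n t.
Qed.

Lemma measurable_adams_integrand sigma alpha n u : measurable_fun B u ->
  measurable_fun B (adams_integrand sigma alpha n u).
Proof.
move=> mu_; apply: measurable_funM.
  apply: (measurableT_comp (measurable_powR alpha)).
  by apply: measurable_funS measurable_enorm.
apply: (measurableT_comp (measurable_exp_tail n)).
by apply: measurable_funM => //; exact: measurable_funX.
Qed.

Lemma adams_integrand_ge0 sigma alpha n u x : 0 <= sigma -> 0 <= adams_integrand sigma alpha n u x.
Proof. by move=> s0; rewrite mulr_ge0 ?powR_ge0// exp_tail_ge0// mulr_ge0// sqr_ge0. Qed.

(** On the smallest of the cubes, that of the last index [j = m], all [m + 1] atoms are at least
    1. *)
Lemma tower_ge p r m x : 0 < r -> cube p (r * 2 ^+ m)^-1 x -> m.+1%:R <= tower p r m.+1 x.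
Proof.
move=> r0 xc; rewrite /tower.
apply: (@le_trans _ _ (\sum_(j <- iota 0 m.+1) 1)).
  by rewrite big_const_seq count_predT size_iota iter_addr_0.
rewrite !big_seq; apply: ler_sum => j; rewrite mem_iota add0n ltnS => /andP[_ jm].
apply: atom_ge1; first by rewrite mulr_gt0// exprn_gt0.
apply/cubeP => i; apply: lt_le_trans ((cubeP _ _ _).1 xc i) _.
rewrite lef_pV2 ?posrE ?mulr_gt0 ?exprn_gt0// ler_pM2l// ler_weXn2l// ler1n//.
Qed.

Lemma tower_ge0 p r N x : 0 <= tower p r N x.
Proof. by apply: sumr_ge0 => j _; exact: atom_ge0. Qed.

Lemma tower_eq0 p r N x : 0 < r -> ~ cube p (2 / r) x -> tower p r N x = 0.
Proof.
move=> r0 nx; rewrite /tower big1// => j _; apply: atom_eq0.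
  by rewrite mulr_gt0// exprn_gt0.
move=> /cubeP xc; apply: nx; apply/cubeP => i; apply: lt_le_trans (xc i) _.
rewrite ler_pM2l// lef_pV2 ?posrE ?mulr_gt0 ?exprn_gt0// ler_peMr ?(ltW r0)//.
by rewrite exprn_ege1// ler1n.
Qed.

(* The cube of radius [2 / r] around this point lies in the ball, at distance of order [1 / r]
   from the sphere; with [r] of order [alpha] the weight [|x|^alpha] is bounded below there. *)
Definition bdry_point (r : R) : R4 R := mk4 (1 - 4 / r) 0 0 0.

Lemma coord_bdry_point (r : R) i : coord4 (bdry_point r) i = (i == ord0)%:R * (1 - 4 / r).
Proof. by rewrite coord4E; case: i => [[|[|[|[|//]]]] H] /=; rewrite ?mul1r ?mul0r. Qed.

Lemma cube_bdry_sqnorm (r : R) x : 12 <= r -> cube (bdry_point r) (2 / r) x ->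
  sqnorm x <= 1 - 4 / r + 16 / r ^+ 2 /\ 1 - 6 / r <= enorm x.
Proof.
move=> r12 /cubeP xc; have r0 : 0 < r by apply: lt_le_trans r12.
set e := r^-1; have e0 : 0 < e by rewrite invr_gt0.
have e12 : e <= 12^-1 by rewrite lef_pV2 ?posrE.
have -> : 16 / r ^+ 2 = 16 * e ^+ 2 by rewrite exprVn.
have c0 : 1 - 6 * e < coord4 x ord0 < 1 - 2 * e.
  by have := xc ord0; rewrite coord_bdry_point mul1r ltr_distl -/e => /andP[h1 h2]; apply/andP; split; lra.
have ci (i : 'I_4) : i != ord0 -> coord4 x i ^+ 2 <= 4 * e ^+ 2.
  move=> /negbTE i0; have := xc i; rewrite coord_bdry_point i0 mul0r subr0 -/e ltr_norml => /andP[h1 h2].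
  nra.
case/andP: c0 => c1 c2; split.
  rewrite /sqnorm (bigD1 ord0)//=.
  have h : \sum_(i < 4 | i != ord0) coord4 x i ^+ 2 <= 12 * e ^+ 2.
    apply: (@le_trans _ _ (\sum_(i < 4 | i != ord0) 4 * e ^+ 2)); first exact: ler_sum.
    by rewrite big_mkcond !big_ord_recl big_ord0 /=; lra.
  (* The bound is [(1 - 2e)^2 + 3 (2e)^2 = 1 - 4e + 16 e^2]. *)
  have : coord4 x ord0 ^+ 2 <= (1 - 2 * e) ^+ 2 by rewrite lerXn2r ?nnegrE; lra.
  by rewrite -/e; nra.
apply: le_trans (ltW c1) _.
rewrite -[leLHS]ger0_norm; last by lra.
by rewrite -sqrtr_sqr /enorm ler_sqrt ?sqnorm_ge0// coord4_le_sqnorm.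
Qed.

Lemma test_fun_tower (r : R) N : 12 <= r -> test_fun (tower (bdry_point r) r N).
Proof.
move=> r12; have r0 : 0 < r by apply: lt_le_trans r12.
apply: (@test_fun_intro _ _ (1 - 4 / r + 16 / r ^+ 2)).
- have e0 : 0 < r^-1 by rewrite invr_gt0.
  have e12 : r^-1 <= 12^-1 by rewrite lef_pV2 ?posrE.
  by rewrite -exprVn; nra.
- exact: smooth_tower.
move=> x nz; have [xc|nc] := pselect (cube (bdry_point r) (2 / r) x).
  by have [] := cube_bdry_sqnorm r12 xc.
by move: nz; rewrite tower_eq0// eqxx.
Qed.

Lemma lap_sqnorm x : lap (@sqnorm R) x = 8.
Proof.
rewrite /lap (eq_bigr (fun=> 2)); first by rewrite sumr_const card_ord -mulr_natl; lra.
move=> i _; rewrite -[[:: i; i]]/([:: i] ++ [:: i]) pderiv_cat pderiv_sqnorm.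
rewrite pderiv1Z; last exact: smooth_coord4.
rewrite (pderiv1E (fun x => is_derive_coord4 i i x)) eqxx mulr1//.
Qed.

Lemma intB_lap_symm f phi : is_smooth f -> test_fun phi ->
  intB (fun x => f x * lap phi x) = intB (fun x => lap f x * phi x).
Proof.
move=> sf tphi; have sphi := test_fun_smooth tphi.
have H g : is_smooth g -> (fun x => \sum_(i < 4) pderiv [:: i; i] g x) = lap g by [].
transitivity (intB (fun x => \sum_(i <- index_enum 'I_4) f x * pderiv [:: i; i] phi x)).
  by congr intB; apply/funext => x; rewrite /lap mulr_sumr.
rewrite intB_sum; last by move=> i; apply: L2B_mul; apply: smooth_L2B => //; exact: (smooth_pderiv [:: i; i]).
transitivity (intB (fun x => \sum_(i <- index_enum 'I_4) pderiv [:: i; i] f x * phi x)); last first.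
  by congr intB; apply/funext => x; rewrite /lap mulr_suml.
rewrite intB_sum; last by move=> i; apply: L2B_mul; apply: smooth_L2B => //; exact: (smooth_pderiv [:: i; i]).
by apply: eq_bigr => i _; rewrite intB_pderiv_by_parts// expr2 mulrNN mulr1 mul1r.
Qed.

Lemma intB_tower_gt0 (r : R) m : 12 <= r -> 0 < intB (tower (bdry_point r) r m.+1).
Proof.
move=> r12; have r0 : 0 < r by apply: lt_le_trans r12.
set p := bdry_point r; have rm : 0 < r * 2 ^+ m by rewrite mulr_gt0// exprn_gt0.
set C := cube p (r * 2 ^+ m)^-1.
have CB : C `<=` B.
  move=> x xC; apply: contrapT => nB; have := tower_ge r0 xC.
  by rewrite (test_fun_eq0 (test_fun_tower _ r12) nB) lern0.
have mC : measurable C by exact: measurable_cube.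
have e0 : 0 < (r * 2 ^+ m)^-1 by rewrite invr_gt0.
have iC : integrable_ball (\1_C).
  apply: (@integrable_ball_bounded _ _ 1); first by apply: measurable_indic.
  by move=> x _; rewrite indicE normr_nat; case: (_ \in _); rewrite ?lexx ?ler01.
apply: (@lt_le_trans _ _ (intB (\1_C))).
  rewrite -lte_fin -intBE// integral_indic//; last exact: measurable_uball.
  apply: (@lt_le_trans _ _ (mu C)); last by rewrite setIidl.
  by rewrite /C lebesgue4_cube ?(ltW e0)// lte_fin exprn_gt0// mulr_gt0.
apply: intB_le => //; first exact/L2B_integrable/smooth_L2B/smooth_tower.
move=> x _; rewrite indicE; case: (pselect (C x)) => xC.
  by rewrite mem_set//; apply: le_trans (tower_ge r0 xC); rewrite ler1n.
by rewrite memNset// tower_ge0.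
Qed.

(* If the Laplacian vanished, testing it against [|x|^2] would give [8 * int phi = 0]. *)
Lemma intB_lap_tower_gt0 (r : R) m : 12 <= r ->
  0 < intB (fun x => lap (tower (bdry_point r) r m.+1) x ^+ 2).
Proof.
move=> r12; have tt := test_fun_tower m.+1 r12; set phi := tower _ _ _ in tt *.
have sphi := test_fun_smooth tt.
rewrite lt_neqAle intB_ge0 ?andbT => [|x _]; last exact: sqr_ge0.
apply/eqP => E.
have := cauchy_schwarzB (smooth_L2B (@smooth_sqnorm R)) (smooth_L2B (smooth_lap sphi)).
rewrite -E sqrtr0 mulr0 (intB_lap_symm (@smooth_sqnorm R) tt).
under eq_fun do rewrite lap_sqnorm.
rewrite intBZ; last exact: L2B_integrable (smooth_L2B sphi).
rewrite normr_le0 mulf_eq0 pnatr_eq0/= => /eqP h.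
by have := intB_tower_gt0 m r12; rewrite -/phi h ltxx.
Qed.

(** The inequality [exp(-2e) <= 1 - e], valid for [0 <= e <= 1/2], is raised to the power [alpha],
    with [2 e alpha = 1]. *)
Lemma powR_ge_expRN1 (alpha y : R) : 1 <= alpha -> 1 - (2 * alpha)^-1 <= y -> expR (-1) <= y `^ alpha.
Proof.
move=> a1; have a0 : 0 < alpha by apply: lt_le_trans a1.
set e := (2 * alpha)^-1 => ye.
have ae : alpha * e = 2^-1 by rewrite /e invfM mulrCA mulfV ?mulr1// gt_eqF.
have e0 : 0 < e by rewrite invr_gt0 mulr_gt0.
have e2 : e <= 2^-1 by rewrite -ae ler_peMl// ltW.
have h1 : expR (- (2 * e)) <= 1 - e.
  have e1 : 0 < 1 - e by lra.
  rewrite expRN -[leRHS]invrK lef_pV2 ?posrE ?expR_gt0 ?invr_gt0//.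
  apply: le_trans (expR_ge1Dx (2 * e)).
  by rewrite -div1r ler_pdivrMr//; nra.
apply: le_trans (_ : expR (- (2 * e)) `^ alpha <= _).
  rewrite -expRM mulNr -mulrA (mulrC e) ae mulfV//.
apply: ge0_ler_powR; rewrite ?nnegrE ?expR_ge0 ?(ltW a0)//; lra.
Qed.

Lemma fact_le_expn n : (n`! <= n ^ n)%N.
Proof.
elim: n => // n IH; rewrite factS expnS leq_mul2l/= (leq_trans IH)//.
by case: n {IH} => // n; rewrite leq_exp2r.
Qed.

(** With [n = m + 1] atoms, [phi^2 >= n^2 / (A n) = n / A] on the smallest cube, and the first term
    [(sigma n / A)^n / n!] of the tail is at least [(sigma / A)^n] because [n! <= n^n]. The volume
    of that cube is [(4 / 12)^4 alpha^-4 16^-n], whence the 16 in [kappa] and the constant [c]. *)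
Lemma adams_lower (sigma : R) : 0 < sigma -> exists kappa c : R, [/\ 0 < kappa, 0 < c &
  forall (alpha : R) (m : nat), 1 <= alpha -> exists phi, [/\ test_fun phi,
    normL2B (laplacian phi) = 1%E &
    ((c * kappa ^+ m.+1 * alpha ^- 4)%:E <= adamsF sigma alpha m phi)%E]].
Proof.
move=> s0; have [A A0 HA] := @intB_lap_tower R.
exists (sigma / (16 * A)), (expR (-1) * 4 ^+ 4 / 12 ^+ 4).
split; first by rewrite divr_gt0// mulr_gt0.
  by rewrite divr_gt0// ?mulr_gt0 ?exprn_gt0 ?expR_gt0.
move=> alpha m a1; have a0 : 0 < alpha by apply: lt_le_trans a1.
(* On the large cube [|x| >= 1 - 6 / r = 1 - 1 / (2 alpha)], so the weight is at least [1/e];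
   moreover [alpha >= 1] gives [r >= 12]. *)
set r := 12 * alpha; have r12 : 12 <= r by rewrite /r; lra.
have r0 : 0 < r by apply: lt_le_trans r12.
set p := bdry_point r; set psi := tower p r m.+1.
have tpsi : test_fun psi by exact: test_fun_tower.
have spsi := test_fun_smooth tpsi.
set D2 := intB (fun x => lap psi x ^+ 2).
have D0 : 0 < D2 by exact: intB_lap_tower_gt0.
have DA : D2 <= A * m.+1%:R by exact: HA.
pose t := (Num.sqrt D2)^-1.
have t2 : t ^+ 2 = D2^-1 by rewrite exprVn sqr_sqrtr// ltW.
have tphi := test_funZ t tpsi.
have sphi := test_fun_smooth tphi.
exists (fun x => t * psi x); split => //.
  rewrite (normL2B_ae_eq (Hk_laplacian (smooth_Hk 2 sphi)) (smooth_L2B (smooth_lap sphi)) (laplacian_smooth sphi)).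
  rewrite normL2BE; last exact/smooth_L2B/smooth_lap.
  have E x : lap (fun x => t * psi x) x = t * lap psi x.
    by rewrite /lap mulr_sumr; apply: eq_bigr => i _; rewrite (pderivZ [:: i; i] t spsi).
  under eq_fun do rewrite E exprMn.
  rewrite intBZ; last by have [] := (L2BP _).1 (smooth_L2B (smooth_lap spsi)).
  by rewrite -/D2 t2 mulVf ?gt_eqF// sqrtr1.
set phi := (fun x => t * psi x).
rewrite adamsFE.
set e := (r * 2 ^+ m)^-1; have e0 : 0 < e by rewrite invr_gt0 mulr_gt0// exprn_gt0.
set C := cube p e.
have mC : measurable C by exact: measurable_cube.
have CB : C `<=` B.
  move=> x xC; apply: contrapT => nB; have := tower_ge r0 xC.
  by rewrite -/psi (test_fun_eq0 tpsi nB) lern0.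
pose L := expR (-1) * (sigma / A) ^+ m.+1.
have L0 : 0 <= L by rewrite mulr_ge0 ?expR_ge0// exprn_ge0// divr_ge0// ltW.
have low x : C x -> L <= adams_integrand sigma alpha m.+1 phi x.
  move=> xC; apply: ler_pM; rewrite ?expR_ge0 ?exprn_ge0 ?divr_ge0 ?(ltW s0) ?(ltW A0)//.
    apply: powR_ge_expRN1 => //.
    have xC2 : cube p (2 / r) x.
      apply/cubeP => i; apply: lt_le_trans ((cubeP _ _ _).1 xC i) _.
      rewrite /e invfM mulrC ler_pM2r ?invr_gt0//.
      apply: (@le_trans _ _ 1); last by rewrite ler1n.
      by rewrite invf_le1 ?exprn_gt0// exprn_ege1// ler1n.
    have [_] := cube_bdry_sqnorm r12 xC2; apply: le_trans.
    have -> : (2 * alpha)^-1 = 6 / r by rewrite /r; field; rewrite gt_eqF.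
    by [].
  have ux : sigma / A * m.+1%:R <= sigma * phi x ^+ 2.
    have h : m.+1%:R <= psi x by exact: tower_ge r0 xC.
    rewrite -mulrA ler_pM2l// /phi exprMn t2 ![_^-1 * _]mulrC ler_pdivlMr// mulrAC ler_pdivrMr//.
    apply: le_trans (ler_wpM2l _ DA) _ => //.
    by rewrite mulrCA mulrC ler_pM2r// -expr2 lerXn2r ?nnegrE//; exact: le_trans h.
  apply: le_trans (exp_tail_ge m.+1 (mulr_ge0 (ltW s0) (sqr_ge0 (phi x)))).
  rewrite ler_pdivlMr ?ltr0n ?fact_gt0//.
  apply: le_trans (_ : (sigma / A * m.+1%:R) ^+ m.+1 <= _); last first.
    have h1 : 0 <= sigma / A * m.+1%:R by apply: mulr_ge0 => //; apply/ltW/divr_gt0.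
    have h2 : 0 <= sigma * phi x ^+ 2 by apply: mulr_ge0; [exact: ltW|exact: sqr_ge0].
    exact: lerXn2r.
  rewrite [leRHS]exprMn ler_wpM2l ?exprn_ge0 ?divr_ge0 ?(ltW s0) ?(ltW A0)//.
  by rewrite -natrX ler_nat fact_le_expn.
apply: (@le_trans _ _ (\int[mu]_(x in B) (L * \1_C x)%:E)%E); last first.
  apply: ge0_le_integral => //.
  - exact: measurable_uball.
  - by move=> x _; rewrite lee_fin mulr_ge0.
  - by apply/measurable_EFinP; apply: measurable_funM => //; exact: measurable_indic.
  - by apply/measurable_EFinP; apply: measurable_adams_integrand; apply: smooth_measurable => //; exact: measurable_uball.
  move=> x _; rewrite lee_fin indicE; case: (pselect (C x)) => xC.
    by rewrite mem_set// mulr1 low.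
  by rewrite memNset// mulr0 adams_integrand_ge0// ltW.
under eq_integral do rewrite EFinM.
rewrite (@ge0_integralZl_EFin _ _ _ mu B measurable_uball (EFin \o \1_C) _ _ L L0)//; last 2 first.
- by move=> x _; rewrite lee_fin.
- by apply/measurable_EFinP; exact: measurable_indic.
rewrite (_ : (\int[mu]_(x in B) (EFin \o \1_C) x = \int[mu]_(x in B) (\1_C x)%:E)%E)//.
rewrite integral_indic//; last exact: measurable_uball.
rewrite setIidl//.
apply: (@le_trans _ _ (L%:E * mu C)%E); last by [].
rewrite /C lebesgue4_cube ?(ltW e0)// -EFinM lee_fin le_eqVlt; apply/orP; left; apply/eqP.
rewrite /L /e /r.
have -> : (2 : R) ^+ m = 2 ^+ m.+1 / 2 by rewrite exprS mulrAC mulfV ?mul1r.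
have n2 : (2 : R) ^+ m.+1 != 0 by rewrite expf_neq0.
have -> : sigma / (16 * A) = (sigma / A) / 2 ^+ 4.
  by rewrite -natrX; field; rewrite gt_eqF.
rewrite [((sigma / A) / _) ^+ _]expr_div_n -exprM mulnC exprM.
by field; rewrite n2 gt_eqF.
Qed.

End AdamsLower.

(** * Pointwise bound for radial functions *)

Section Duality.
Context {R : realType}.
Local Notation mu := (@lebesgue4 R).
Local Notation B := (@uball R).
Implicit Types (f g u v w phi psi : R4 R -> R) (x p : R4 R).

Lemma HkB k u f : Hk k u -> is_smooth f -> Hk k (fun x => u x - f x).
Proof.
move=> [Lu Hu] sf; split; first by apply: L2BB => //; exact: smooth_L2B.
move=> s sk; have [w Lw dw] := Hu s sk.
exists (fun x => w x - pderiv (rev s) f x); first by apply: L2BB => //; exact/smooth_L2B/smooth_pderiv.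
move=> phi tphi; have Lp := smooth_L2B (test_fun_smooth tphi).
have Lpd := smooth_L2B (smooth_pderiv s (test_fun_smooth tphi)).
have Ldf := smooth_L2B (smooth_pderiv (rev s) sf).
rewrite -[LHS]/(intB _) -[X in _ = _ * X]/(intB _).
under eq_fun do rewrite mulrBl; under [in RHS]eq_fun do rewrite mulrBl.
rewrite !intBB ?mulrBr; try exact: L2B_mul; last by apply: L2B_mul => //; exact: smooth_L2B.
by rewrite -(dw phi tphi) (intB_pderiv_by_parts s sf tphi).
Qed.

Lemma normL2B_le_normHk k s u : Hk k u -> (size s <= k)%N ->
  (normL2B (wderiv s u) <= normHk k u)%E.
Proof.
move=> Hu sk; have [L _] := Hk_wderiv Hu sk.
have n0 (s' : seq 'I_4) : (0 <= normL2B (wderiv s' u) * normL2B (wderiv s' u))%E by rewrite mule_ge0// Lnorm_ge0.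
rewrite [leLHS](_ : _ = ((normL2B (wderiv s u) ^+ 2) `^ 2^-1)%E).
  apply: gt0_ler_poweR; rewrite ?invr_ge0// ?in_itv/= ?leey ?andbT//.
    by apply: sume_ge0 => j _; apply: sume_ge0.
  have hs : (size s < k.+1)%N by [].
  rewrite (bigD1 (Ordinal hs))//= (bigD1 (in_tuple s))//=.
  rewrite -addeA leeDl// adde_ge0//; first by apply: sume_ge0.
  by apply: sume_ge0 => j _; apply: sume_ge0.
by rewrite normL2BE// expe2 -EFinM -expr2 poweR_EFin powR12_sqrt ?sqr_ge0// sqrtr_sqr ger0_norm// sqrtr_ge0.
Qed.

Lemma radial_fun_bound (P : R -> R) : smooth1 P -> P 1 = 0 ->
  exists2 L, 0 < L & forall s : R, 0 <= s <= 1 -> `|P s| <= L * (1 - s).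
Proof.
move=> sP P1; have [sP' dP] := smooth1_derive1 sP.
have [L L0 HL] := smooth1_bounded 0 1 sP'.
exists L => // s /andP[s0]; rewrite le_eqVlt => /orP[/eqP ->|s1].
  by rewrite P1 normr0 subrr mulr0.
have [c] := @MVT _ P P^`()%classic s 1 s1 (fun (y : R) _ => dP y)
  (derivable_within_continuous (fun (y : R) _ => @ex_derive _ _ _ _ _ _ _ (dP y))).
rewrite in_itv/= P1 => /andP[sc c1] /(congr1 Num.norm).
rewrite sub0r normrN normrM => ->.
rewrite [X in _ * X]ger0_norm ?subr_ge0 ?(ltW s1)// ler_wpM2r ?subr_ge0 ?(ltW s1)//.
by apply: HL; rewrite (ltW c1) (ltW (le_lt_trans s0 sc)).
Qed.

Lemma pderiv1_cutoff k i x : pderiv [:: i] (cutoff k) x =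
  ramp^`()%classic (k.+1%:R * (1 - sqnorm x)) * (- (k.+1%:R * (2 * coord4 x i))).
Proof.
have sa := smooth1_affine (k.+1%:R : R) 1.
rewrite (@pderiv1_comp _ ramp (fun x => k.+1%:R * (1 - sqnorm x)) i smooth1_ramp); last first.
  by apply: (smooth_comp sa); exact: smooth_sqnorm.
congr (_ * _); rewrite (@pderiv1_comp _ _ _ i sa smooth_sqnorm) pderiv_sqnorm -mulNr; congr (_ * _).
rewrite derive1E; apply: derive_val.
rewrite -[X in is_derive _ _ _ X]mulrN1.
apply: is_deriveZ; rewrite -[X in is_derive _ _ _ X]sub0r; exact: is_deriveB.
Qed.

(** The gradient of the cutoff is of size [k], but it lives where [1 - |x|^2 <= 2/(k+1)], and there
    [P (|x|^2)] is of order [1/k] since [P 1 = 0]. The product is bounded uniformly in [k], which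
    fails for second derivatives in general. *)
Lemma cutoff_radial_bounds (P : R -> R) : smooth1 P -> P 1 = 0 ->
  exists M, forall k i x, B x ->
    `|pderiv [:: i] (fun x => P (sqnorm x) * cutoff k x) x| <= M.
Proof.
move=> sP P1; have [L L0 HL] := radial_fun_bound sP P1.
have [M M0 HM] := @ramp_derive_bounded R.
have spsi : is_smooth (fun x => P (sqnorm x)) by apply: smooth_comp sP smooth_sqnorm.
have [M1 M10 HM1] : exists2 M1 : R, 0 < M1 & forall i x, B x -> `|pderiv [:: i] (fun x => P (sqnorm x)) x| <= M1.
  have H i := smooth_bounded (smooth_pderiv [:: i] spsi).
  have [M1 HM1] := choice (fun i => let: ex_intro2 M a b := H i in ex_intro (fun M => 0 < M /\ _) M (conj a b)).
  exists (\sum_(i < 4) M1 i); first by rewrite (bigD1 ord0)//= ltr_wpDr ?(HM1 _).1// sumr_ge0// => i _; exact/ltW/(HM1 i).1.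
  move=> i x Bx; apply: le_trans ((HM1 i).2 x Bx) _; rewrite (bigD1 i)//= lerDl sumr_ge0// => j _; exact/ltW/(HM1 j).1.
exists (M1 + 4 * (L * M)) => k i x Bx.
rewrite (pderiv1M _ spsi (smooth_cutoff k)).
apply: le_trans (ler_normD _ _) _; rewrite addrC; apply: lerD.
  rewrite normrM -[leRHS]mul1r; apply: ler_pM => //; [exact: cutoff_bound|exact: HM1].
have s0 := sqnorm_ge0 x; have := Bx; rewrite uballE => s1.
rewrite pderiv1_cutoff.
have [b1 b2] := HM (k.+1%:R * (1 - sqnorm x)).
have [->|nz] := eqVneq (ramp^`()%classic (k.+1%:R * (1 - sqnorm x))) 0.
  by rewrite mul0r mulr0 normr0 !mulr_ge0// ltW.
have /andP[_ h2] := b2 nz.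
have xi : `|coord4 x i| <= 1.
  rewrite -(ler_pXn2r (n := 2)) ?nnegrE// real_normK ?num_real// expr1n.
  exact: le_trans (coord4_le_sqnorm _ _) (ltW s1).
rewrite !normrM normrN !normrM (ger0_norm (ler0n R k.+1)) (ger0_norm (ler0n R 2)).
have hP : `|P (sqnorm x)| <= L * (1 - sqnorm x) by apply: HL; rewrite s0 ltW.
apply: (@le_trans _ _ (L * (1 - sqnorm x) * (M * (k.+1%:R * (2 * 1))))).
  apply: ler_pM => //; apply: ler_pM => //.
  by rewrite ler_wpM2l// ler_wpM2l.
have -> : L * (1 - sqnorm x) * (M * (k.+1%:R * (2 * 1))) = L * M * 2 * (k.+1%:R * (1 - sqnorm x)) by ring.
have -> : 4 * (L * M) = L * M * 2 * 2 by ring.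
by rewrite ler_wpM2l// !mulr_ge0// ltW.
Qed.

Lemma pderiv_cutoff_cvg f i x : is_smooth f -> B x ->
  pderiv [:: i] (fun x => f x * cutoff k x) x @[k --> \oo] --> pderiv [:: i] f x.
Proof.
move=> sf Bx.
apply: cvg_near_cst; have := Bx; rewrite uballE -subr_gt0 => s0.
near=> k; rewrite (pderiv1M _ sf (smooth_cutoff k)) pderiv1_cutoff.
have k2 : 2 < k.+1%:R * (1 - sqnorm x).
  rewrite -ltr_pdivrMr//; apply: lt_trans (_ : k%:R < _); last by rewrite ltr_nat.
  by near: k; exact: nbhs_infty_gtr.
have -> : cutoff k x = 1 by apply: ramp_eq1; exact: ltW.
have [M _ /(_ (k.+1%:R * (1 - sqnorm x)))[_ H]] := @ramp_derive_bounded R.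
have -> : ramp^`()%classic (k.+1%:R * (1 - sqnorm x)) = 0.
  by apply/eqP; apply: contraT => /H /andP[_]; rewrite leNgt k2.
by rewrite mul0r mulr0 add0r mul1r.
Unshelve. all: by end_near. Qed.

Lemma cvg_sumR (I : Type) (r : seq I) (F : I -> nat -> R) (l : I -> R) :
  (forall i, F i k @[k --> \oo] --> l i) ->
  (\sum_(i <- r) F i k) @[k --> \oo] --> \sum_(i <- r) l i.
Proof.
move=> H; elim: r => [|a r IH].
  by under eq_fun do rewrite big_nil; rewrite big_nil; exact: cvg_cst.
under eq_fun do rewrite big_cons; rewrite big_cons.
by apply: cvgD.
Qed.

(* [P (|x|^2)] vanishes only to first order on the sphere; no boundary term appears because
   [u] is in the closure of the test functions for the H^1 norm. *)
Lemma laplacian_radial_duality u (P : R -> R) : H2N R u -> smooth1 P -> P 1 = 0 ->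
  intB (fun x => u x * lap (fun x => P (sqnorm x)) x) =
  intB (fun x => laplacian u x * P (sqnorm x)).
Proof.
move=> [[H1 H0] H2] sP P1.
set psi := fun x => P (sqnorm x).
have spsi : is_smooth psi by apply: smooth_comp sP smooth_sqnorm.
have Lpsi := smooth_L2B spsi; have Llpsi := smooth_L2B (smooth_lap spsi).
have Ldpsi i := smooth_L2B (smooth_pderiv [:: i] spsi).
have Lu : L2B u by case: H1.
have Lw := Hk_laplacian H2.
pose psik k x := psi x * cutoff k x.
have tpsik k : test_fun (psik k) by apply: test_funM => //; exact: test_fun_cutoff.
have Lpd s k : L2B (pderiv s (psik k)).
  by apply: smooth_L2B; apply: smooth_pderiv; exact: test_fun_smooth.
have Ltk k : L2B (psik k) := Lpd [::] k.
have [Mpsi _ HMpsi] := smooth_bounded spsi.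
have [Md HMd] := cutoff_radial_bounds sP P1.
set Cpsi := \sum_(i < 4) Num.sqrt (intB (fun x => pderiv [:: i] psi x ^+ 2)) +
  Num.sqrt (intB (fun x => lap psi x ^+ 2)).
have C0 : 0 <= Cpsi by rewrite addr_ge0 ?sqrtr_ge0// sumr_ge0// => i _; exact: sqrtr_ge0.
have main (e : R) : 0 < e ->
    `|intB (fun x => u x * lap psi x) - intB (fun x => laplacian u x * psi x)| <= e * Cpsi.
  move=> e0; have [phi tphi ltphi] := H0 e e0.
  have sphi := test_fun_smooth tphi.
  have Lphi := smooth_L2B sphi.
  set d := (fun x => u x - phi x) in ltphi.
  have Hd : Hk 1 d by exact: HkB.
  have Ld : L2B d by case: Hd.
  have [Ld0 wd0] := Hk_wderiv (s := [::]) Hd isT.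
  have Ldi i := (Hk_wderiv (s := [:: i]) Hd isT).1.
  have wdi i := (Hk_wderiv (s := [:: i]) Hd isT).2.
  have nd0 : Num.sqrt (intB (fun x => d x ^+ 2)) <= e.
    have E : normL2B d = normL2B (wderiv [::] d).
      apply: normL2B_ae_eq => //; apply: weak_deriv_unique wd0 => //.
      by move=> th _; rewrite /= expr0 mul1r.
    rewrite -lee_fin -normL2BE// E; apply: le_trans (ltW ltphi).
    exact: normL2B_le_normHk.
  have ndi i : Num.sqrt (intB (fun x => wderiv [:: i] d x ^+ 2)) <= e.
    rewrite -lee_fin -normL2BE//; apply: le_trans (ltW ltphi).
    exact: normL2B_le_normHk.
  (* Only one derivative is moved from [psik] to [d = u - phi], which is small in H^1 only, while
     both are moved to the smooth [phi]. No second derivative of [psik] remains, so dominated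
     convergence in [k] applies. *)
  have key k : intB (fun x => laplacian u x * psik k x) =
      - (\sum_(i < 4) intB (fun x => wderiv [:: i] d x * pderiv [:: i] (psik k) x)) +
      intB (fun x => lap phi x * psik k x).
    have -> : intB (fun x => laplacian u x * psik k x) = intB (fun x => u x * lap (psik k) x).
      transitivity (intB (fun x => \sum_(i <- index_enum 'I_4) wderiv [:: i; i] u x * psik k x)).
        by congr intB; apply/funext => x; rewrite /laplacian mulr_suml.
      rewrite intB_sum; last by move=> i; apply: L2B_mul => //; have [] := Hk_wderiv (s := [:: i; i]) H2 isT.
      transitivity (intB (fun x => \sum_(i <- index_enum 'I_4) u x * pderiv [:: i; i] (psik k) x)); last first.
        by congr intB; apply/funext => x; rewrite /lap mulr_sumr.
      rewrite intB_sum; last by move=> i; apply: L2B_mul => //; exact: Lpd [:: i; i] k.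
      apply: eq_bigr => i _; have [_ /(_ _ (tpsik k))] := Hk_wderiv (s := [:: i; i]) H2 isT.
      by rewrite expr2 mulrNN mulr1 mul1r -[X in X = _ -> _]/(intB _) => ->.
    transitivity (intB (fun x => d x * lap (psik k) x) + intB (fun x => phi x * lap (psik k) x)).
      have Ll : L2B (lap (psik k)) by apply: smooth_L2B; apply: smooth_lap; exact: test_fun_smooth.
      rewrite -intBD; try exact: L2B_mul.
      by congr intB; apply/funext => x; rewrite /d -mulrDl subrK.
    congr (_ + _); last first.
      exact: (intB_lap_symm sphi (tpsik k)).
    transitivity (intB (fun x => \sum_(i <- index_enum 'I_4) d x * pderiv [:: i; i] (psik k) x)).
      by congr intB; apply/funext => x; rewrite /lap mulr_sumr.
    rewrite intB_sum; last by move=> i; apply: L2B_mul => //; exact: Lpd [:: i; i] k.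
    rewrite -sumrN; apply: eq_bigr => i _.
    have := wdi i _ (test_fun_pderiv [:: i] (tpsik k)).
    by rewrite expr1 mulN1r => <-.
  have lim1 : intB (fun x => laplacian u x * psik k x) @[k --> \oo] --> intB (fun x => laplacian u x * psi x).
    apply: (@dominated_intB _ _ psik psi Mpsi); first exact: L2B_integrable.
    - by move=> k; exact: L2B_measurable.
    - move=> k x Bx; rewrite /psik normrM -[leRHS]mulr1; apply: ler_pM => //; [exact: HMpsi|exact: cutoff_bound].
    - move=> x Bx; rewrite -[X in _ --> X]mulr1; apply: cvgM; [exact: cvg_cst|exact: cutoff_cvg].
  have lim2 : intB (fun x => lap phi x * psik k x) @[k --> \oo] --> intB (fun x => lap phi x * psi x).
    apply: (@dominated_intB _ _ psik psi Mpsi); first exact/L2B_integrable/smooth_L2B/smooth_lap.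
    - by move=> k; exact: L2B_measurable.
    - move=> k x Bx; rewrite /psik normrM -[leRHS]mulr1; apply: ler_pM => //; [exact: HMpsi|exact: cutoff_bound].
    - move=> x Bx; rewrite -[X in _ --> X]mulr1; apply: cvgM; [exact: cvg_cst|exact: cutoff_cvg].
  have lim3 i : intB (fun x => wderiv [:: i] d x * pderiv [:: i] (psik k) x) @[k --> \oo] -->
      intB (fun x => wderiv [:: i] d x * pderiv [:: i] psi x).
    apply: (@dominated_intB _ _ (fun k => pderiv [:: i] (psik k)) (pderiv [:: i] psi) Md); first exact: L2B_integrable.
    - by move=> k; exact: L2B_measurable.
    - by move=> k x Bx; exact: HMd.
    - by move=> x Bx; exact: pderiv_cutoff_cvg.
  have E : intB (fun x => laplacian u x * psi x) =
      - (\sum_(i < 4) intB (fun x => wderiv [:: i] d x * pderiv [:: i] psi x)) +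
      intB (fun x => phi x * lap psi x).
    have -> : intB (fun x => phi x * lap psi x) = intB (fun x => lap phi x * psi x).
      rewrite (_ : (fun x => phi x * lap psi x) = (fun x => lap psi x * phi x)).
        rewrite -(intB_lap_symm spsi tphi); congr intB; apply/funext => x; exact: mulrC.
      by apply/funext => x; exact: mulrC.
    rewrite -(cvg_lim (@Rhausdorff R) lim1); apply: cvg_lim; first exact: Rhausdorff.
    rewrite (_ : (fun k => _) = fun k => - (\sum_(i <- index_enum 'I_4) intB (fun x => wderiv [:: i] d x * pderiv [:: i] (psik k) x)) +
      intB (fun x => lap phi x * psik k x)); last by apply/funext => k; exact: key.
    apply: cvgD; last exact: lim2.
    apply: cvgN.
    apply: (@cvg_sumR _ (index_enum 'I_4) (fun i k => intB (fun x => wderiv [:: i] d x * pderiv [:: i] (psik k) x))) => i.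
    exact: lim3.
  rewrite E.
  have -> : intB (fun x => u x * lap psi x) = intB (fun x => d x * lap psi x) + intB (fun x => phi x * lap psi x).
    rewrite -intBD; try exact: L2B_mul.
    by congr intB; apply/funext => x; rewrite /d -mulrDl subrK.
  rewrite opprD opprK addrACA subrr addr0 addrC.
  apply: le_trans (ler_normD _ _) _; rewrite /Cpsi mulrDr; apply: lerD.
    apply: le_trans (ler_norm_sum _ _ _) _; rewrite mulr_sumr; apply: ler_sum => i _.
    apply: le_trans (cauchy_schwarzB (Ldi i) (Ldpsi i)) _.
    by rewrite ler_wpM2r ?sqrtr_ge0.
  apply: le_trans (cauchy_schwarzB Ld Llpsi) _.
  by rewrite ler_wpM2r ?sqrtr_ge0.
apply/eqP; rewrite -subr_eq0 -normr_le0; apply/ler_addgt0Pr => e e0; rewrite add0r.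
have := main (e / (Cpsi + 1)) (divr_gt0 e0 (ltr_wpDl C0 ltr01)).
move/le_trans; apply; rewrite mulrAC ler_pdivrMr ?ltr_wpDl// ler_wpM2l ?(ltW e0)// lerDl.
exact: ler01.
Qed.

End Duality.

(** * The radial Poisson equation and averages over shells *)

Section RadialTest.
Context {R : realType}.
Local Notation mu := (@lebesgue4 R).
Local Notation B := (@uball R).
Implicit Types (u v w phi psi : R4 R -> R) (x : R4 R).

Lemma le_of_derive_ge0 (f f' : R -> R) (a b : R) : a <= b ->
  (forall y : R, a <= y <= b -> is_derive y (1:R) f (f' y)) ->
  (forall y : R, a <= y <= b -> 0 <= f' y) -> f a <= f b.
Proof.
rewrite le_eqVlt => /orP[/eqP ->//|ab] df f0.
have inab y : y \in `]a, b[ -> a <= y <= b by rewrite in_itv/= => /andP[h1 h2]; rewrite !ltW.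
have cf : {within `[a, b], continuous f}.
  apply: derivable_within_continuous => y; rewrite in_itv/= => yab.
  exact: (@ex_derive _ _ _ _ _ _ _ (df y yab)).
have [c cab E] := @MVT _ f f' a b ab (fun y h => df y (inab y h)) cf.
by rewrite -subr_ge0 E mulr_ge0 ?subr_ge0 ?(ltW ab)// f0// inab.
Qed.

Lemma eq_of_derive_eq0 (f : R -> R) (a b : R) : a <= b ->
  (forall y : R, a <= y <= b -> is_derive y (1:R) f 0) -> f a = f b.
Proof.
move=> ab df; apply/eqP; rewrite eq_le (@le_of_derive_ge0 f (fun=> 0))//=.
rewrite -lerN2; apply: (@le_of_derive_ge0 (fun y => - f y) (fun=> 0)) => // y yab.
by rewrite -[0]oppr0; apply: is_deriveN; exact: df.
Qed.

Lemma smooth1_antiderivative (g : R -> R) (a b : R) : smooth1 g ->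
  (forall y, ~~ (a <= y <= b) -> g y = 0) ->
  exists F : R -> R, [/\ smooth1 F, forall y : R, is_derive y (1:R) F (g y) &
    forall y, y <= a -> F y = 0].
Proof.
move=> sg g0; have cg := smooth1_continuous sg.
have [M M0 HM] := smooth1_bounded a b sg.
have mg : measurable_fun setT g by exact: continuous_measurable_fun.
have mI : measurable (`[a, b]%classic : set (measurableTypeR R)) by [].
have ltI : (lebesgue_measure (`[a, b]%classic : set (measurableTypeR R)) < +oo)%E.
  by rewrite lebesgue_measure_itv/=; case: ifP => // _; rewrite -EFinB ltry.
have iab : lebesgue_measure.-integrable `[a, b] (EFin \o g).
  apply: measurable_bounded_integrable => //; first exact: measurable_funS mg.
  exists M; split; first exact: num_real.
  by move=> y My z; rewrite /= in_itv/= => zab; apply: le_trans (HM z zab) (ltW My).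
have ig : lebesgue_measure.-integrable setT (EFin \o g).
  rewrite (_ : EFin \o g = (EFin \o g) \_ `[a, b]); first exact/(integrable_mkcond _ mI).
  apply/funext => y; rewrite /patch; case: ifPn => // /negP nI /=.
  rewrite g0//; apply/negP => yab; apply: nI; rewrite inE /= in_itv//.
pose F (y : R) := (\int[lebesgue_measure]_(t in [set` Interval -oo%O (BRight y)]) g t)%R.
have dF (y : R) : is_derive y (1:R) F (g y).
  have iu : lebesgue_measure.-integrable [set` Interval -oo%O (BRight (y + 1))] (EFin \o g).
    by apply: integrableS ig.
  have FT := @continuous_FTC1 R g -oo%O y (y + 1) (ltr_pwDr ltr01 (lexx y)) iu.
  have [|dF EF] := FT _ (cg y); first exact: ltNyr.
  split; [exact: dF|rewrite -EF derive1E; exact: erefl].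
exists F; split => //; first exact: smooth1_primitive sg.
move=> y ya; rewrite /F /Rintegral.
case: (ltP y a) => [ylt|yge].
  rewrite integral0_eq// => t /=; rewrite in_itv/= => ty.
  by rewrite g0// negb_and -ltNge (le_lt_trans ty ylt).
have -> : y = a by apply/eqP; rewrite eq_le ya.
(* The hypothesis gives [g = 0] to the left of [a] only; continuity gives the value at [a]. *)
have ga : g a = 0.
  apply: contrapT => /eqP gn.
  have : \forall t \near a, g t != 0.
    have := cg a; move/(_ [set z | z != 0]); apply.
    apply: open_nbhs_nbhs; split => //; exact: open_neq.
  move=> /nbhs_ballP[e /= e0 He].
  have := He (a - e / 2); rewrite /ball/= opprB addrC subrK gtr0_norm ?divr_gt0//.
  have h : e / 2 < e by rewrite ltr_pdivrMr// ltr_pMr// ltr1n.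
  move=> /(_ h); rewrite g0 ?eqxx// negb_and -ltNge.
  by rewrite ltrBlDr ltrDl divr_gt0.
rewrite integral0_eq// => t /=; rewrite in_itv/= le_eqVlt => /orP[/eqP ->|ta]; first by rewrite ga.
by rewrite g0// negb_and -ltNge ta.
Qed.

(* In the variable [s = |x|^2], the equation [lap (P s) = f s] reads [(s^2 P')' = s f / 4].
   Since [int s f / 4 <= (s2^2 - s1^2) / 8], integrating from [1] gives the bound on [P]. *)
Lemma radial_poisson (f : R -> R) (s1 s2 : R) : smooth1 f -> 0 < s1 -> s1 < s2 -> s2 < 1 ->
  (forall s, 0 <= f s <= 1) -> (forall s, ~~ (s1 < s < s2) -> f s = 0) ->
  exists P : R -> R, [/\ smooth1 P, P 1 = 0,
    forall x, B x -> lap (fun x => P (sqnorm x)) x = f (sqnorm x) &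
    forall s, 0 <= s <= 1 -> `|P s| <= (s2 ^+ 2 - s1 ^+ 2) / 8 * ((Num.max s s1)^-1 - 1)].
Proof.
move=> sf s10 s12 s21 f01 f0.
set M := (s2 ^+ 2 - s1 ^+ 2) / 8.
have M0 : 0 <= M by rewrite divr_ge0// subr_ge0 lerXn2r ?nnegrE ?ltW// (lt_trans s10).
pose g (s : R) := 4^-1 * (s * f s).
have sg : smooth1 g.
  by apply: smooth1M; [exact: smooth1_cst|apply: smooth1M => //; exact: smooth1_id].
have g0 s : ~~ (s1 <= s <= s2) -> g s = 0.
  move=> h; rewrite /g f0 ?mulr0//; apply: contra h => /andP[h1 h2]; by rewrite !ltW.
have [Q [sQ dQ Q0]] := smooth1_antiderivative sg g0.
have gge0 s : s1 <= s -> 0 <= g s.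
  move=> h; rewrite /g; have /andP[fs _] := f01 s.
  by rewrite !mulr_ge0// (le_trans _ h)// ltW.
have Qge0 s : 0 <= Q s.
  have [h|h] := leP s s1; first by rewrite Q0.
  rewrite -(Q0 s1 (lexx _)); apply: (@le_of_derive_ge0 Q g) => //; first exact: ltW.
  by move=> y /andP[y1 _]; exact: gge0.
have dsq (y : R) : is_derive y (1:R) (fun t : R => 8^-1 * (t * t)) (8^-1 * (y * 1 + y * 1)).
  by apply: is_deriveZ; apply: is_deriveM.
have Qle1 s : s1 <= s -> s <= s2 -> Q s <= M.
  move=> h1 h2; apply: (@le_trans _ _ (8^-1 * (s * s) - 8^-1 * (s1 * s1))).
    rewrite lerBrDl -lerBrDr -[8^-1 * (s1 * s1)]subr0 -[in X in _ - X](Q0 s1 (lexx _)).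
    apply: (@le_of_derive_ge0 (fun t => 8^-1 * (t * t) - Q t) (fun y => 8^-1 * (y * 1 + y * 1) - g y)) => //.
    move=> y /andP[y1 _]; rewrite /g; have /andP[fs fs1] := f01 y.
    have y0 : 0 < y by apply: lt_le_trans y1.
    have : y * f y <= y * 1 by rewrite ler_pM2l.
    lra.
  rewrite /M; have : s ^+ 2 <= s2 ^+ 2.
    by rewrite lerXn2r ?nnegrE// ?(le_trans _ h1) ?(ltW s10)// (le_trans _ (ltW s12))// ltW.
  rewrite !expr2; lra.
have Qle s : Q s <= M.
  have [h|h] := leP s s1; first by rewrite Q0.
  have [h2|h2] := leP s s2; first by apply: Qle1 => //; exact: ltW.
  have <- : Q s2 = Q s.
    apply: eq_of_derive_eq0; first exact: ltW.
    move=> y /andP[y1 _]; suff <- : g y = 0 by [].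
    by rewrite /g f0 ?mulr0// negb_and -!leNgt y1 orbT.
  by apply: Qle1 => //; exact: ltW.
(* Equal to [s^2] for [s >= s1] and positive everywhere. Since [Q] vanishes for [s <= s1], the
   quotient [Q / d] is a smooth version of [Q / s^2]. *)
pose d (s : R) := s * s + hstep (s1 - s).
have d0 s : 0 < d s.
  rewrite /d; have [h|h] := ltP s s1.
    by rewrite ltr_wpDl ?hstep_gt0 ?subr_gt0// -expr2 sqr_ge0.
  by rewrite ltr_wpDr ?hstep_ge0// mulr_gt0// (lt_le_trans s10).
have sd : smooth1 (fun s => (d s)^-1).
  apply: smooth1V; first by move=> s; rewrite gt_eqF.
  apply: smooth1D; first by apply: smooth1M; exact: smooth1_id.
  by apply: smooth1_comp smooth1_hstep _; apply: smooth1B; [exact: smooth1_cst|exact: smooth1_id].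
(* The last factor is 1 for [s <= 1] and 0 for [s >= 2]; it provides the bounded support needed for
   a second antiderivative without changing anything on the ball. *)
pose p (s : R) := Q s * (d s)^-1 * (1 - ramp s).
have sp : smooth1 p.
  apply: smooth1M; first exact: smooth1M.
  by apply: smooth1B; [exact: smooth1_cst|exact: smooth1_ramp].
have p0 s : ~~ (s1 <= s <= 2) -> p s = 0.
  rewrite negb_and -!ltNge => /orP[h|h]; first by rewrite /p Q0 ?mul0r// ltW.
  by rewrite /p ramp_eq1 ?subrr ?mulr0// ltW.
have [F [sF dF F0]] := smooth1_antiderivative sp p0.
have pE s : s <= 1 -> s ^+ 2 * p s = Q s.
  move=> h; rewrite /p ramp_eq0// subr0 mulr1.
  have [h1|h1] := leP s s1; first by rewrite Q0// mul0r mulr0.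
  rewrite /d hstep_eq0 ?subr_le0 ?(ltW h1)// addr0 mulrCA expr2 mulfV ?mulr1//.
  by rewrite mulf_neq0// gt_eqF// (lt_trans s10).
have pge0 s : s <= 1 -> 0 <= p s.
  by move=> h; rewrite /p ramp_eq0// subr0 mulr1 mulr_ge0// invr_ge0 ltW.
pose P s := F s - F 1.
have sP : smooth1 P by apply: smooth1B => //; exact: smooth1_cst.
have dP (s : R) : is_derive s (1:R) P (p s).
  by rewrite -[p s]subr0; apply: is_deriveB.
have P'E : P^`()%classic = p.
  by apply/funext => s; rewrite derive1E; apply: derive_val.
exists P; split => //; first by rewrite /P subrr.
- move=> x; rewrite uballE => x1.
  have [sp' dp'] := smooth1_derive1 sp.
  have sc (i : 'I_4) : is_smooth (fun x => 2 * coord4 x i) by apply: smoothZ; exact: smooth_coord4.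
  have spp : is_smooth (fun x => p (sqnorm x)) by apply: smooth_comp sp smooth_sqnorm.
  have lapE : lap (fun x => P (sqnorm x)) x =
      4 * (sqnorm x * p^`()%classic (sqnorm x)) + 8 * p (sqnorm x).
    rewrite /lap (eq_bigr (fun i => 4 * p^`()%classic (sqnorm x) * coord4 x i ^+ 2 + 2 * p (sqnorm x))).
      rewrite big_split/= -mulr_sumr -/(sqnorm x) sumr_const card_ord -mulr_natl; ring.
    move=> i _; rewrite -[[:: i; i]]/([:: i] ++ [:: i]) pderiv_cat.
    rewrite (@pderiv1_comp _ P _ i sP smooth_sqnorm) P'E pderiv_sqnorm.
    rewrite (@pderiv1M _ _ _ i spp (sc i)) (@pderiv1Z _ 2 _ i (smooth_coord4 i)).
    rewrite (pderiv1E (fun x => is_derive_coord4 i i x)) eqxx [true%:R]mulr1n.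
    rewrite (@pderiv1_comp _ p _ i sp smooth_sqnorm) pderiv_sqnorm; ring.
  rewrite lapE; have s0 := sqnorm_ge0 x; set s := sqnorm x in x1 s0 *.
  have dQ' : Q^`()%classic s = g s by rewrite derive1E; apply: derive_val.
  have : 2 * s * p s + s ^+ 2 * p^`()%classic s = g s.
    rewrite -dQ' [Q^`()%classic s]derive1E.
    have -> : 'D_1 Q s = 'D_1 (fun t : R => t * t * p t) s.
      apply: near_eq_derive; near=> t; rewrite -expr2 pE//; apply: ltW; near: t; exact: lt_nbhsl.
    apply/esym; apply: derive_val; apply: is_derive_eq.
    rewrite /GRing.scale/=; ring.
  rewrite /g; move: s0; rewrite le_eqVlt => /orP[/eqP <-|s0].
    have p00 : p 0 = 0 by rewrite /p Q0 ?(ltW s10)// !mul0r.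
    have f00 : f 0 = 0 by apply: f0; rewrite ltNge (ltW s10).
    by rewrite p00 f00 !mul0r !mulr0 addr0.
  move=> /(congr1 (fun y => y * (4 / s))) E.
  have -> : f s = 4^-1 * (s * f s) * (4 / s) by field; rewrite gt_eqF.
  by rewrite -E; field; rewrite gt_eqF.
- move=> s /andP[s0 s1'].
  have P1 : P 1 = 0 by rewrite /P subrr.
  have Pm (a b : R) : a <= b -> b <= 1 -> P a <= P b.
    move=> ab b1; apply: (@le_of_derive_ge0 P p) => // y /andP[_ yb].
    exact/pge0/(le_trans yb).
  have Pn (a : R) : a <= 1 -> `|P a| = - P a by move=> h; rewrite ler0_norm// -P1 Pm.
  (* Integration from [a] to 1 of [p = Q / s^2 <= M / s^2]. *)
  have big (a : R) : s1 <= a -> a <= 1 -> - P a <= M * (a^-1 - 1).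
    move=> h1 h2; have a0 : 0 < a by apply: lt_le_trans h1.
    have : - (M * a^-1) - P a <= - (M * 1^-1) - P 1.
      apply: (@le_of_derive_ge0 (fun t => - (M * t^-1) - P t) (fun y => - (M * (- y ^- 2)) - p y)); first exact: h2.
        move=> y /andP[ya _]; have y0 : y != 0 by rewrite gt_eqF// (lt_le_trans a0).
        apply: is_deriveB.
        apply: is_deriveN; apply: is_deriveZ.
        have := @is_deriveV R id y 1 1 y0 (is_derive_id _ _).
        by rewrite /GRing.scale/= mulr1.
      move=> y /andP[ya y1]; have y0 : 0 < y by apply: lt_le_trans ya.
      rewrite mulrN opprK subr_ge0 ler_pdivlMr ?exprn_gt0// mulrC pE//.
    rewrite P1 invr1; lra.
  rewrite Pn//; have [h|h] := leP s1 s; first exact: big.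
  have -> : P s = P s1.
    apply: eq_of_derive_eq0; first exact: ltW.
    move=> y /andP[_ y1]; suff <- : p y = 0 by [].
    by rewrite /p Q0// !mul0r.
  by apply: big => //; exact/ltW/(lt_trans s12).
Unshelve. all: by end_near. Qed.

(** Up to a constant factor, [|x|^-2 - 1] is the Green function of the unit ball of R^4 with pole at
    the origin; here it is truncated at [|x|^2 = s1]. *)
Definition greenL2 (s1 : R) : R :=
  Num.sqrt (intB (fun x => ((Num.max (sqnorm x) s1)^-1 - 1) ^+ 2)).

Lemma L2B_green (s1 : R) : 0 < s1 -> L2B (fun x => (Num.max (sqnorm x) s1)^-1 - 1).
Proof.
move=> s10; apply: (@L2B_bounded _ _ (s1^-1 + 1)).
  apply: measurable_funB => //.
  have mm : measurable_fun setT (fun t : R => (Num.max t s1)^-1).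
    apply: continuous_measurable_fun => t.
    apply: cvgV; first by rewrite gt_eqF// lt_max s10 orbT.
    apply: continuous_max; [exact: cvg_id|exact: cvg_cst].
  by apply: (measurableT_comp mm); apply: measurable_funS measurable_sqnorm.
move=> x _; apply: le_trans (ler_normB _ _) _; rewrite normr1 lerD2r.
have h : s1 <= Num.max (sqnorm x) s1 by rewrite le_max lexx orbT.
by rewrite ger0_norm ?invr_ge0 ?(le_trans (ltW s10))// lef_pV2 ?posrE// (lt_le_trans s10).
Qed.

(* Tested against the radial potential of the shell, the condition [||lap u||_2 = 1] bounds
   the average of [u] over the shell. *)
Lemma shell_average_bound u (s1 s2 : R) : H2N R u -> normL2B (laplacian u) = 1%E ->
  0 < s1 -> s1 < s2 -> s2 < 1 ->
  `|intB (fun x => u x * \1_`]s1, s2[ (sqnorm x))| <= (s2 ^+ 2 - s1 ^+ 2) / 8 * greenL2 s1.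
Proof.
move=> Hu nu s10 s12 s21.
have Lu : L2B u by case: Hu => [[[]]].
have Lw : L2B (laplacian u) by apply: Hk_laplacian; case: Hu.
have nw : Num.sqrt (intB (fun x => laplacian u x ^+ 2)) = 1.
  by move: nu; rewrite normL2BE// => -[].
set M := (s2 ^+ 2 - s1 ^+ 2) / 8.
have M0 : 0 <= M by rewrite divr_ge0// subr_ge0 lerXn2r ?nnegrE ?ltW// (lt_trans s10).
have Lg := L2B_green s10.
have bd k : `|intB (fun x => u x * bump s1 s2 k (sqnorm x))| <= M * greenL2 s1.
  have f01 s : 0 <= bump s1 s2 k s <= 1 by rewrite bump_ge0 bump_le1.
  have [P [sP P1 HP bP]] := radial_poisson (smooth1_bump s1 s2 k) s10 s12 s21 f01 (@bump_eq0 R s1 s2 k).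
  have LP : L2B (fun x => P (sqnorm x)) by apply: smooth_L2B; apply: smooth_comp sP smooth_sqnorm.
  have -> : intB (fun x => u x * bump s1 s2 k (sqnorm x)) = intB (fun x => u x * lap (fun x => P (sqnorm x)) x).
    by apply: eq_Rintegral => x; rewrite inE => Bx; rewrite HP.
  rewrite laplacian_radial_duality//; apply: le_trans (cauchy_schwarzB Lw LP) _.
  rewrite nw mul1r /greenL2 -[X in X * _](ger0_norm M0) -sqrtr_sqr -sqrtrM ?sqr_ge0//.
  rewrite ler_sqrt; last by rewrite mulr_ge0 ?sqr_ge0// intB_ge0// => x _; exact: sqr_ge0.
  have [_ ig] := (L2BP _).1 Lg; have [_ iP] := (L2BP _).1 LP.
  rewrite -intBZ//; apply: intB_le => //; first exact: integrable_ballZ.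
  move=> x; rewrite uballE => x1; rewrite -exprMn -[P _ ^+ 2]real_normK ?num_real//.
  have s01 : 0 <= sqnorm x <= 1 by rewrite sqnorm_ge0 ltW.
  have := bP _ s01; rewrite -/M => h.
  by rewrite lerXn2r ?nnegrE// (le_trans _ h).
have Hc : intB (fun x => u x * bump s1 s2 k (sqnorm x)) @[k --> \oo] -->
   intB (fun x => u x * \1_`]s1, s2[ (sqnorm x)).
  apply: (@dominated_intB _ u (fun k x => bump s1 s2 k (sqnorm x)) (fun x => \1_`]s1, s2[ (sqnorm x)) 1).
  - exact: L2B_integrable.
  - move=> k; apply: smooth_measurable; first exact: measurable_uball.
    by apply: smooth_comp (smooth1_bump _ _ _) smooth_sqnorm.
  - by move=> k x _; rewrite ger0_norm ?bump_ge0// bump_le1.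
  - by move=> x _; exact: bump_cvg.
have Hn : `|intB (fun x => u x * bump s1 s2 k (sqnorm x))| @[k --> \oo] -->
   `|intB (fun x => u x * \1_`]s1, s2[ (sqnorm x))| by apply: cvg_norm.
rewrite -(cvg_lim (@Rhausdorff R) Hn); apply: limr_le; first by apply/cvg_ex; eexists; exact: Hn.
by apply: nearW => k; exact: bd.
Qed.

End RadialTest.

(** * The law of the fourth power of the norm on the ball *)

Section RadialDistribution.
Context {R : realType}.
Local Notation mu := (@lebesgue4 R).
Local Notation B := (@uball R).
Implicit Types (u v w : R4 R -> R) (x : R4 R).

Definition mass : R := fine (mu B).

Lemma mu_uball : mu B = mass%:E.
Proof.
by rewrite /mass fineK// ge0_fin_numE ?mu_uball_lty// ltW// mu_uball_gt0.
Qed.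

Lemma mass_gt0 : 0 < mass.
Proof. by rewrite -lte_fin -mu_uball mu_uball_gt0. Qed.

Lemma sqnorm_scale (r : R) x : sqnorm (r *: x + 0 : R4 R) = r ^+ 2 * sqnorm x.
Proof.
rewrite /sqnorm mulr_sumr; apply: eq_bigr => i _; rewrite coord4_linear -exprMn.
by congr (_ ^+ _); rewrite coord4E; case: i => [[|[|[|[|//]]]] H]; rewrite /= addr0.
Qed.

Lemma mu_sqnorm_lt (r : R) : 0 < r -> mu [set x | sqnorm x < r ^+ 2] = (r ^+ 4 * mass)%:E.
Proof.
move=> r0.
have -> : [set x | sqnorm x < r ^+ 2] = (fun x => (r^-1 *: x + 0 : R4 R)) @^-1` B.
  apply/funext => x; rewrite /preimage/= uballE sqnorm_scale exprVn.
  by rewrite ltr_pdivrMl ?exprn_gt0// mulr1.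
rewrite lebesgue4_affine ?invr_gt0//; last exact: measurable_uball.
by rewrite mu_uball -EFinM exprVn invrK.
Qed.

Definition qnorm x : R := sqnorm x ^+ 2.

Lemma measurable_qnorm : measurable_fun setT qnorm.
Proof. by apply: measurable_funX; exact: measurable_sqnorm. Qed.

Lemma qnorm_ge0 x : 0 <= qnorm x.
Proof. exact: sqr_ge0. Qed.

Lemma sqrt_qnorm x : Num.sqrt (qnorm x) = sqnorm x.
Proof. by rewrite /qnorm sqrtr_sqr ger0_norm// sqnorm_ge0. Qed.

Lemma qnorm_lt x (a : R) : 0 <= a -> (qnorm x < a ^+ 2) = (sqnorm x < a).
Proof. by move=> a0; rewrite /qnorm ltr_pXn2r// nnegrE// sqnorm_ge0. Qed.

Lemma uball_qnorm x : B x <-> qnorm x < 1.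
Proof. by have := qnorm_lt x ler01; rewrite expr1n uballE => ->. Qed.

Lemma preimage_qnorm01 : qnorm @^-1` `[0, 1[ = B.
Proof.
apply/seteqP; split => x /=; rewrite in_itv/= qnorm_ge0/=; first by move/uball_qnorm.
by move=> /uball_qnorm.
Qed.

Lemma mu_qnorm_lt (a : R) : a <= 1 -> mu [set x | qnorm x < a] = (Num.max 0 a * mass)%:E.
Proof.
move=> a1; case: (leP a 0) => a0.
  rewrite mul0r (_ : [set x | _] = set0) ?measure0//.
  by apply/seteqP; split => x //=; rewrite ltNge (le_trans a0 (qnorm_ge0 x)).
have s0 : 0 < Num.sqrt a by rewrite sqrtr_gt0.
have ss0 : 0 < Num.sqrt (Num.sqrt a) by rewrite sqrtr_gt0.
have E2 : Num.sqrt (Num.sqrt a) ^+ 2 = Num.sqrt a by rewrite sqr_sqrtr// ltW.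
have -> : [set x | qnorm x < a] = [set x | sqnorm x < Num.sqrt (Num.sqrt a) ^+ 2].
  by apply/funext => x /=; rewrite E2 -qnorm_lt ?(ltW s0)// sqr_sqrtr// ltW.
rewrite mu_sqnorm_lt//; congr (_ * _)%:E.
by rewrite -[4%N]/(2 * 2)%N exprM E2 sqr_sqrtr// ltW.
Qed.

(* The distribution of [|x|^4] on the unit ball is uniform: this replaces
   polar coordinates. *)
Lemma mu_preimage_qnorm (A : set (measurableTypeR R)) : measurable A -> A `<=` `[0, 1[ ->
  mu (qnorm @^-1` A) = (mass%:E * lebesgue_measure A)%E.
Proof.
move=> mA A01.
have mI : measurable (`[0%R, 1%R[%classic : set (measurableTypeR R)) by [].
have mq : measurable_fun setT (qnorm : R4 R -> measurableTypeR R) := measurable_qnorm.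
have m0 : 0 <= mass := ltW mass_gt0.
pose m1 := mrestr (pushforward mu (qnorm : R4 R -> measurableTypeR R)) mI.
pose m2 := mscale (NngNum m0) (mrestr (@lebesgue_measure R) mI).
have H : m1 A = m2 A.
  apply: (@measure_unique _ R (measurableTypeR R) (@RGenInftyO.G R) (fun n => `]-oo, n%:R[%classic)) => //.
  - exact: RGenInftyO.measurableE.
  - move=> _ _ [a ->] [b ->]; exists (Num.min a b).
    by apply/seteqP; split => t /=; rewrite !in_itv/= lt_min; [move=> [-> ->]|move/andP].
  - by move=> i; exists i%:R.
  - apply/seteqP; split => // t _; near \oo => n; exists n => //=; rewrite in_itv/=.
    by near: n; exact: nbhs_infty_gtr.
  - move=> _ [a ->].
    change (mu (qnorm @^-1` (`]-oo, a[%classic `&` `[0, 1[%classic)) =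
      (mass%:E * lebesgue_measure (`]-oo, a[%classic `&` `[0%R, 1%R[%classic : set (measurableTypeR R)))%E).
    have -> : `]-oo, a[%classic `&` `[0, 1[%classic = [set` `[0, (Num.min a 1)[] :> set R.
      apply/seteqP; split => t /=; rewrite !in_itv/= lt_min.
        by move=> [-> /andP[-> ->]].
      by move=> /andP[-> /andP[-> ->]].
    have -> : qnorm @^-1` [set` `[0, (Num.min a 1)[] = [set x | qnorm x < Num.min a 1].
      by apply/funext => x /=; rewrite in_itv/= qnorm_ge0.
    rewrite mu_qnorm_lt ?ge_min ?lexx ?orbT// lebesgue_measure_itv/= lte_fin.
    case: ltP => h; last by rewrite mule0 mul0r.
    by rewrite sube0 -EFinM mulrC.
  - move=> k; change (mu (qnorm @^-1` (`]-oo, k%:R[%classic `&` `[0%R, 1%R[%classic)) < +oo)%E.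
    apply: le_lt_trans mu_uball_lty; apply: le_measure; rewrite ?inE.
    + by rewrite -[X in measurable X]setTI; apply: mq => //; apply: measurableI.
    + exact: measurable_uball.
    + by rewrite -preimage_qnorm01 => x [].
change (mu (qnorm @^-1` (A `&` `[0%R, 1%R[%classic)) = (mass%:E * lebesgue_measure (A `&` `[0%R, 1%R[%classic))%E) in H.
by move: H; rewrite setIidl.
Unshelve. all: by end_near. Qed.

Lemma ge0_integral_qnorm (f : R -> \bar R) : measurable_fun (`[0%R, 1%R[%classic : set (measurableTypeR R)) f ->
  (forall t, (0 <= f t)%E) ->
  (\int[mu]_(x in B) f (qnorm x) = mass%:E * \int[lebesgue_measure]_(t in (`[0%R, 1%R[%classic : set (measurableTypeR R))) f t)%E.
Proof.
move=> mf f0.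
have mq : measurable_fun setT (qnorm : R4 R -> measurableTypeR R) := measurable_qnorm.
have mI : measurable (`[0%R, 1%R[%classic : set (measurableTypeR R)) by [].
have m0 : 0 <= mass := ltW mass_gt0.
rewrite -preimage_qnorm01.
rewrite -(@ge0_integral_pushforward _ _ _ (measurableTypeR R) R qnorm mq mu
  (`[0%R, 1%R[%classic : set (measurableTypeR R)) f mI mf (fun t _ => f0 t)).
rewrite -(@ge0_integral_mscale _ _ R (@lebesgue_measure R) `[0, 1[ mI (NngNum m0) f mf (fun t _ => f0 t)).
apply: eq_measure_integral => A mA A01; exact: mu_preimage_qnorm.
Qed.

Lemma integral_qnorm (f : R -> R) : measurable_fun setT f ->
  integrable_ball (fun x => f (qnorm x)) ->
  lebesgue_measure.-integrable (`[0%R, 1%R[%classic : set (measurableTypeR R)) (EFin \o f) /\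
  intB (fun x => f (qnorm x)) = mass * \int[lebesgue_measure]_(t in (`[0%R, 1%R[%classic : set (measurableTypeR R))) f t.
Proof.
move=> mf iqf.
have mI : measurable (`[0%R, 1%R[%classic : set (measurableTypeR R)) by [].
have mfI : measurable_fun (`[0%R, 1%R[%classic : set R) f by exact: measurable_funS mf.
have m0 := mass_gt0.
have fin : lebesgue_measure.-integrable (`[0%R, 1%R[%classic : set (measurableTypeR R)) (EFin \o f).
  apply/integrableP; split; first exact/measurable_EFinP.
  have /integrableP[_] := iqf.
  rewrite (ge0_integral_qnorm (f := fun t => `|(f t)%:E|%E)) //; last first.
    by apply: measurableT_comp => //; exact/measurable_EFinP.
  have := integral_ge0 (D := (`[0%R, 1%R[%classic : set (measurableTypeR R))) (@lebesgue_measure R)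
    (f := fun t => `|(f t)%:E|%E) (fun t _ => abse_ge0 _).
  move: (\int[_]_(t in _) _)%E => [r _ _|_|//]; first exact: ltry.
  by rewrite gt0_muley ?lte_fin.
split => //.
have fpE (g : R -> R) : measurable_fun setT g -> (forall t, 0 <= g t) ->
    lebesgue_measure.-integrable (`[0%R, 1%R[%classic : set (measurableTypeR R)) (EFin \o g) ->
    intB (fun x => g (qnorm x)) = mass * \int[lebesgue_measure]_(t in (`[0%R, 1%R[%classic : set (measurableTypeR R))) g t.
  move=> mg g0 ig; rewrite /intB /Rintegral (ge0_integral_qnorm (f := EFin \o g)).
  - by rewrite fineM// integrable_fin_num.
  - by apply/measurable_EFinP; exact: measurable_funS mg.
  - by move=> t; rewrite lee_fin.
pose fp t := Num.max (f t) 0; pose fn t := Num.max (- f t) 0.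
have mfp : measurable_fun setT fp by apply: measurable_maxr.
have mfn : measurable_fun setT fn by apply: measurable_maxr => //; exact: measurableT_comp.
have fE t : f t = fp t - fn t.
  by rewrite /fp /fn; case: (leP (f t) 0) => h; case: (leP (- f t) 0) => h'; lra.
have ifp : lebesgue_measure.-integrable (`[0%R, 1%R[%classic : set (measurableTypeR R)) (EFin \o fp).
  exact: (integrable_funrpos mI fin).
have ifn : lebesgue_measure.-integrable (`[0%R, 1%R[%classic : set (measurableTypeR R)) (EFin \o fn).
  exact: (integrable_funrneg mI fin).
have iqfp : integrable_ball (fun x => fp (qnorm x)) := integrable_funrpos measurable_uball iqf.
have iqfn : integrable_ball (fun x => fn (qnorm x)) := integrable_funrneg measurable_uball iqf.
have -> : (fun x => f (qnorm x)) = (fun x => fp (qnorm x) - fn (qnorm x)) by apply/funext => x.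
rewrite intBB// !fpE//; last 2 first.
- by move=> t; rewrite /fn le_max lexx orbT.
- by move=> t; rewrite /fp le_max lexx orbT.
rewrite -mulrBr -RintegralB//; congr (_ * _); apply: eq_Rintegral => t _; exact/esym/fE.
Qed.

(** Lipschitz control on intervals implies absolute continuity: [N] is covered by half-open
    intervals of total length below [e / (C + 1)], where the added 1 allows [C = 0]. *)
Lemma null_of_interval_bound (m : {measure set (measurableTypeR R) -> \bar R}) (C : R) :
  0 <= C -> (forall a b : R, a < b -> (m (`]a, b]%classic : set (measurableTypeR R)) <= (C * (b - a))%:E)%E) ->
  forall N, measurable N -> lebesgue_measure N = 0%E -> m N = 0%E.
Proof.
move=> C0 H N mN N0.
apply/eqP; rewrite eq_le measure_ge0 andbT; apply/lee_addgt0Pr => e e0; rewrite add0e.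
have d0 : 0 < e / (C + 1) by rewrite divr_gt0// ltr_wpDl.
have /ereal_inf_lt[z [/= M covN sMz ze]] : (lebesgue_measure N < (e / (C + 1))%:E)%E.
  by rewrite N0 lte_fin.
have ocM n : ocitv (M n) by case: covN => /(_ n).
have mM n : measurable (M n : set (measurableTypeR R)).
  have /ocitvP[->|[[a b] /= _ ->]] := ocM n; first exact: measurable0.
  exact: measurable_itv.
have mH n : (m (M n) <= C%:E * lebesgue_measure (M n))%E.
  have /ocitvP[->|[[a b] /= ab ->]] := ocM n; first by rewrite !measure0 mule0.
  by rewrite lebesgue_measure_itv/= lte_fin ab -EFinB -EFinM; exact: H.
have covN' : N `<=` \bigcup_n M n by case: covN.
apply: (@le_trans _ _ (m (\bigcup_n M n))).
  by apply: le_measure => //; rewrite inE//; exact: bigcupT_measurable.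
apply: (le_trans (measure_sigma_subadditive _ mM _ (@subset_refl _ _))).
  exact: bigcupT_measurable.
apply: (@le_trans _ _ (\sum_(n <oo) (C%:E * lebesgue_measure (M n)))%E).
  by apply: lee_nneseries => // n _ _; exact: mH.
rewrite nneseriesZl//.
have -> : (\sum_(n <oo) lebesgue_measure (M n) = z)%E.
  rewrite -sMz; apply: eq_eseriesr => n _.
  have /ocitvP[->|[[a b] /= ab ->]] := ocM n; first by rewrite wlength0 measure0.
  by rewrite wlength_itv lebesgue_measure_itv/= lte_fin ab.
apply: (@le_trans _ _ (C%:E * (e / (C + 1))%:E)%E).
  by apply: lee_wpmul2l; [rewrite lee_fin|exact: ltW].
rewrite -EFinM lee_fin mulrCA -[leRHS]mulr1 ler_wpM2l ?(ltW e0)//.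
by rewrite ler_pdivrMr ?ltr_wpDl// mul1r lerDl ler01.
Qed.

End RadialDistribution.

(** * Measurable profile of a radial function *)

Section RadialRepresentative.
Context {R : realType}.
Local Notation mu := (@lebesgue4 R).
Local Notation B := (@uball R).
Local Notation mR := (measurableTypeR R).
Local Notation mu3 := (@lebesgue_measure R \x @lebesgue_measure R \x @lebesgue_measure R)%E.
Implicit Types (u v w : R4 R -> R) (x : R4 R).

Lemma lebesgue4_xsection (N : set (R4 R)) :
  mu N = (\int[mu3]_p (@lebesgue_measure R) (xsection N p))%E.
Proof. by []. Qed.

Definition sqnorm3 (p : mR * mR * mR) : R := p.1.1 ^+ 2 + p.1.2 ^+ 2 + p.2 ^+ 2.

Lemma sqnorm_pair (p : mR * mR * mR) (t : R) : sqnorm ((p, t) : R4 R) = sqnorm3 p + t ^+ 2.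
Proof. by rewrite /sqnorm !big_ord_recr big_ord0/= !coord4E/= add0r. Qed.

(** By Fubini almost every line parallel to the last axis meets [N] in a null set. If no line with
    [sqnorm3 p < d] did, the ball [|x|^2 < d] would be null. *)
Lemma null_fiber (N : set (R4 R)) (d : R) : measurable N -> mu N = 0%E -> 0 < d ->
  exists p : mR * mR * mR, sqnorm3 p < d /\ lebesgue_measure (xsection N p) = 0%E.
Proof.
move=> mN N0 d0; apply: contrapT => H.
have mf : measurable_fun setT (fun p => lebesgue_measure (xsection N p) : \bar R) by exact: measurable_fun_xsection.
have ae0 : ae_eq mu3 setT (fun p => lebesgue_measure (xsection N p)) (cst 0%E).
  apply/ae_eq_integral_abs => //.
  by under eq_integral do rewrite gee0_abs//; rewrite -lebesgue4_xsection.
pose S := [set x : R4 R | sqnorm x < d].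
have mS : measurable S by rewrite /S; exact: measurable_sqnorm_lt.
have mfS : measurable_fun setT (fun p => lebesgue_measure (xsection S p) : \bar R) by exact: measurable_fun_xsection.
have : mu S = 0%E.
  rewrite lebesgue4_xsection.
  transitivity (\int[mu3]_p (cst 0 p : \bar R))%E; last by rewrite integral0.
  apply: ae_eq_integral => //.
  apply: filterS ae0 => p /(_ I) Np _.
  rewrite (_ : xsection S p = set0) ?measure0//.
  apply/seteqP; split => t //; rewrite /xsection/= inE /S/= sqnorm_pair => h.
  by apply: H; exists p; split => //; apply: le_lt_trans h; rewrite lerDl sqr_ge0.
have := @mu_sqnorm_lt R (Num.sqrt d); rewrite sqrtr_gt0 sqr_sqrtr ?ltW// => /(_ d0) -> /eqP.
by rewrite eqe mulf_eq0 expf_eq0/= gt_eqF ?sqrtr_gt0//= gt_eqF// mass_gt0.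
Qed.

(** The inverse of [rho], which sends [t] to [(c + t^2)^2], has slope at most 8 on [0, 1] because
    [c < 1]; so [rho] pulls null sets back to null sets, and the law of [|x|^4] transfers this to
    the ball. The set described consists of the points having the norm of a bad point of the chosen
    line. *)
Lemma null_preimage_sqrt_shift (c : R) (N : set mR) : 0 <= c -> c < 1 -> measurable N ->
  lebesgue_measure N = 0%E ->
  mu [set x | [/\ B x, c < sqnorm x & N (Num.sqrt (sqnorm x - c))]] = 0%E /\
  measurable [set x | [/\ B x, c < sqnorm x & N (Num.sqrt (sqnorm x - c))]].
Proof.
move=> c0 c1 mN N0.
pose rho (t : mR) : mR := Num.sqrt (Num.sqrt t - c).
have msq : measurable_fun setT (Num.sqrt : mR -> mR).
  by apply: continuous_measurable_fun; exact: sqrt_continuous.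
have mrho : measurable_fun setT rho.
  by apply: measurableT_comp => //; apply: measurable_funB.
pose D : set mR := `](c ^+ 2), 1%R[%classic.
have mD : measurable D by exact: measurable_itv.
pose m := pushforward (mrestr (@lebesgue_measure R) mD) rho.
have mN' : m N = 0%E.
  apply: (@null_of_interval_bound R m 8) => // a b ab.
  change (lebesgue_measure ((rho @^-1` `]a, b]%classic) `&` D) <= (8 * (b - a))%:E)%E.
  (* The values of [rho] on [D] lie in []0, 1]], so the interval may be clipped to that range. *)
  pose a' := Num.max a 0; pose b' := Num.min b 1.
  have sub t : ((rho @^-1` `]a, b]%classic) `&` D) t -> [/\ a' < b', (c + a' ^+ 2) ^+ 2 < t & t <= (c + b' ^+ 2) ^+ 2].
    rewrite /D /= !in_itv/= => -[/andP[at_ tb] /andP[ct t1]].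
    have t0 : 0 < t by exact: le_lt_trans (sqr_ge0 _) ct.
    have s1 : Num.sqrt t < 1 by rewrite -sqrtr1 ltr_sqrt.
    have sc : c < Num.sqrt t by rewrite -(ger0_norm c0) -sqrtr_sqr ltr_sqrt.
    have r0 : 0 < rho t by rewrite sqrtr_gt0 subr_gt0.
    have r1 : rho t <= 1 by rewrite -[leRHS]sqrtr1 ler_sqrt//; lra.
    have E : c + rho t ^+ 2 = Num.sqrt t by rewrite sqr_sqrtr ?subr_ge0 ?ltW// addrC subrK.
    have ar : a' < rho t by rewrite /a' gt_max at_ r0.
    have rb : rho t <= b' by rewrite /b' le_min tb r1.
    have a'0 : 0 <= a' by rewrite /a' le_max lexx orbT.
    have Et : t = (c + rho t ^+ 2) ^+ 2 by rewrite E sqr_sqrtr// ltW.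
    split; first exact: lt_le_trans rb.
    - by rewrite [ltRHS]Et ltr_pXn2r// ?nnegrE ?addr_ge0 ?sqr_ge0// ltrD2l ltr_pXn2r// ?nnegrE// ltW.
    - by rewrite [leLHS]Et ler_pXn2r// ?nnegrE ?addr_ge0 ?sqr_ge0// lerD2l ler_pXn2r// ?nnegrE// ?ltW// (lt_le_trans r0).
  have [ab'|ab'] := ltP a' b'; last first.
    rewrite (_ : _ `&` D = set0) ?measure0 ?lee_fin; first by nra.
    by apply/seteqP; split => t // /sub[]; rewrite ltNge ab'.
  apply: (@le_trans _ _ (lebesgue_measure (`]((c + a' ^+ 2) ^+ 2), ((c + b' ^+ 2) ^+ 2)]%classic : set mR))).
    apply: le_measure; rewrite ?inE//.
      by apply: measurableI => //; rewrite -[X in measurable X]setTI; exact: mrho.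
    by move=> t /sub[_ h1 h2]; rewrite /= in_itv/= h1 h2.
  have a'0 : 0 <= a' by rewrite /a' le_max lexx orbT.
  have b'1 : b' <= 1 by rewrite /b' ge_min lexx orbT.
  have aa' : a <= a' by rewrite /a' le_max lexx.
  have bb' : b' <= b by rewrite /b' ge_min lexx.
  clearbody a' b'.
  rewrite lebesgue_measure_itv/= lte_fin; case: ifP => _; last by rewrite lee_fin; nra.
  rewrite -EFinB lee_fin.
  have -> : (c + b' ^+ 2) ^+ 2 - (c + a' ^+ 2) ^+ 2 = (b' - a') * ((a' + b') * (2 * c + a' ^+ 2 + b' ^+ 2)) by ring.
  have h1 : a' ^+ 2 <= 1 by nra.
  have h2 : b' ^+ 2 <= 1 by nra.
  have h0 : 0 <= a' ^+ 2 by exact: sqr_ge0.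
  have h3 : (a' + b') * (2 * c + a' ^+ 2 + b' ^+ 2) <= 2 * 4.
    by apply: ler_pM; [lra| have := sqr_ge0 b'; lra|lra|lra].
  apply: (@le_trans _ _ ((b' - a') * 8)); last by lra.
  by rewrite ler_wpM2l//; lra.
pose A := (rho @^-1` N) `&` D.
have mA : measurable A by apply: measurableI => //; rewrite -[X in measurable X]setTI; exact: mrho.
have A01 : A `<=` `[0, 1[.
  move=> t [_]; rewrite /D/= !in_itv/= => /andP[ct ->]; rewrite andbT.
  exact: le_trans (sqr_ge0 _) (ltW ct).
have -> : [set x | [/\ B x, c < sqnorm x & N (Num.sqrt (sqnorm x - c))]] = (@qnorm R) @^-1` A.
  apply/funext => x /=; apply/propext; rewrite /A /rho /D/= in_itv/= sqrt_qnorm.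
  have -> : (c ^+ 2 < qnorm x) = (c < sqnorm x).
    by rewrite ltNge -[qnorm x]/(sqnorm x ^+ 2) ler_pXn2r ?nnegrE ?sqnorm_ge0// -ltNge.
  split; first by move=> [/uball_qnorm h1 h2 h3]; rewrite h1 h2.
  by move=> [h1 /andP[h2 /uball_qnorm h3]].
split; first by rewrite mu_preimage_qnorm// (mN' : lebesgue_measure A = 0%E) mule0.
by rewrite -[X in measurable X]setTI; exact: measurable_qnorm.
Qed.

(* A radial function is given by an arbitrary profile, but restricting it to a line that meets
   the exceptional set in a null set yields a measurable profile. *)
Lemma radial_measurable_profile u (d : R) : L2B u -> radial R u -> 0 < d -> d <= 1 ->
  exists (c : R) (g : R -> R), [/\ 0 <= c, c < d, measurable_fun setT g &
    {ae mu, forall x, B x -> c < sqnorm x -> u x = g (qnorm x)}].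
Proof.
move=> Lu [g [N [mN N0 sN]]] d0 d1.
have [p [pd pN]] := null_fiber mN N0 d0.
pose c := sqnorm3 p.
have c0 : 0 <= c by rewrite /c /sqnorm3 !addr_ge0// sqr_ge0.
have mp : measurable (xsection N p) by exact: measurable_xsection.
have mu' : measurable_fun setT (u \_ B).
  exact: (measurable_restrictT _ measurable_uball).1 (L2B_measurable Lu).
(* For [t = |x|^4] the point [(p, sqrt (|x|^2 - c))] of the line has the same norm as [x]. It exists
   only for [|x|^2 >= c], which is why [c] must be available below every [d]. *)
exists c, (fun t => (u \_ B) ((p, Num.sqrt (Num.sqrt t - c)) : R4 R)); split => //.
  apply: measurableT_comp => //.
  apply: measurable_fun_pair => //.
  have msq : measurable_fun setT (Num.sqrt : mR -> mR).
    by apply: continuous_measurable_fun; exact: sqrt_continuous.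
  by apply: measurableT_comp => //; apply: measurable_funB.
have [h1 h2] := null_preimage_sqrt_shift c0 (lt_le_trans pd d1) mp pN.
have : {ae mu, forall x, ~ [/\ B x, c < sqnorm x & xsection N p (Num.sqrt (sqnorm x - c))]}.
  by eexists; split; [exact: h2|exact: h1|move=> x /contrapT].
have : {ae mu, forall x, ~ N x} by exists N; split => // x /contrapT.
apply: filterS2 => x /= nN nN' Bx cx.
rewrite sqrt_qnorm.
set y : R4 R := (p, _).
have yx : sqnorm y = sqnorm x by rewrite sqnorm_pair sqr_sqrtr ?subr_ge0 ?ltW// addrC subrK.
have By : B y by rewrite uballE yx -uballE.
have eyx : enorm y = enorm x.
  by apply/eqP; rewrite -(@eqrXn2 _ 2) ?sqrtr_ge0// !enormE yx.
have : ~ N y by move=> Ny; apply: nN'; split => //; rewrite /xsection/= inE.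
move=> nNy; rewrite patchE mem_set//.
have H z : ~ N z -> B z -> u z = g (enorm z) by move=> Nz; apply: contrapT => h; apply: Nz; exact: sN.
by rewrite !H// eyx.
Qed.

End RadialRepresentative.

(** * From averages over shells to almost every point *)

Section RadialPointwise.
Context {R : realType}.
Local Notation mu := (@lebesgue4 R).
Local Notation B := (@uball R).
Local Notation mR := (measurableTypeR R).
Implicit Types (u v w : R4 R -> R) (x : R4 R).

Lemma integrable_ball_ae_eq (f g : R4 R -> R) : measurable_fun B g ->
  {ae mu, forall x, B x -> f x = g x} -> integrable_ball f -> integrable_ball g.
Proof.
move=> mg fg /integrableP[mf foo]; apply/integrableP; split; first exact/measurable_EFinP.
apply: le_lt_trans foo; rewrite le_eqVlt; apply/orP; left; apply/eqP; apply: ae_eq_integral.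
- exact: measurable_uball.
- by apply: measurableT_comp => //; exact/measurable_EFinP.
- exact: measurableT_comp.
- by apply: filterS fg => x fg Bx /=; rewrite fg.
Qed.

Lemma L2B_indic_sqnorm (I : set mR) : measurable I -> L2B (fun x => \1_I (sqnorm x)).
Proof.
move=> mI; apply: (@L2B_bounded _ _ 1).
  apply: (measurableT_comp (f := (\1_I : mR -> R))); first exact: measurable_indic.
  exact: measurable_funS measurable_sqnorm.
by move=> x _; rewrite indicE ger0_norm ?ler0n// lern1 leq_b1.
Qed.

Lemma nicely_shrinking_right (q : R) :
  nicely_shrinking q (fun n => `]q, (q + n.+1%:R^-1)[%classic).
Proof.
split; first by move=> n; exact: measurable_itv.
have n0 n : 0 < n.+1%:R^-1 :> R by rewrite invr_gt0 ltr0n.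
exists (2, fun n => PosNum (n0 n)); split => //=.
- exact: cvg_harmonic.
- move=> n t; rewrite /= in_itv/= /ball/= => /andP[h1 h2].
  by rewrite ltr0_norm ?subr_lt0// opprB ltrBlDl.
- move=> n; rewrite lebesgue_measure_ball// lebesgue_measure_itv/= lte_fin ltrDl n0.
  by rewrite -EFinB addrAC subrr add0r -EFinM lee_fin mulr_natl.
Qed.

(* Lebesgue differentiation, with shells shrinking to a sphere from outside. *)
Lemma radial_profile_bound u (c : R) (g : R -> R) : H2N R u -> normL2B (laplacian u) = 1%E ->
  0 <= c -> measurable_fun setT g ->
  {ae mu, forall x, B x -> c < sqnorm x -> u x = g (qnorm x)} ->
  {ae (@lebesgue_measure R), forall q, c ^+ 2 < q -> q < 1 -> 8 * mass * `|g q| <= greenL2 (Num.sqrt q)}.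
Proof.
move=> Hu nu c0 mg ug.
have Lu : L2B u by case: Hu => [[[]]].
have mq : measurable_fun setT (qnorm : R4 R -> mR) := measurable_qnorm.
have M0 := @mass_gt0 R.
pose D : set mR := `](c ^+ 2), 1%R[%classic.
have mD : measurable D by exact: measurable_itv.
(* Only on [D] is [g] known to represent [u]; once truncated to [D], it is integrable because [u]
   is. *)
pose G t := g t * \1_D t.
have mG : measurable_fun setT G by apply: measurable_funM => //; exact: measurable_indic.
have cq x : (c ^+ 2 < qnorm x) = (c < sqnorm x).
  by rewrite ltNge -[qnorm x]/(sqnorm x ^+ 2) ler_pXn2r ?nnegrE ?sqnorm_ge0// -ltNge.
(* Integrals of [u] over shells become one-dimensional integrals of [G]: [J] is a condition on
   [|x|^2] and [I] the corresponding condition on [|x|^4]. *)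
have main (I J : set mR) : measurable I -> measurable J ->
    (forall x, B x -> J (sqnorm x) <-> (I (qnorm x) /\ c < sqnorm x)) ->
    lebesgue_measure.-integrable (`[0%R, 1%R[%classic : set mR) (EFin \o (fun t => G t * \1_I t)) /\
    intB (fun x => u x * \1_J (sqnorm x)) =
      mass * \int[lebesgue_measure]_(t in (`[0%R, 1%R[%classic : set mR)) (G t * \1_I t).
  move=> mI mJ IJ.
  have mGI : measurable_fun setT (fun t => G t * \1_I t).
    by apply: measurable_funM => //; exact: measurable_indic.
  have mGq : measurable_fun B (fun x => G (qnorm x) * \1_I (qnorm x)).
    by apply: (measurableT_comp mGI); apply: measurable_funS mq.
  have iJ : integrable_ball (fun x => u x * \1_J (sqnorm x)).
    by apply: L2B_mul => //; exact: L2B_indic_sqnorm.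
  have E : {ae mu, forall x, B x -> u x * \1_J (sqnorm x) = G (qnorm x) * \1_I (qnorm x)}.
    apply: filterS ug => x ug Bx; rewrite /G !indicE.
    have [Jx|Jx] := pselect (J (sqnorm x)).
      have [Ix cx] := (IJ x Bx).1 Jx.
      rewrite !mem_set//; last by rewrite /D/= in_itv/= cq cx/=; exact/uball_qnorm.
      by rewrite !mulr1 ug.
    rewrite (memNset Jx) mulr0.
    have [Ix|Ix] := pselect (I (qnorm x)); last by rewrite (memNset Ix) mulr0.
    rewrite [X in _ * X * _](_ : _ = 0) ?mulr0 ?mul0r//.
    rewrite memNset// /D/= in_itv/= cq => /andP[cx _]; apply: Jx; exact/IJ.
  have [h1 h2] := integral_qnorm mGI (integrable_ball_ae_eq mGq E iJ).
  by split => //; rewrite -h2; apply: intB_ae_eq => //; have /integrableP[/measurable_EFinP] := iJ.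
have [iG _] := main setT `]c, +oo[%classic measurableT (measurable_itv _) (fun x _ => ltac:(rewrite /= in_itv/= andbT; tauto)).
have locG : locally_integrable setT G.
  apply: open_integrable_locally; first exact: openT.
  have -> : EFin \o G = (EFin \o (fun t => G t * \1_setT t)) \_ (`[0%R, 1%R[%classic : set mR).
    apply/funext => t; rewrite patchE/= indicT mulr1; case: ifPn => // /negP tI.
    rewrite /G indicE memNset ?mulr0// /D /= in_itv/= => /andP[h1 h2]; apply: tI.
    by rewrite inE/= in_itv/= h2 andbT (le_trans (sqr_ge0 c))// ltW.
  by apply/(integrable_mkcond _ _).1 => //; exact: measurable_itv.
have [N [mN N0 sN]] := lebesgue_differentiation locG.
exists N; split => // q nP; apply: sN => /= Lq; apply: nP => cq0 q1.
have q0 : 0 < q by exact: le_lt_trans (sqr_ge0 _) cq0.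
have -> : g q = G q by rewrite /G indicE mem_set ?mulr1// /D/= in_itv/= cq0 q1.
have := nice_lebesgue_differentiation nicely_shrinking_right locG Lq.
set E := fun n => `]q, (q + n.+1%:R^-1)[%classic.
move=> cvgE.
(* In the variable [|x|^4] the factor [s2^2 - s1^2] of the shell bound is the length of [E n], so it
   cancels in the average and the bound does not depend on [n]. *)
pose K := greenL2 (Num.sqrt q) / (8 * mass).
suff GK : `|G q| <= K by rewrite mulrC -ler_pdivlMr ?mulr_gt0.
have bd : \forall n \near \oo, `|fine ((lebesgue_measure (E n))^-1 * \int[lebesgue_measure]_(y in E n) (G y)%:E)%E| <= K.
  near=> n.
  have h0 : 0 < n.+1%:R^-1 :> R by rewrite invr_gt0 ltr0n.
  have h1 : q + n.+1%:R^-1 < 1.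
    rewrite -ltrBrDl; near: n.
    have q1' : 0 < 1 - q by rewrite subr_gt0.
    exact: (near_infty_natSinv_lt (PosNum q1')).
  have muE : lebesgue_measure (E n) = (n.+1%:R^-1)%:E.
    by rewrite lebesgue_measure_itv/= lte_fin ltrDl h0 -EFinB addrAC subrr add0r.
  have sE : E n `<=` (`[0%R, 1%R[%classic : set mR).
    move=> t; rewrite /E/= !in_itv/= => /andP[h2 h3]; apply/andP; split; first exact/ltW/(lt_trans q0).
    exact: lt_trans h1.
  set s1 := Num.sqrt q; set s2 := Num.sqrt (q + n.+1%:R^-1).
  have s10 : 0 < s1 by rewrite sqrtr_gt0.
  have s1E : s1 ^+ 2 = q by rewrite sqr_sqrtr// ltW.
  have s2E : s2 ^+ 2 = q + n.+1%:R^-1 by rewrite sqr_sqrtr// ltW// addr_gt0.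
  have s12 : s1 < s2 by rewrite ltr_sqrt ?ltrDl// addr_gt0.
  have s21 : s2 < 1 by rewrite -sqrtr1 ltr_sqrt.
  have cs1 : c < s1 by rewrite -(ger0_norm c0) -sqrtr_sqr ltr_sqrt.
  have EJ x : B x -> [set` `]s1, s2[] (sqnorm x) <-> E n (qnorm x) /\ c < sqnorm x.
    move=> _; rewrite /E /= !in_itv/= -s2E qnorm_lt ?(ltW (lt_trans s10 s12))//.
    have -> : (q < qnorm x) = (s1 < sqnorm x).
      by rewrite -s1E ltNge -[qnorm x]/(sqnorm x ^+ 2) ler_pXn2r ?nnegrE ?sqnorm_ge0 ?(ltW s10)// -ltNge.
    by split => [/andP[h2 ->]|[]//]; rewrite h2 (lt_trans cs1).
  have [iE EE] := main (E n) `]s1, s2[%classic (measurable_itv _) (measurable_itv _) EJ.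
  have shell := shell_average_bound Hu nu s10 s12 s21; rewrite EE s1E s2E in shell.
  have -> : (\int[lebesgue_measure]_(y in E n) (G y)%:E)%E =
     (\int[lebesgue_measure]_(t in (`[0%R, 1%R[%classic : set mR)) (G t * \1_(E n) t)%:E)%E.
    rewrite integral_mkcond [RHS]integral_mkcond; apply: eq_integral => t _.
    rewrite !patchE; case: ifPn => [tE|tE].
      rewrite ifT; first by rewrite indicE tE mulr1.
      by apply: mem_set; apply: sE; exact: set_mem.
    by case: ifP => // _; rewrite indicE (negbTE tE) mulr0.
  rewrite muE inver gt_eqF// invrK; move: shell iE => /[swap] /integrable_fin_num.
  move=> /(_ (measurable_itv _)); rewrite /Rintegral.
  case: (integral _ _ _) => // r _ /= shell; rewrite normrM ger0_norm ?ler0n//.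
  move: shell; rewrite /K normrM gtr0_norm// => h.
  rewrite ler_pdivlMr ?mulr_gt0//.
  have nn : n.+1%:R != 0 :> R by rewrite pnatr_eq0.
  have := @ler_wpM2l R (8 * n.+1%:R) (mulr_ge0 (ler0n _ _) (ler0n _ _)) _ _ h.
  by rewrite [X in _ <= X -> _](_ : _ = greenL2 (Num.sqrt q)); [move=> h'; lra|field].
have /fine_cvgP[_ Gc] := cvgE.
have Hn := cvg_norm (FF := eventually_filter) Gc.
rewrite -(cvg_lim (@Rhausdorff R) Hn); apply: limr_le; first by apply/cvg_ex; eexists; exact: Hn.
exact: bd.
Unshelve. all: by end_near. Qed.

(** The profile is valid only beyond some [c], which can be taken below any [1/(k+1)]; countably
    many exceptional null sets then cover all nonzero points. *)
Lemma radial_pointwise_bound u : H2N R u -> radial R u -> normL2B (laplacian u) = 1%E ->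
  {ae mu, forall x, B x -> 0 < sqnorm x -> 8 * mass * `|u x| <= greenL2 (sqnorm x)}.
Proof.
move=> Hu ru nu.
have Lu : L2B u by case: Hu => [[[]]].
have mq : measurable_fun setT (qnorm : R4 R -> mR) := measurable_qnorm.
suff H (k : nat) : {ae mu, forall x, B x -> k.+1%:R^-1 <= sqnorm x -> 8 * mass * `|u x| <= greenL2 (sqnorm x)}.
  apply: filterS (ae_foralln H) => x Hx Bx x0.
  have /filter_ex[k /ltW kx] := near_infty_natSinv_lt (PosNum x0).
  exact: (Hx k).
have k0 : 0 < k.+1%:R^-1 :> R by rewrite invr_gt0 ltr0n.
have k1 : k.+1%:R^-1 <= 1 :> R by rewrite invf_le1 ?ltr0n// ler1n.
have [c [g [c0 ck mg ug]]] := radial_measurable_profile Lu ru k0 k1.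
have [N [mN N0 sN]] := radial_profile_bound Hu nu c0 mg ug.
pose N' : set mR := N `&` `[0%R, 1%R[%classic.
have mN' : measurable N' by apply: measurableI => //; exact: measurable_itv.
have N'0 : {ae mu, forall x, ~ N' (qnorm x)}.
  exists (qnorm @^-1` N'); split; last by move=> x /contrapT.
    by rewrite -[X in measurable X]setTI; exact: mq.
  rewrite mu_preimage_qnorm//; last by move=> ? [].
  rewrite (subset_measure0 _ mN _ N0) ?mule0//.
  by move=> ? [].
apply: filterS2 ug N'0 => x ux Nx Bx kx.
have cx : c < sqnorm x by exact: lt_le_trans kx.
have x1 : qnorm x < 1 by exact/uball_qnorm.
rewrite ux// -[X in greenL2 X]sqrt_qnorm.
have : ~ N (qnorm x) by move=> Nq; apply: Nx; split => //=; rewrite in_itv/= qnorm_ge0.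
move=> nN; apply: contrapT => nP; apply: nN; apply: sN => /= /(_ _ x1) h; apply: nP; apply: h.
by rewrite ltr_pXn2r ?nnegrE ?sqnorm_ge0.
Qed.

End RadialPointwise.

(** * Size of the truncated Green function *)

Section RadialUpperBound.
Context {R : realType}.
Local Notation mu := (@lebesgue4 R).
Local Notation B := (@uball R).
Implicit Types (u v w : R4 R -> R) (x : R4 R).

(* Together with [intB_layer] this replaces the integral of [|x|^-4]. *)
Lemma inv_sq_le_layers (J : nat) (w : R) : expR (- J%:R) <= w -> w <= 1 ->
  w ^- 2 <= 1 + \sum_(j < J) expR (2 * j.+1%:R) * (w < expR (- j%:R))%R%:R.
Proof.
elim: J => [|J IH] wJ w1.
  rewrite big_ord0 addr0 invf_le1 ?exprn_gt0 ?(lt_le_trans _ wJ) ?expR_gt0//.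
  by move: wJ; rewrite oppr0 expR0 => h; rewrite -(expr1n _ 2) lerXn2r ?nnegrE ?(le_trans _ h).
rewrite big_ord_recr/= addrA; case: (ltP w (expR (- J%:R))) => h; last first.
  by rewrite mulr0 addr0 IH.
rewrite mulr1 -[leLHS]add0r lerD//.
  by rewrite addr_ge0// sumr_ge0// => j _; rewrite mulr_ge0 ?expR_ge0.
have w0 : 0 < w by exact: lt_le_trans (expR_gt0 _) wJ.
rewrite -[expR _]invrK -expRN lef_pV2 ?posrE ?expR_gt0 ?exprn_gt0//.
rewrite -mulrN expRM_natl.
by rewrite lerXn2r ?nnegrE ?expR_ge0// ltW.
Qed.

Lemma L2B_layer (a : R) : L2B (fun x : R4 R => (sqnorm x < a)%R%:R : R).
Proof.
have -> : (fun x : R4 R => (sqnorm x < a)%R%:R : R) = (fun x => \1_(`]-oo, a[%classic : set (measurableTypeR R)) (sqnorm x)).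
  by apply/funext => x; rewrite indicE; congr (nat_of_bool _)%:R; apply/idP/idP; rewrite inE/= in_itv.
by apply: L2B_indic_sqnorm; exact: measurable_itv.
Qed.

Lemma intB_layer (j : nat) :
  intB (fun x : R4 R => (sqnorm x < expR (- j%:R))%R%:R) = expR (- (2 * j%:R)) * mass.
Proof.
pose r : R := expR (- (j%:R / 2)).
have r2 : r ^+ 2 = expR (- j%:R) by rewrite -expRM_natl; congr expR; lra.
have sub : [set x : R4 R | sqnorm x < r ^+ 2] `<=` B.
  by move=> x /= xr; rewrite uballE (lt_le_trans xr)// r2 -expR0 ler_expR oppr_le0.
have -> : intB (fun x : R4 R => (sqnorm x < expR (- j%:R))%R%:R) =
    fine (\int[mu]_(x in B) (\1_[set x : R4 R | sqnorm x < r ^+ 2] x)%:E)%E.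
  congr fine; apply: eq_integral => x _; rewrite indicE r2; congr (nat_of_bool _)%:R%:E.
  by apply/idP/idP; rewrite inE.
rewrite integral_indic; [|exact: measurable_uball|exact: measurable_sqnorm_lt].
change (fine (mu ([set x : R4 R | sqnorm x < r ^+ 2] `&` B)) = expR (- (2 * j%:R)) * mass).
rewrite setIidl// mu_sqnorm_lt ?expR_gt0//=; congr (_ * _).
by rewrite -expRM_natl; congr expR; lra.
Qed.

(** Each layer contributes [exp(2(j+1)) exp(-2j) mass = e^2 mass], and the number [J] of layers,
    chosen with [exp(-J) <= s], is at most [1 - ln s]. *)
Lemma greenL2_log (s : R) : 0 < s -> s <= 1 ->
  greenL2 s ^+ 2 <= mass * (1 + expR 2 * (1 - ln s)).
Proof.
move=> s0 s1.
set J := (Num.truncn (- ln s)).+1.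
have L0 : 0 <= - ln s by rewrite oppr_ge0 ln_le0.
have Js : expR (- J%:R) <= s.
  rewrite -[leRHS]lnK ?posrE// ler_expR lerNl ltW//.
  by have /andP[_ ] := truncn_itv L0.
have JL : J%:R <= 1 - ln s.
  by rewrite /J -natr1 addrC lerD2l; have /andP[] := truncn_itv L0.
rewrite /greenL2 sqr_sqrtr; last by apply: intB_ge0 => x _; exact: sqr_ge0.
pose F x : R := 1 + \sum_(j < J) expR (2 * j.+1%:R) * (sqnorm x < expR (- j%:R))%R%:R.
have iI j : integrable_ball (fun x : R4 R => expR (2 * j.+1%:R) * (sqnorm x < expR (- j%:R))%R%:R).
  apply: integrable_ballZ; apply: L2B_integrable.
  exact: L2B_layer.
have iF : integrable_ball F.
  apply: integrable_ballD; first exact/L2B_integrable/L2B_cst.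
  by apply: integrable_ball_sum => j.
have [_ ig] := (L2BP _).1 (L2B_green s0).
apply: (@le_trans _ _ (intB F)).
  apply: intB_le => // x; rewrite uballE => x1; rewrite /F.
  set w := Num.max _ _.
  have sw : s <= w by rewrite le_max lexx orbT.
  have w0 : 0 < w by exact: lt_le_trans sw.
  have w1 : w <= 1 by rewrite ge_max s1 ltW.
  have wV : 1 <= w^-1 by rewrite invf_ge1.
  apply: (@le_trans _ _ (w ^- 2)).
    by rewrite -exprVn lerXn2r ?nnegrE ?subr_ge0 ?(le_trans ler01)// gerBl.
  apply: le_trans (@inv_sq_le_layers J w (le_trans Js sw) w1) _.
  rewrite lerD2l ler_sum// => j _; rewrite ler_wpM2l ?expR_ge0// ler_nat.
  have : (w < expR (- j%:R)) ==> (sqnorm x < expR (- j%:R)).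
    by apply/implyP; apply: le_lt_trans; rewrite le_max lexx.
  by case: (w < _); case: (sqnorm x < _).
rewrite /F intBD//; last 2 first.
- exact/L2B_integrable/L2B_cst.
- by apply: integrable_ball_sum => j.
rewrite intB_cst mul1r -/mass intB_sum//.
rewrite (eq_bigr (fun=> expR 2 * mass)); last first.
  move=> j _; rewrite intBZ; last exact/L2B_integrable/L2B_layer.
  rewrite intB_layer mulrA -expRD; congr (expR _ * _).
  by rewrite -natr1; ring.
rewrite sumr_const card_ord -[_ *+ J]mulr_natl.
have h : J%:R * (expR 2 * mass) <= (1 - ln s) * (expR 2 * mass).
  by rewrite ler_wpM2r// mulr_ge0 ?expR_ge0 ?(ltW (@mass_gt0 R)).
by move: h; lra.
Qed.

Lemma greenL2_linear (s : R) : 0 < s -> s <= 1 ->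
  greenL2 s ^+ 2 <= mass * (s^-1 - 1) ^+ 2.
Proof.
move=> s0 s1.
rewrite /greenL2 sqr_sqrtr; last by apply: intB_ge0 => x _; exact: sqr_ge0.
have [_ ig] := (L2BP _).1 (L2B_green s0).
rewrite mulrC -intB_cst; apply: intB_le => //; first exact/L2B_integrable/L2B_cst.
move=> x; rewrite uballE => x1.
have w1 : Num.max (sqnorm x) s <= 1 by rewrite ge_max s1 ltW.
have sw : s <= Num.max (sqnorm x) s by rewrite le_max lexx orbT.
have w0 := lt_le_trans s0 sw.
rewrite lerXn2r ?nnegrE ?subr_ge0 ?invf_ge1//.
by rewrite lerD2r lef_pV2.
Qed.

(** Put [L = - ln s]. For [L > 1] the logarithmic bound applies with [1 + L <= 2 L]; for [L <= 1]
    the linear one applies with [s^-1 - 1 = exp L - 1 <= e L]. *)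
Lemma greenL2_le : exists C : R, 0 < C /\ forall s : R, 0 < s -> s < 1 ->
  greenL2 s ^+ 2 <= C * Num.min (- ln s) (ln s ^+ 2).
Proof.
have e1 : 1 <= expR 2 :> R by rewrite -expR0 ler_expR.
have M0 := @mass_gt0 R.
exists (mass * (1 + 2 * expR 2)); split; first by rewrite mulr_gt0//; lra.
move=> s s0 s1.
have L0 : 0 < - ln s by rewrite oppr_gt0 ln_lt0// s0.
set L := - ln s in L0 *; have -> : ln s ^+ 2 = L ^+ 2 by rewrite sqrrN.
have [L1|L1] := leP L 1.
  rewrite (_ : Num.min _ _ = L ^+ 2); last by apply/min_idPr; rewrite expr2 ger_pMl.
  apply: le_trans (greenL2_linear s0 (ltW s1)) _; rewrite -mulrA ler_wpM2l ?(ltW M0)//.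
  have h : s^-1 - 1 <= expR 1 * L.
    have -> : s^-1 = expR L by rewrite /L expRN lnK.
    have := expR_ge1Dx (- L); rewrite expRN => h.
    have h2 : 1 - (expR L)^-1 <= L by lra.
    have -> : expR L - 1 = expR L * (1 - (expR L)^-1) by rewrite mulrBr mulr1 mulfV// gt_eqF ?expR_gt0.
    apply: ler_pM; rewrite ?expR_ge0 ?ler_expR//.
    by rewrite subr_ge0 invf_le1 ?expR_gt0// -expR0 ler_expR ltW.
  apply: (@le_trans _ _ ((expR 1 * L) ^+ 2)).
    by rewrite lerXn2r ?nnegrE ?subr_ge0 ?invf_ge1 ?(ltW s1)// mulr_ge0 ?expR_ge0// ltW.
  rewrite exprMn ler_wpM2r ?sqr_ge0//.
  by rewrite -expRM_natl mulr1; lra.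
rewrite (_ : Num.min _ _ = L); last by apply/min_idPl; rewrite expr2 ler_pMl// ltW.
apply: le_trans (greenL2_log s0 (ltW s1)) _; rewrite -mulrA ler_wpM2l ?(ltW M0)//.
rewrite -/L -[1 - ln s]/(1 + L).
nra.
Qed.

Lemma radial_log_bound : exists C : R, 0 < C /\ forall u, H2N R u -> radial R u ->
  normL2B (laplacian u) = 1%E ->
  {ae mu, forall x, B x -> 0 < sqnorm x ->
     u x ^+ 2 <= C * Num.min (- ln (sqnorm x)) (ln (sqnorm x) ^+ 2)}.
Proof.
have [C [C0 HC]] := greenL2_le; have M0 := @mass_gt0 R.
exists (C / (8 * mass) ^+ 2); split; first by rewrite divr_gt0// exprn_gt0// mulr_gt0.
move=> u Hu ru nu; apply: filterS (radial_pointwise_bound Hu ru nu) => x Hx Bx x0.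
have := HC _ x0; rewrite -uballE => /(_ Bx) h.
rewrite mulrAC ler_pdivlMr ?exprn_gt0 ?mulr_gt0// mulrC -(real_normK (num_real (u x))) -exprMn.
by apply: le_trans h; rewrite lerXn2r ?nnegrE ?mulr_ge0 ?sqrtr_ge0 ?(ltW M0)//; exact: Hx.
Qed.

End RadialUpperBound.

(** * Comparison of the suprema *)

Section AdamsUpper.
Context {R : realType}.
Local Notation mu := (@lebesgue4 R).
Local Notation B := (@uball R).
Implicit Types (u v w : R4 R -> R) (x : R4 R).

Lemma expX_le_fact (k : nat) (t : R) : 0 <= t -> t ^+ k <= k`!%:R * expR t.
Proof.
move=> t0; rewrite mulrC -ler_pdivrMr ?ltr0n ?fact_gt0//.
apply: le_trans (exp_tail_ge k t0) _; rewrite /exp_tail gerBl.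
by apply: sumr_ge0 => j _; rewrite divr_ge0 ?exprn_ge0.
Qed.

Lemma quadratic_factor_le (n : nat) : (n.+1 * n.+2 <= 2 * 4 ^ n)%N.
Proof.
have -> : (2 * 4 ^ n = 2 ^ n * 2 ^ n.+1)%N by rewrite -[4%N]/(2 * 2)%N expnMn expnS mulnCA.
by apply: leq_mul; exact: ltn_expl.
Qed.

(** In both regimes [tau^n <= D^n L^(n+2)]: for [L <= 1] from the quadratic bound, as [2n >= n + 2],
    and for [L > 1] from the linear one. Then [L^(n+2) <= (8/alpha)^(n+2) (n+2)! exp(alpha L / 8)],
    where the factorial exceeds [n!] by at most [2 4^n], and [exp tau <= exp(alpha L / 8)] since
    [8 D <= alpha]. The constants are [128 = 2 8^2] and [32 = 8 4]. *)
Lemma adams_pointwise (D alpha L tau : R) (n : nat) : 0 < D -> 8 * D <= alpha -> 0 <= L ->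
  0 <= tau -> tau <= D * Num.min L (L ^+ 2) -> (2 <= n)%N ->
  exp_tail n tau <= 128 * (32 * D) ^+ n * alpha ^- n.+2 * expR (alpha / 4 * L).
Proof.
move=> D0 aD L0 t0 tD n2.
have a0 : 0 < alpha by apply: lt_le_trans aD; lra.
have tL : tau <= D * L by apply: le_trans tD _; rewrite ler_pM2l// ge_min lexx.
have tL2 : tau <= D * L ^+ 2 by apply: le_trans tD _; rewrite ler_pM2l// ge_min lexx orbT.
have powL : tau ^+ n <= D ^+ n * L ^+ n.+2.
  have [L1|L1] := leP L 1.
    apply: (@le_trans _ _ ((D * L ^+ 2) ^+ n)); first by rewrite lerXn2r ?nnegrE// mulr_ge0 ?sqr_ge0// ltW.
    rewrite exprMn -exprM ler_pM2l ?exprn_gt0// ler_wiXn2l//.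
    by rewrite mul2n -addnn -addn2 leq_add2l.
  apply: (@le_trans _ _ ((D * L) ^+ n)); first by rewrite lerXn2r ?nnegrE// mulr_ge0// ltW.
  by rewrite exprMn ler_pM2l ?exprn_gt0// ler_eXn2l// ltnW.
have b0 : 0 < alpha / 8 by rewrite divr_gt0.
have Lk : L ^+ n.+2 <= (8 / alpha) ^+ n.+2 * (n.+2)`!%:R * expR (alpha / 8 * L).
  have := @expX_le_fact n.+2 (alpha / 8 * L) (mulr_ge0 (ltW b0) L0).
  rewrite exprMn => h; rewrite -mulrA -[8 / alpha]invf_div exprVn.
  by rewrite ler_pdivlMl ?exprn_gt0.
apply: le_trans (exp_tail_le n t0) _.
have fE : ((n.+2)`!%:R = n`!%:R * (n.+1 * n.+2)%:R :> R).
  by rewrite !factS -natrM; congr (_%:R); rewrite mulnA [RHS]mulnC [(n.+2 * _)%N]mulnC.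
have f0 : 0 < n`!%:R :> R by rewrite ltr0n fact_gt0.
have q4 : (n.+1 * n.+2)%:R <= 2 * 4 ^+ n :> R.
  by rewrite -natrX -natrM ler_nat quadratic_factor_le.
apply: (@le_trans _ _ (D ^+ n * ((8 / alpha) ^+ n.+2 * (2 * 4 ^+ n) * expR (alpha / 8 * L)) * expR (alpha / 8 * L))).
  apply: ler_pM; rewrite ?expR_ge0 ?divr_ge0 ?exprn_ge0//; last first.
    by rewrite ler_expR (le_trans tL)// ler_wpM2r// ler_pdivlMr// mulrC.
  rewrite ler_pdivrMr//; apply: le_trans powL _; rewrite -[leRHS]mulrA ler_pM2l ?exprn_gt0//.
  apply: le_trans Lk _; rewrite fE.
  rewrite [leRHS](_ : _ = (8 / alpha) ^+ n.+2 * (n`!%:R * (2 * 4 ^+ n)) * expR (alpha / 8 * L)); last by ring.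
  rewrite ler_wpM2r ?expR_ge0// ler_wpM2l ?exprn_ge0 ?divr_ge0 ?(ltW a0)//.
  by rewrite ler_wpM2l// ltW.
rewrite le_eqVlt; apply/orP; left; apply/eqP.
have -> : expR (alpha / 4 * L) = expR (alpha / 8 * L) * expR (alpha / 8 * L).
  by rewrite -expRD; congr expR; lra.
have -> : (32 * D) ^+ n = 8 ^+ n * 4 ^+ n * D ^+ n by rewrite -!exprMn; congr (_ ^+ _); ring.
rewrite expr_div_n !exprSr; have := expf_neq0 n (lt0r_neq0 a0); move: (alpha ^+ n) => An An0.
by field; rewrite An0 gt_eqF.
Qed.

(** The source of the o(1) in the radial bound: the powers tend to 0 pointwise on the open ball and
    are bounded by 1. *)
Lemma sqnorm_powers_vanish (e : R) : 0 < e ->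
  exists k : nat, intB (fun x : R4 R => sqnorm x ^+ k) <= e.
Proof.
move=> e0.
have mk k : measurable_fun B (fun x : R4 R => sqnorm x ^+ k).
  by apply: measurable_funX; apply: measurable_funS measurable_sqnorm.
have : intB (fun x : R4 R => 1 * sqnorm x ^+ k) @[k --> \oo] --> intB (fun x : R4 R => 1 * 0).
  apply: (@dominated_intB _ (fun=> 1) (fun k x => sqnorm x ^+ k) (fun=> 0) 1) => //.
  - exact/L2B_integrable/L2B_cst.
  - move=> k x; rewrite uballE => x1; rewrite ger0_norm ?exprn_ge0 ?sqnorm_ge0//.
    by rewrite exprn_ile1// ?sqnorm_ge0// ltW.
  - by move=> x; rewrite uballE => x1; apply: cvg_expr; rewrite ger0_norm ?sqnorm_ge0.
rewrite mulr0 intB_cst mul0r => /cvgrPdist_le/(_ e e0)/filter_ex[k].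
rewrite sub0r normrN => h; exists k; apply: le_trans h; apply: le_trans (ler_norm _).
by rewrite le_eqVlt; apply/orP; left; apply/eqP; apply: eq_Rintegral => x _; rewrite mul1r.
Qed.

(** With [L = - ln |x|^2] the weight is [exp(- alpha L / 2)]. Half of the exponent pays for the
    factor [exp(alpha L / 4)] of the pointwise bound; the other half leaves
    [exp(- alpha L / 4) <= |x|^(2k)] as soon as [alpha >= 4 k], and [k] is chosen from [e] alone, so
    independently of [m]. *)
Lemma adams_radial_upper (sigma : R) : 0 < sigma -> exists D : R, 0 < D /\
  forall e : R, 0 < e -> exists alpha0 : R, forall alpha m u, alpha0 <= alpha -> (1 <= m)%N ->
    H2N R u -> radial R u -> normL2B (laplacian u) = 1%E ->
    (adamsF sigma alpha m u <= (e * D ^+ m.+1 * alpha ^- m.+3)%:E)%E.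
Proof.
move=> sigma0; have [C [C0 HC]] := @radial_log_bound R.
pose D := sigma * C; have D0 : 0 < D by exact: mulr_gt0.
exists (32 * D); split; first by rewrite mulr_gt0.
move=> e e0.
have [k Hk] := @sqnorm_powers_vanish (e / 128) (divr_gt0 e0 (ltr0n R 128)).
exists (Num.max (8 * D) (4 * k%:R)) => alpha m u; rewrite ge_max => /andP[aD ak] m1 Hu ru nu.
have a0 : 0 < alpha by apply: lt_le_trans aD; rewrite mulr_gt0.
have Lu : L2B u by case: Hu => [[[]]].
have mB := @measurable_uball R.
set K := 128 * (32 * D) ^+ m.+1 * alpha ^- m.+3.
have K0 : 0 <= K by apply: ltW; rewrite /K divr_gt0 ?exprn_gt0// mulr_gt0// exprn_gt0// mulr_gt0.
have mk : measurable_fun B (fun x : R4 R => sqnorm x ^+ k).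
  by apply: measurable_funX; apply: measurable_funS measurable_sqnorm.
have ik : integrable_ball (fun x : R4 R => sqnorm x ^+ k).
  apply: L2B_integrable; apply: (@L2B_bounded _ _ 1) => // x; rewrite uballE => x1.
  by rewrite ger0_norm ?exprn_ge0 ?sqnorm_ge0// exprn_ile1// ?sqnorm_ge0// ltW.
rewrite adamsFE.
apply: (@le_trans _ _ (\int[mu]_(x in B) (K * sqnorm x ^+ k)%:E)%E); last first.
  rewrite intBE; last exact: integrable_ballZ.
  rewrite lee_fin intBZ//; apply: (@le_trans _ _ (K * (e / 128))); first by rewrite ler_wpM2l.
  by rewrite /K; lra.
apply: ae_ge0_le_integral => //.
- by move=> x _; rewrite lee_fin adams_integrand_ge0// ltW.
- by apply/measurable_EFinP; apply: measurable_adams_integrand; exact: L2B_measurable.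
- by move=> x _; rewrite lee_fin mulr_ge0// exprn_ge0// sqnorm_ge0.
- by apply/measurable_EFinP; apply: measurable_funM.
apply: filterS (HC u Hu ru nu) => x Hx Bx; rewrite lee_fin /adams_integrand.
have := sqnorm_ge0 x; rewrite le_eqVlt => /orP[/eqP x0|x0].
  have -> : enorm x = 0 by apply/eqP; rewrite -(sqrf_eq0 (enorm x)) enormE -x0.
  by rewrite powR0 ?gt_eqF// mul0r mulr_ge0// exprn_ge0// sqnorm_ge0.
have x1 : sqnorm x < 1 by rewrite -uballE.
set L := - ln (sqnorm x).
have L0 : 0 < L by rewrite oppr_gt0 ln_lt0// x0.
have sE : sqnorm x = expR (- L) by rewrite /L opprK lnK.
have eE : enorm x `^ alpha = expR (- (alpha / 2 * L)).
  have ex0 : 0 < enorm x by rewrite /enorm sqrtr_gt0.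
  have lnE : ln (enorm x) = - L / 2.
    by have := @lnXn R 2 _ ex0; rewrite enormE mulr2n -[ln (sqnorm x)]opprK -/L; lra.
  by rewrite /powR gt_eqF// lnE; congr expR; lra.
have HxL : sigma * u x ^+ 2 <= D * Num.min L (L ^+ 2).
  by rewrite /D -mulrA ler_pM2l// [L ^+ 2]sqrrN; exact: Hx.
have su0 : 0 <= sigma * u x ^+ 2 by rewrite mulr_ge0 ?sqr_ge0// ltW.
have := adams_pointwise D0 aD (ltW L0) su0 HxL (m1 : (2 <= m.+1)%N); rewrite -/K => h.
rewrite eE; apply: (@le_trans _ _ (expR (- (alpha / 2 * L)) * (K * expR (alpha / 4 * L)))).
  by rewrite ler_pM2l ?expR_gt0.
rewrite mulrCA ler_wpM2l// -expRD sE -expRM_natl ler_expR.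
by nra.
Qed.

End AdamsUpper.

Lemma adams_sup_lt (R : realType) (X Y : set (R4 R -> R)) (sigma alpha : R) (m : nat) (a b : R) phi :
  a < b -> (forall u, X u -> normL2B (laplacian u) = 1%E -> (adamsF sigma alpha m u <= a%:E)%E) ->
  Y phi -> normL2B (laplacian phi) = 1%E -> (b%:E <= adamsF sigma alpha m phi)%E ->
  (adams_sup X sigma alpha m < adams_sup Y sigma alpha m)%E.
Proof.
move=> ab Xa Yphi nphi bphi; apply: (@le_lt_trans _ _ a%:E).
  by apply: ge_ereal_sup => _ [u [Xu nu] <-]; exact: Xa.
apply: (@lt_le_trans _ _ b%:E); first by rewrite lte_fin.
by apply: le_trans bphi _; apply: ereal_sup_ubound; exists phi.
Qed.

Theorem theorem3 (R : realType) (sigma : R) :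
  0 < sigma -> sigma <= 32 * pi ^+ 2 ->
  exists alpha_star : R, 0 < alpha_star /\
    forall alpha : R, alpha_star < alpha ->
    forall m : nat, (1 <= m)%N ->
      (adams_sup (H2N R `&` radial R) sigma alpha m
         < adams_sup (H2N R) sigma alpha m)%E /\
      (adams_sup (Hk0 R 2 `&` radial R) sigma alpha m
         < adams_sup (Hk0 R 2) sigma alpha m)%E.
Proof.
move=> s0 _.
have [kappa [c [k0 c0 low]]] := adams_lower s0.
have [D [D0 up]] := adams_radial_upper s0.
pose r := D / kappa; have r0 : 0 < r by exact: divr_gt0.
have DE : D = r * kappa by rewrite /r divfK// gt_eqF.
clearbody r.
(* This choice makes the quotient of the radial bound by the lower bound equal to
   [(1/2) (r / alpha)^(m - 1)], which is at most 1/2 for every [m >= 1] when [alpha > r]. *)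
have e0 : 0 < c / (2 * r ^+ 2) by rewrite divr_gt0// mulr_gt0// exprn_gt0.
have [alpha0 {}up] := up _ e0.
exists (Num.max 1 (Num.max r alpha0)); split; first by rewrite lt_max ltr01.
move=> alpha; rewrite !gt_max => /and3P[a1 ar aa0] m m1.
have a0 : 0 < alpha := lt_trans ltr01 a1.
have [phi [tphi nphi lphi]] := low alpha m (ltW a1).
have ab : c / (2 * r ^+ 2) * D ^+ m.+1 * alpha ^- m.+3 < c * kappa ^+ m.+1 * alpha ^- 4.
  case: m m1 {phi tphi nphi lphi} => // m _.
  have -> : c / (2 * r ^+ 2) * D ^+ m.+2 * alpha ^- m.+4 =
      c * kappa ^+ m.+2 * alpha ^- 4 * (2^-1 * (r / alpha) ^+ m).
    rewrite DE expr_div_n exprMn -[m.+4]addn4 -[in r ^+ m.+2]addn2 !exprD.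
    have an := expf_neq0 m (lt0r_neq0 a0); move: (alpha ^+ m) an => An An0.
    by field; rewrite An0 !gt_eqF.
  rewrite gtr_pMr; last by rewrite divr_gt0 ?exprn_gt0// mulr_gt0// exprn_gt0.
  have h : (r / alpha) ^+ m <= 1.
    by apply: exprn_ile1; [rewrite divr_ge0 ?ltW|rewrite ler_pdivrMr// mul1r ltW].
  by apply: le_lt_trans (ler_wpM2l _ h) _; rewrite ?invr_ge0// mulr1 invf_lt1// ltr1n.
have up' u : H2N R u -> radial R u -> normL2B (laplacian u) = 1%E ->
    (adamsF sigma alpha m u <= (c / (2 * r ^+ 2) * D ^+ m.+1 * alpha ^- m.+3)%:E)%E.
  by apply: up => //; exact: ltW.
have phi2 : Hk0 R 2 phi by exact: test_fun_Hk0.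
split; apply: (adams_sup_lt (phi := phi) ab) => //.
- by move=> u [Hu ru]; exact: up'.
- exact: Hk0_H2N.
- by move=> u [/Hk0_H2N Hu ru]; exact: up'.
Qed.
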